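(* Let $s=\frac{766}{\sqrt{625565}}$, $c=\frac{197}{\sqrt{625565}}$ and $T=\operatorname{conv}\{(-c,0),(c,0),(0,s)\}\subset\mathbb R^2$. Then $$E(T)\ \ge\ D:=\frac{82074390584}{84861020075}.$$
   Context: An arc (path) is a rectifiable curve in $\mathbb R^2$ (the image of a continuous map $[0,1]\to\mathbb R^2$ of finite length), and $\operatorname{len}$ is its length. For a compact convex set $K\subset\mathbb R^2$ with nonempty interior, a rectifiable arc $\Gamma$ is an escape path for $K$ if no translated and rotated copy of $\Gamma$ (i.e. no set $z+R_\theta\Gamma$ with $z\in\mathbb R^2$ and $R_\theta$ the rotation by angle $\theta$) is contained in the interior of $K$. Put $E(K):=\inf\{\operatorname{len}(\Gamma):\Gamma\text{ is an escape path for }K\}$. *)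

(* Defs.v *)
From mathcomp Require Import all_boot all_order all_algebra.
From mathcomp Require Import all_classical all_reals all_analysis.

Set Implicit Arguments.
Unset Strict Implicit.
Unset Printing Implicit Defensive.

Import Order.TTheory GRing.Theory Num.Theory.
Import numFieldNormedType.Exports.

Local Open Scope classical_set_scope.
Local Open Scope ring_scope.

(* The library norm on a product is the max norm: it induces the usual topology
   of the plane, but lengths must be measured with [edist] below. *)
Notation plane R := (R^o * R^o)%type.

Definition edist (R : realType) (p q : plane R) : R :=
  Num.sqrt ((p.1 - q.1) ^+ 2 + (p.2 - q.2) ^+ 2).

(* For the subdivision a < s_0 < ... < s_(n-1) = b; compare [variation]. *)
Definition polygonal_length (R : realType) (a b : R) (gamma : R -> plane R)
    (s : seq R) : R :=
  let F := gamma \o nth b (a :: s) in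
  \sum_(0 <= n < size s) edist (F n.+1) (F n).

(* An arc is represented by a parametrization gamma, of which only the values on
   [0, 1] matter. Length is that of the curve, so it counts multiplicity; being
   an escape path depends only on the image. *)
Definition len (R : realType) (gamma : R -> plane R) : \bar R :=
  ereal_sup [set (polygonal_length 0 1 gamma s)%:E | s in itv_partition 0 1].

Definition rectifiable_arc (R : realType) (gamma : R -> plane R) : Prop :=
  {within `[0, 1], continuous gamma} /\ (len gamma < +oo)%E.

Definition trace (R : realType) (gamma : R -> plane R) : set (plane R) :=
  gamma @` `[0, 1].

Definition rotation (R : realType) (theta : R) (p : plane R) : plane R :=
  (cos theta * p.1 - sin theta * p.2, sin theta * p.1 + cos theta * p.2).

Definition escape_path (R : realType) (K : set (plane R))
    (gamma : R -> plane R) : Prop :=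
  rectifiable_arc gamma /\
  forall (z : plane R) (theta : R),
    ~ ([set z + rotation theta p | p in trace gamma] `<=` interior K).

(* Meant for K compact and convex with nonempty interior. *)
Definition escape_length (R : realType) (K : set (plane R)) : \bar R :=
  ereal_inf [set len gamma | gamma in escape_path K].

Definition convex_hull (R : realType) (A : set (plane R)) : set (plane R) :=
  smallest (@convex_set R (plane R)) A.

(* Main.v *)
From Stdlib Require Import ZArith.
From HB Require Import structures.
Require Import Defs.
From mathcomp Require Import all_boot all_order all_algebra.
From mathcomp Require Import all_classical all_reals all_analysis.
From mathcomp Require Import ring lra zify ssrZ.

Set Implicit Arguments.
Unset Strict Implicit.
Unset Printing Implicit Defensive.

Import Order.TTheory GRing.Theory Num.Theory.
Import numFieldNormedType.Exports.

(** Let R, L, B be the outer normals of the triangle along its right leg, left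
    leg and base, scaled so that they sum to zero and the leg normals have
    length 1. If a curve cannot be moved into the interior of the triangle, then
    for every rotation e its support values along e R, e L and e B sum to at
    least w, the altitude onto a leg: otherwise the rotated curve could be
    translated into the interior ([fits_inside]). The points of a fine net of
    the curve keep this property up to an error, so it is enough to bound the
    length of finite sequences of points from below ([polygon_bound]).

    Lower bounds come from [calibration]: if vectors W_i with sum zero are
    attached to the points, and the partial sums of the W_i in time order have
    norm at most K, then the sum of the W_i . p_i is at most K times the length.
    Here D = 2 w / K. So one looks for a few rotated circumscribed triangles
    whose contact points are visited in an order that allows their width
    inequalities to be combined, with total weight 2, under that constraint.

    The time order is controlled by minimality. Choose the fewest points that
    are still too wide, and order them by a shortest tour. Each point is then a
    strict vertex of the hull, and reversing a part of the tour does not shorten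
    it; hence two points visited before two others never lie on a line that
    separates these others ([separated_same_side]).

    If a point touches both legs of some circumscribed triangle, the base is far
    away and the bound is easy ([common_contact_bound]). Otherwise turn the
    triangle from a position where the first point alone touches the right leg
    to one where the last point alone does. The order in time of the contacts
    with the two legs is reversed on the way, and at the moment of reversal one
    leg touches two points while the other leg touches a point visited between
    them ([flip_between]). Reversing time gives a second such triangle, in which
    the hull edge on the doubly touched leg has the other orientation.

    If both triangles are doubly touched on the same leg, the time order of the
    six contacts is essentially forced ([opposite_edges_order]); the extremal
    curves look like the letter Z, and [two_straddles_bound] combines the two
    width inequalities. If the doubly touched legs differ, the triangles are
    either separated in time, which the same bound covers, or they stand on a
    common hull edge and are mirror images of each other; the extremal curves
    then look like the letter U, and four further triangles, slightly rotated,
    are needed ([common_edge_bound]). *)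

Local Open Scope ring_scope.

(** * Plane vectors and the calibration inequality *)

Section Plane.
Variable R : rcfType.
Implicit Types u v e : R * R.

Definition dot u v : R := u.1 * v.1 + u.2 * v.2.
Definition det u v : R := u.1 * v.2 - u.2 * v.1.
Definition vsub u v : R * R := (u.1 - v.1, u.2 - v.2).
Definition cmul e v : R * R := (e.1 * v.1 - e.2 * v.2, e.2 * v.1 + e.1 * v.2).
Definition dist u v : R := Num.sqrt ((u.1 - v.1) ^+ 2 + (u.2 - v.2) ^+ 2).

Lemma dist_ge0 u v : 0 <= dist u v.
Proof. exact: sqrtr_ge0. Qed.
Lemma dist_sym u v : dist u v = dist v u.
Proof. by rewrite /dist; congr Num.sqrt; ring. Qed.

Lemma sqr_dist u v : dist u v ^+ 2 = dot (vsub u v) (vsub u v).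
Proof.
by rewrite /dist sqr_sqrtr ?addr_ge0 ?sqr_ge0.
Qed.

Lemma dot_CS u v : dot u v ^+ 2 <= dot u u * dot v v.
Proof.
rewrite -subr_ge0; suff -> : dot u u * dot v v - dot u v ^+ 2 = det u v ^+ 2 by exact: sqr_ge0.
by rewrite /dot /det; ring.
Qed.

Lemma dot_le_dist u K p q : 0 <= K -> dot u u <= K ^+ 2 ->
  dot u (vsub p q) <= K * dist p q.
Proof.
move=> K0 hu; have d0 := dist_ge0 p q; have hd := sqr_dist p q.
have [h|h] := ltP (dot u (vsub p q)) 0.
  by apply: le_trans (ltW h) _; apply: mulr_ge0.
rewrite -ler_sqr ?nnegrE ?mulr_ge0 // exprMn hd.
apply: le_trans (dot_CS _ _) _.
by rewrite ler_wpM2r // /dot -!expr2 addr_ge0 ?sqr_ge0.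
Qed.

(** Only the first [n] terms of [p] count as points. *)
Definition path_length (p : nat -> R * R) n := \sum_(0 <= k < n.-1) dist (p k.+1) (p k).

(** [W] attaches vectors to indices of points; an index may occur repeatedly. *)
Definition partial_sum (W : seq (nat * (R * R))) k : R * R :=
  (\sum_(x <- W | (x.1 <= k)%N) x.2.1, \sum_(x <- W | (x.1 <= k)%N) x.2.2).

(** Summation by parts: since the total is zero, the left side is minus the sum over
    the edges of the path of the edge vector paired with the partial sum at that
    moment, and each edge contributes at most [K] times its length. *)
Lemma calibration (p : nat -> R * R) n (W : seq (nat * (R * R))) K :
  0 <= K -> (0 < n)%N -> all (fun x => x.1 < n)%N W ->
  (forall k, dot (partial_sum W k) (partial_sum W k) <= K ^+ 2) ->
  partial_sum W n = (0, 0) ->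
  \sum_(x <- W) dot x.2 (p x.1) <= K * path_length p n.
Proof.
case: n => // n K0 _ hW hK h0; rewrite /path_length /=.
have step x : x \in W -> dot x.2 (p x.1) = dot x.2 (p n) -
    \sum_(0 <= k < n) (if (x.1 <= k)%N then dot x.2 (vsub (p k.+1) (p k)) else 0).
  move/(allP hW); rewrite ltnS; case: x => i c /= hi.
  have tel : \sum_(i <= k < n) dot c (vsub (p k.+1) (p k)) = dot c (p n) - dot c (p i).
    rewrite (eq_bigr (fun k => dot c (p k.+1) - dot c (p k))); last first.
      by move=> k _; rewrite /dot /=; ring.
    exact: telescope_sumr.
  rewrite (@big_cat_nat _ _ _ i) //= big_nat big1; last first.
    by move=> k /andP[_ hk]; rewrite leqNgt hk.
  rewrite add0r big_nat (eq_bigr (fun k => dot c (vsub (p k.+1) (p k)))); last first.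
    by move=> k /andP[-> _].
  by rewrite -big_nat tel; ring.
rewrite big_seq (eq_bigr _ step) -big_seq sumrB.
have -> : \sum_(x <- W) dot x.2 (p n) = 0.
  rewrite /dot big_split /= -!mulr_suml.
  move: h0; rewrite /partial_sum => -[].
  have all_in (F : nat * (R * R) -> R) :
      \sum_(x <- W | (x.1 <= n.+1)%N) F x = \sum_(x <- W) F x.
    rewrite big_mkcond big_seq [RHS]big_seq; apply: eq_bigr => x /(allP hW) hx.
    by rewrite ltnW.
  by rewrite !all_in => -> ->; rewrite !mul0r addr0.
rewrite sub0r exchange_big /= -sumrN mulr_sumr; apply: ler_sum => k _.
rewrite dist_sym; apply: le_trans (dot_le_dist _ (p k.+1) K0 (hK k)).
rewrite -big_mkcond /= /dot /partial_sum /= !mulr_suml -big_split /= -sumrN.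
by apply: ler_sum => x _; rewrite le_eqVlt; apply/orP; left; apply/eqP; ring.
Qed.
End Plane.

(** * Normals of the triangle and an exact certificate *)

Delimit Scope Z_scope with BZ.

Section Certificate.
Variable R : rcfType.
Implicit Types u v e : R * R.

(** The numerical constants are sealed behind opaque existence proofs, since
    conversion would otherwise expand the unary numerals in them. The triangle has
    legs of length 1, and [apex_sin] is also its altitude onto a leg. *)
Fact apex_sin_key : {x : R | x = (301804%:R / 625565%:R)}.
Proof. by exists (301804%:R / 625565%:R). Qed.
Definition apex_sin : R := sval apex_sin_key.
Lemma apex_sin_def : apex_sin = (301804%:R / 625565%:R).
Proof. exact: svalP apex_sin_key. Qed.
Fact apex_cos_key : {x : R | x = (547947%:R / 625565%:R)}.
Proof. by exists (547947%:R / 625565%:R). Qed.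
Definition apex_cos : R := sval apex_cos_key.
Lemma apex_cos_def : apex_cos = (547947%:R / 625565%:R).
Proof. exact: svalP apex_cos_key. Qed.

(** The constant of the theorem is [2 * apex_sin / Kbound]. *)
Fact Kbound_key : {x : R | x = (135655%:R / 135973%:R)}.
Proof. by exists (135655%:R / 135973%:R). Qed.
Definition Kbound : R := sval Kbound_key.
Lemma Kbound_def : Kbound = (135655%:R / 135973%:R).
Proof. exact: svalP Kbound_key. Qed.

(** Outer normals in the frame in which the right leg lies horizontally at the bottom.
    The leg normals are unit vectors, and the base normal is as long as the base, so
    that the three sum to zero; with this scaling the support values of the triangle
    itself sum to [apex_sin]. *)
Definition uR : R * R := (0, -1).
Definition uL : R * R := (apex_sin, apex_cos).
Definition uB : R * R := (- apex_sin, 1 - apex_cos).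
Definition mir v : R * R := (- v.1, v.2).
Definition scl k v : R * R := (k * v.1, k * v.2).

(** Two clockwise rotations, by about 15.2 and 14.3 degrees; together with the weights
    below they come from numerical optimization. *)
Fact frame_A_key : {x : R * R | x = (221%:R / 229%:R, - (60%:R / 229%:R))}.
Proof. by exists (221%:R / 229%:R, - (60%:R / 229%:R)). Qed.
Definition frame_A : R * R := sval frame_A_key.
Lemma frame_A_def : frame_A = (221%:R / 229%:R, - (60%:R / 229%:R)).
Proof. exact: svalP frame_A_key. Qed.
Fact frame_B_key : {x : R * R | x = (63%:R / 65%:R, - (16%:R / 65%:R))}.
Proof. by exists (63%:R / 65%:R, - (16%:R / 65%:R)). Qed.
Definition frame_B : R * R := sval frame_B_key.
Lemma frame_B_def : frame_B = (63%:R / 65%:R, - (16%:R / 65%:R)).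
Proof. exact: svalP frame_B_key. Qed.
Fact wt_main_key : {x : R | x = (9193%:R / 10000%:R)}.
Proof. by exists (9193%:R / 10000%:R). Qed.
Definition wt_main : R := sval wt_main_key.
Lemma wt_main_def : wt_main = (9193%:R / 10000%:R).
Proof. exact: svalP wt_main_key. Qed.
Fact wt_A_key : {x : R | x = (15%:R / 1000%:R)}.
Proof. by exists (15%:R / 1000%:R). Qed.
Definition wt_A : R := sval wt_A_key.
Lemma wt_A_def : wt_A = (15%:R / 1000%:R).
Proof. exact: svalP wt_A_key. Qed.
Fact wt_B_key : {x : R | x = (657%:R / 10000%:R)}.
Proof. by exists (657%:R / 10000%:R). Qed.
Definition wt_B : R := sval wt_B_key.
Lemma wt_B_def : wt_B = (657%:R / 10000%:R).
Proof. exact: svalP wt_B_key. Qed.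
Definition vadd u v : R * R := (u.1 + v.1, u.2 + v.2).

(** The partial sums of the certificate are compared exactly, by computation with
    integers. *)
Definition Zr (z : Z) : R := (int_of_Z z)%:~R.
Lemma zrD (x y : Z) : Zr (x + y)%BZ = Zr x + Zr y.
Proof. by rewrite /Zr -rmorphD /= -(rmorphD int_of_Z). Qed.
Lemma zrM (x y : Z) : Zr (x * y)%BZ = Zr x * Zr y.
Proof. by rewrite /Zr -rmorphM /= -(rmorphM int_of_Z). Qed.
Lemma zr_le (x y : Z) : (x <=? y)%BZ -> Zr x <= Zr y.
Proof. by move=> h; rewrite /Zr ler_int; lia. Qed.
Lemma zr1 : Zr (Z.pos xH) = 1.
Proof. by []. Qed.
Lemma zrO p : Zr (Z.pos p~0) = 2%:R * Zr (Z.pos p).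
Proof. by rewrite (_ : Z.pos p~0 = 2 * Z.pos p)%BZ // zrM. Qed.
Lemma zrI p : Zr (Z.pos p~1) = 2%:R * Zr (Z.pos p) + 1.
Proof. by rewrite (_ : Z.pos p~1 = 2 * Z.pos p + 1)%BZ // zrD zrM. Qed.
Lemma zrN p : Zr (Z.neg p) = - Zr (Z.pos p).
Proof. by rewrite (_ : Z.neg p = -1 * Z.pos p)%BZ // zrM mulN1r. Qed.
Lemma zr0 : Zr Z0 = 0.
Proof. by []. Qed.
Definition zrE := (zrN, zrI, zrO, zr1, zr0).

Definition cert_den := 12661173519543250000%BZ.
Definition cert_bound := 12631562838163750000%BZ.
Definition left_num : seq (Z * Z) :=
 [:: (-5615439727113614060, 1444179668722430770); (0, -11639416816516109725);
     (-82250834451747000, 46747887994411500); (-49760070600825000, -183282926713038750);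
     (-132010905052572000, 136535038718627250); (-363566675425866516, 198822754904665662);
     (-204760393903751760, -806244050996022555); (-568327069329618276, 607421296091356893)]%BZ.
Definition mid_num : seq (Z * Z) := [:: (-5615439727113614060, 10195237147793678955);
  (5615439727113614060, 10195237147793678955)]%BZ.
Definition Zfrac (a b : Z) : R := Zr a / Zr b.
Definition Zvec (z : Z * Z) : R * R := (Zfrac z.1 cert_den, Zfrac z.2 cert_den).
Definition left_vecs : seq (R * R) :=
  [:: scl wt_main uB; scl wt_main uR; scl wt_A (cmul frame_A uB); scl wt_A (cmul frame_A uR);
  scl wt_A (mir (cmul frame_A uL)); scl wt_B (cmul frame_B uB); scl wt_B (cmul frame_B uR);
    scl wt_B (mir (cmul frame_B uL))].

Lemma zr_eq0 (a : Z) : (Zr a == 0) = (a =? 0)%BZ.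
Proof. by rewrite /Zr intr_eq0; lia. Qed.

(** Reified rational expressions, normalized to a fraction without cancellation; they
    serve to check that the vectors of the certificate have denominator [cert_den]. *)
Inductive qexpr := QConst of Z & Z | QAdd of qexpr & qexpr | QMul of qexpr & qexpr | QOpp of qexpr.
Fixpoint qexpr_val x : R := match x with
  QConst a b => Zfrac a b | QAdd x y => qexpr_val x + qexpr_val y | QMul x y => qexpr_val x *
    qexpr_val y | QOpp x => - qexpr_val x end.
Fixpoint qexpr_frac x : Z * Z := match x with
  QConst a b => (a, b)
| QAdd x y => let: (a, b) := qexpr_frac x in let: (c, d) := qexpr_frac y in (a * d + c * b,
  b * d)%BZ
| QMul x y => let: (a, b) := qexpr_frac x in let: (c, d) := qexpr_frac y in (a * c, b * d)%BZ
| QOpp x => let: (a, b) := qexpr_frac x in (- a, b)%BZ end.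
Fixpoint qexpr_ok x := match x with
  QConst a b => ~~ (b =? 0)%BZ | QAdd x y | QMul x y => qexpr_ok x && qexpr_ok y | QOpp x =>
    qexpr_ok x end.
Lemma qexpr_frac_correct x : qexpr_ok x -> ~~ ((qexpr_frac x).2 =? 0)%BZ /\
  qexpr_val x = Zfrac (qexpr_frac x).1 (qexpr_frac x).2.
Proof.
elim: x => [a b|x IHx y IHy|x IHx y IHy|x IHx] //=.
- case/andP=> /IHx[hx ->] /IHy[hy ->]; move: (qexpr_frac x) (qexpr_frac y) hx hy => [a b] [c d] /=.
  rewrite -!zr_eq0 zrM mulf_eq0 negb_or => hb hd; split; first by rewrite hb hd.
  by rewrite /Zfrac zrD !zrM; field; rewrite hb hd.
- case/andP=> /IHx[hx ->] /IHy[hy ->]; move: (qexpr_frac x) (qexpr_frac y) hx hy => [a b] [c d] /=.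
  rewrite -!zr_eq0 zrM mulf_eq0 negb_or => hb hd; split; first by rewrite hb hd.
  by rewrite /Zfrac !zrM; field; rewrite hb hd.
- move=> /IHx[hx ->]; move: (qexpr_frac x) hx => [a b] /= hb; split=> //.
  by rewrite /Zfrac -mulNr; congr (_ / _); rewrite /Zr (rmorphN int_of_Z) rmorphN.
Qed.
Definition qexpr_eq (z : Z * Z) (x : qexpr) :=
  qexpr_ok x && (let: (a, b) := qexpr_frac x in (a * z.2 =? z.1 * b)%BZ).
Lemma qexpr_eqP z x : ~~ (z.2 =? 0)%BZ -> qexpr_eq z x -> qexpr_val x = Zfrac z.1 z.2.
Proof.
move=> hz /andP[hx]; have [hb ->] := qexpr_frac_correct hx.
move: (qexpr_frac x) hb hz => [a b] /=; rewrite -!zr_eq0 => hb hd h.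
by apply/eqP; rewrite /Zfrac eqr_div // -!zrM; apply/eqP; congr Zr; lia.
Qed.
Lemma zq_lit (x y : R) (a b : Z) : x = Zr a -> y = Zr b -> x / y = Zfrac a b.
Proof. by move=> -> ->. Qed.
Lemma scalar_constE : [/\ apex_sin = Zfrac 301804 625565, apex_cos = Zfrac 547947 625565,
  wt_main = Zfrac 9193 10000,
  wt_A = Zfrac 15 1000 & wt_B = Zfrac 657 10000].
Proof. by rewrite apex_sin_def apex_cos_def wt_main_def wt_A_def wt_B_def; split; apply: zq_lit;
  rewrite !zrE; ring. Qed.
Lemma vector_constE : [/\ frame_A = (Zfrac 221 229, Zfrac (-60) 229), frame_B = (Zfrac 63 65,
  Zfrac (-16) 65), 0 = Zfrac 0 1 & 1 = Zfrac 1 1].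
Proof.
have h x y z t (a b c d : Z) : x = Zr a -> y = Zr b -> z = Zr c -> t = Zr d ->
  (x / y, z / t) = (Zfrac a b, Zfrac c d) by move=> -> -> -> ->.
rewrite frame_A_def frame_B_def; split; rewrite -?mulNr; try (apply: h; rewrite !zrE; ring).
- by rewrite /Zfrac zr0 mul0r.
- by rewrite /Zfrac zr1 divr1.
Qed.

Definition qscl k (v : qexpr * qexpr) := (QMul k v.1, QMul k v.2).
Definition qcmul (e v : qexpr * qexpr) :=
  (QAdd (QMul e.1 v.1) (QOpp (QMul e.2 v.2)), QAdd (QMul e.2 v.1) (QMul e.1 v.2)).
Definition qmir (v : qexpr * qexpr) := (QOpp v.1, v.2).
Definition left_qexprs : seq (qexpr * qexpr) :=
 let wt_main := QConst 9193 10000 in let wt_A := QConst 15 1000 in let wt_B := QConst 657 10000 in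
 let w := QConst 301804 625565 in let apex_cos := QConst 547947 625565 in
 let uB := (QOpp w, QAdd (QConst 1 1) (QOpp apex_cos)) in let uR := (QConst 0 1,
   QOpp (QConst 1 1)) in let uL := (w, apex_cos) in
 let frame_A := (QConst 221 229, QConst (-60) 229) in let frame_B := (QConst 63 65,
   QConst (-16) 65) in
 [:: qscl wt_main uB; qscl wt_main uR; qscl wt_A (qcmul frame_A uB); qscl wt_A (qcmul frame_A uR);
  qscl wt_A (qmir (qcmul frame_A uL)); qscl wt_B (qcmul frame_B uB);
    qscl wt_B (qcmul frame_B uR); qscl wt_B (qmir (qcmul frame_B uL))].

Lemma qexpr_vecs_eq (N : Z) (l : seq (qexpr * qexpr)) (z : seq (Z * Z)) : ~~ (N =? 0)%BZ ->
  size l = size z ->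
  all (fun x => qexpr_eq (x.2.1, N) x.1.1 && qexpr_eq (x.2.2, N) x.1.2) (zip l z) ->
  [seq (qexpr_val x.1, qexpr_val x.2) | x <- l] = [seq (Zfrac x.1 N, Zfrac x.2 N) | x <- z].
Proof.
move=> hN; elim: l z => [|x l IH] [|y z] //= [hs] /andP[/andP[h1 h2]] /(IH _ hs) ->.
by rewrite (@qexpr_eqP (y.1, N) x.1 hN h1) (@qexpr_eqP (y.2, N) x.2 hN h2).
Qed.

Lemma left_vecsE : left_vecs = map Zvec left_num.
Proof.
rewrite -(@qexpr_vecs_eq cert_den left_qexprs); [|by vm_compute|exact: erefl|by vm_compute].
have [hw hc ho ha hb] := scalar_constE; have [hA hB h0 h1] := vector_constE.
by rewrite /left_vecs /scl /mir /cmul /uR /uL /uB hA hB hw hc ho ha hb h0 h1.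
Qed.

Lemma zq_opp (a b : Z) : Zfrac (- a)%BZ b = - Zfrac a b.
Proof. by rewrite /Zfrac -mulNr; congr (_ / _); rewrite /Zr (rmorphN int_of_Z) rmorphN. Qed.
Lemma zq_addM (a b N : Z) : Zfrac (a + b)%BZ N = Zfrac a N + Zfrac b N.
Proof. by rewrite /Zfrac zrD mulrDl. Qed.

Definition mir_num (z : Z * Z) := ((- z.1)%BZ, z.2).
Definition right_vecs := map mir left_vecs.
Definition right_num := map mir_num left_num.
Lemma right_vecsE : right_vecs = map Zvec right_num.
Proof.
rewrite /right_vecs /right_num left_vecsE -!map_comp; apply: eq_map => z.
by rewrite /= /mir /Zvec /mir_num /= zq_opp.
Qed.

(** The contacts on one side are not ordered in time among themselves, so all subset
    sums have to be bounded. *)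
Fixpoint subset_sums_le (B : Z) (l : seq (Z * Z)) (x y : Z) : bool :=
  if l is c :: l' then subset_sums_le B l' x y && subset_sums_le B l' (x + c.1)%BZ (y + c.2)%BZ
  else (x * x + y * y <=? B * B)%BZ.

Lemma KboundE : Kbound = Zfrac cert_bound cert_den.
Proof.
have -> : Kbound = Zfrac 135655 135973 by rewrite Kbound_def; apply: zq_lit; rewrite !zrE; ring.
have hM : ~~ (cert_den =? 0)%BZ by vm_compute.
apply: (@qexpr_eqP (cert_bound, cert_den) (QConst 135655 135973) hM).
by vm_compute.
Qed.

Lemma partial_sum_cons x W k : partial_sum (x :: W) k =
  vadd (if (x.1 <= k)%N then x.2 else (0, 0)) (partial_sum W k).
Proof.
rewrite /partial_sum /vadd !big_cons; case: ifP => _ //=.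
by rewrite !add0r.
Qed.
Lemma partial_sum_nil k : partial_sum (nil : seq (nat * (R * R))) k = (0, 0).
Proof. by rewrite /partial_sum !big_nil. Qed.

Lemma subset_sums_leP (N B : Z) l x y ts k : size ts = size l -> subset_sums_le B l x y ->
  let V := vadd (Zfrac x N, Zfrac y N) (partial_sum (zip ts [seq (Zfrac z.1 N,
    Zfrac z.2 N) | z <- l]) k) in
  dot V V <= Zfrac B N ^+ 2.
Proof.
elim: l x y ts => [|c l IH] x y [|i ts] //=.
  rewrite partial_sum_nil /vadd /dot /= !addr0 => _ h; rewrite /Zfrac.
  have -> : Zr x / Zr N * (Zr x / Zr N) + Zr y / Zr N * (Zr y / Zr N) =
    Zr (x * x + y * y)%BZ / Zr N ^+ 2 by rewrite zrD !zrM expr2 invfM; ring.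
  have -> : (Zr B / Zr N) ^+ 2 = Zr (B * B)%BZ / Zr N ^+ 2.
    by rewrite zrM expr2 [Zr N ^+ 2]expr2 invfM; ring.
  by rewrite ler_wpM2r ?invr_ge0 ?sqr_ge0 // zr_le.
move=> [hs] /andP[h1 h2]; rewrite partial_sum_cons /=; case: ifP => _.
  have := IH _ _ ts hs h2; rewrite /= /vadd /= !zq_addM.
  by rewrite !addrA.
have := IH _ _ ts hs h1; rewrite /= /vadd /= !add0r.
by [].
Qed.

Lemma partial_sum_cat W1 W2 k : partial_sum (W1 ++ W2) k =
  vadd (partial_sum W1 k) (partial_sum W2 k).
Proof. by rewrite /partial_sum /vadd !big_cat. Qed.

Lemma partial_sum_before (ts : seq nat) (cs : seq (R * R)) k :
  all (fun t => (k < t)%N) ts -> partial_sum (zip ts cs) k = (0, 0).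
Proof.
elim: ts cs => [|t ts IH] [|c cs] /=; rewrite ?partial_sum_nil // => /andP[ht /(IH cs) h].
by rewrite partial_sum_cons h /= leqNgt ht /vadd /= addr0.
Qed.

Fixpoint vec_sum (l : seq (Z * Z)) : Z * Z :=
  if l is c :: l' then let s := vec_sum l' in ((c.1 + s.1)%BZ, (c.2 + s.2)%BZ) else (0%BZ, 0%BZ).
Lemma partial_sum_after N (ts : seq nat) l k : size ts = size l ->
  all (fun t => (t <= k)%N) ts ->
  partial_sum (zip ts [seq (Zfrac z.1 N, Zfrac z.2 N) | z <- l]) k = (Zfrac (vec_sum l).1 N,
    Zfrac (vec_sum l).2 N).
Proof.
elim: ts l => [|t ts IH] [|c l] //=.
  by rewrite partial_sum_nil /Zfrac zr0 mul0r.
move=> [hs] /andP[ht hts]; rewrite partial_sum_cons (IH _ hs hts) /= ht /vadd /=.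
by rewrite !zq_addM.
Qed.

Definition mid_vecs : seq (R * R) := [:: scl wt_main (mir uL); scl wt_main uL].
Lemma mid_vecsE : mid_vecs = map Zvec mid_num.
Proof.
pose qmid := let wt_main :=
  QConst 9193 10000 in let uL := (QConst 301804 625565, QConst 547947 625565) in
  [:: qscl wt_main (qmir uL); qscl wt_main uL].
rewrite -(@qexpr_vecs_eq cert_den qmid); [|by vm_compute|exact: erefl|by vm_compute].
have [hw hc ho ha hb] := scalar_constE.
by rewrite /mid_vecs /scl /mir /uL hw hc ho.
Qed.

Lemma vec_sum_cat l1 l2 : vec_sum (l1 ++ l2) = ((vec_sum l1).1 + (vec_sum l2).1,
  (vec_sum l1).2 + (vec_sum l2).2)%BZ.
Proof. by elim: l1 => [|c l IH] /=; [case: (vec_sum l2) | rewrite IH /= !Z.add_assoc]. Qed.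
Lemma left_sums_le : subset_sums_le cert_bound left_num 0 0.
Proof. by vm_compute. Qed.
Lemma mid_sums_le : subset_sums_le cert_bound [::] (vec_sum (left_num ++ take 1 mid_num)).1
  (vec_sum (left_num ++ take 1 mid_num)).2.
Proof. by vm_compute. Qed.
Lemma right_sums_le : subset_sums_le cert_bound right_num (vec_sum (left_num ++ mid_num)).1
  (vec_sum (left_num ++ mid_num)).2.
Proof. by vm_compute. Qed.
Lemma vec_sum_total : vec_sum (left_num ++ mid_num ++ right_num) = (0%BZ, 0%BZ).
Proof. by vm_compute. Qed.

Definition certificate (tl tr : seq nat) b2 b1 : seq (nat * (R * R)) :=
  zip (tl ++ [:: b2; b1] ++ tr) (left_vecs ++ mid_vecs ++ right_vecs).

(** Time splits into three phases, before [b2], between [b2] and [b1], and after [b1];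
    in each phase the active vectors are a fixed collection and a subset of one list. *)
Lemma certificate_partial_sums (tl tr : seq nat) b2 b1 k : size tl = 8 -> size tr = 8 ->
  all (fun t => (t <= b2)%N) tl -> all (fun t => (b1 <= t)%N) tr -> (b2 <= b1)%N ->
  dot (partial_sum (certificate tl tr b2 b1) k) (partial_sum (certificate tl tr b2 b1) k) <=
    Kbound ^+ 2.
Proof.
move=> sl sr hl hr hb.
rewrite /certificate !zip_cat //; rewrite !partial_sum_cat.
have slz : size tl = size left_num by rewrite sl.
have srz : size tr = size right_num by rewrite sr.
rewrite left_vecsE right_vecsE mid_vecsE KboundE; move: left_sums_le mid_sums_le right_sums_le.
have assoc u v z : vadd u (vadd v z) = vadd (vadd u v) z.
  by rewrite /vadd /= !addrA.
have [h1|h1] := ltnP k b2.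
  move=> h _ _.
  rewrite [partial_sum (zip tr _) k]partial_sum_before; last first.
    by apply: sub_all hr => t; apply: leq_trans; apply: leq_trans hb.
  rewrite [partial_sum (zip [:: b2; b1] _) k]partial_sum_before; last first.
    by rewrite /= h1 (leq_trans h1 hb).
  have := @subset_sums_leP cert_den _ _ _ _ tl k slz h; rewrite /Zvec.
  by rewrite /vadd /= /Zfrac zr0 !mul0r !add0r !addr0.
have hl' : all (fun t => (t <= k)%N) tl.
  by apply: sub_all hl => t ht; apply: leq_trans ht h1.
have -> : partial_sum (zip tl (map Zvec left_num)) k = (Zfrac (vec_sum left_num).1 cert_den,
  Zfrac (vec_sum left_num).2 cert_den).
  exact: partial_sum_after.
have [h2|h2] := ltnP k b1.
  move=> _ h _.
  rewrite [partial_sum (zip tr _) k]partial_sum_before; last first.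
    by apply: sub_all hr => t; apply: leq_trans.
  have -> : partial_sum (zip [:: b2; b1] (map Zvec mid_num)) k =
    (Zfrac (vec_sum (take 1 mid_num)).1 cert_den, Zfrac (vec_sum (take 1 mid_num)).2 cert_den).
    rewrite /mid_num; set z1 := (_, _); set z2 := (_, _).
    rewrite [take _ _]/= [vec_sum _]/= !partial_sum_cons partial_sum_nil [fst _]/= [X in (X <=
      k)%N]/= h1.
    rewrite [fst _]/= leqNgt h2 /vadd /= !addr0 /Zfrac.
    exact: erefl.
  move: h; rewrite vec_sum_cat.
  generalize cert_den cert_bound (vec_sum left_num) (vec_sum (take 1 mid_num)) => N B [x y] [z t] h.
  have := @subset_sums_leP N B (nil : seq (Z * Z)) _ _ nil k erefl h.
  by rewrite partial_sum_nil /= /vadd /= !addr0 !zq_addM.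
move=> _ _.
have h12 : all (fun t => (t <= k)%N) [:: b2; b1] by rewrite /= h1 h2.
have -> : partial_sum (zip [:: b2; b1] (map Zvec mid_num)) k =
  (Zfrac (vec_sum mid_num).1 cert_den, Zfrac (vec_sum mid_num).2 cert_den).
  exact: (@partial_sum_after cert_den [:: b2; b1] mid_num k erefl h12).
rewrite assoc vec_sum_cat; move: srz.
have -> : map Zvec right_num = [seq (Zfrac z.1 cert_den,
  Zfrac z.2 cert_den) | z <- right_num] by [].
generalize cert_den cert_bound right_num (vec_sum left_num)
  (vec_sum mid_num) => N B l [x y] [z t] hl2 h.
have := @subset_sums_leP N B l _ _ tr k hl2 h.
by rewrite /= /vadd /= !zq_addM.
Qed.
End Certificate.

Section CertificateBound.
Variable R : rcfType.
Implicit Types u v e : R * R.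
Notation uR := (uR R). Notation uL := (uL R). Notation uB := (uB R).
Notation frame_A := (frame_A R).
Notation frame_B := (frame_B R).
Notation Kbound := (Kbound R).
Notation wt_main := (wt_main R). Notation wt_A := (wt_A R). Notation wt_B := (wt_B R).

Lemma dot_scl k u v : dot (scl k u) v = k * dot u v.
Proof. by rewrite /dot /scl /=; ring. Qed.
Lemma mir_scl k u : mir (scl k u) = scl k (mir u).
Proof. by rewrite /mir /scl /= mulrN. Qed.
Lemma mirK u : mir (mir u) = u.
Proof. by case: u => x y; rewrite /mir /= opprK. Qed.
Lemma Kbound_ge0 : 0 <= Kbound.
Proof. by rewrite Kbound_def divr_ge0 ?ler0n. Qed.

Lemma weights_sum : [/\ 0 <= wt_main, 0 <= wt_A, 0 <= wt_B & wt_main = 1 - wt_A - wt_B].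
Proof. by rewrite wt_main_def wt_A_def wt_B_def; split; lra. Qed.

(** Six width inequalities are combined: those of two mirror triangles standing on one
    hull edge, with weight [wt_main], and those of two auxiliary frames and of their
    mirror images, with weights [wt_A] and [wt_B]. The contacts on the left come before
    both upper contacts [b2] and [b1], and those on the right after them. *)
Theorem common_edge_certificate (p : nat -> R * R) n (rho : R)
  (q1 a ma ra ka mb rb kb b2 b1 q2 c na sa la nb sb lb : nat) :
  all (fun i => i < n)%N [:: q1; a; ma; ra; ka; mb; rb; kb; b2; b1; q2; c; na; sa; la; nb; sb;
    lb] ->
  all (fun i => i <= b2)%N [:: q1; a; ma; ra; ka; mb; rb; kb] -> (b2 <= b1)%N ->
  all (fun i => b1 <= i)%N [:: q2; c; na; sa; la; nb; sb; lb] ->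
  rho <= dot uR (p a) + dot uL (p b1) + dot uB (p q1) ->
  rho <= dot uR (p c) + dot (mir uL) (p b2) + dot (mir uB) (p q2) ->
  rho <= dot (cmul frame_A uR) (p ra) + dot (cmul frame_A uL) (p la) + dot (cmul frame_A uB)
    (p ma) ->
  rho <= dot (mir (cmul frame_A uR)) (p sa) + dot (mir (cmul frame_A uL)) (p ka) + dot (mir
    (cmul frame_A uB)) (p na) ->
  rho <= dot (cmul frame_B uR) (p rb) + dot (cmul frame_B uL) (p lb) + dot (cmul frame_B uB)
    (p mb) ->
  rho <= dot (mir (cmul frame_B uR)) (p sb) + dot (mir (cmul frame_B uL)) (p kb) + dot (mir
    (cmul frame_B uB)) (p nb) ->
  2%:R * rho <= Kbound * path_length p n.
Proof.
move=> hn hl hb hr f1 f2 f3 f4 f5 f6.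
set tl := [:: q1; a; ma; ra; ka; mb; rb; kb] in hl.
set tr := [:: q2; c; na; sa; la; nb; sb; lb] in hr.
have n0 : (0 < n)%N by case: n hn.
have bound k := @certificate_partial_sums R tl tr b2 b1 k erefl erefl hl hr hb.
have hall : all (fun x => x.1 < n)%N (certificate R tl tr b2 b1).
  exact: hn.
have tot : partial_sum (certificate R tl tr b2 b1) n = (0, 0).
  rewrite /certificate left_vecsE right_vecsE mid_vecsE -!map_cat (@partial_sum_after _
    (cert_den)) //; last first.
    by apply: sub_all hn => i /ltnW.
  by rewrite vec_sum_total /Zfrac zr0 !mul0r.
have := calibration p Kbound_ge0 n0 hall bound tot.
apply: le_trans; rewrite /certificate /tl /tr /right_vecs /left_vecs /mid_vecs /=.
rewrite !big_cons big_nil ![(_, _).1]/= ![(_, _).2]/= !mir_scl !mirK !dot_scl.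
have -> : mir uR = uR by rewrite /mir /= oppr0.
have [w0 wA wB w1] := weights_sum; move: f1 f2 f3 f4 f5 f6.
clear -w0 wA wB w1; move: w0 wA wB; rewrite w1; clear; move: (wt_A) (wt_B) => y z.
repeat match goal with |- context [dot ?a ?b] => generalize (dot a b); intro end.
move=> w0 wA wB f1 f2 f3 f4 f5 f6.
have := ler_wpM2l wA f3; have := ler_wpM2l wA f4; have := ler_wpM2l wB f5.
have := ler_wpM2l wB f6; have := ler_wpM2l w0 f1; have := ler_wpM2l w0 f2; lra.
Qed.
End CertificateBound.

(** * Two triangles with a doubly touched leg *)

Section TwoStraddles.
Variable R : rcfType.
Implicit Types u v : R * R.
Implicit Types x y c d e f : R.
Notation uR := (uR R). Notation uL := (uL R). Notation uB := (uB R).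
Notation Kbound := (Kbound R).

(** Squared length of [uB]; [leg_base] is the product of [uB] with either leg normal. *)
Fact base_sq_key : {x : R | x = (155236%:R / 625565%:R)}.
Proof. by exists (155236%:R / 625565%:R). Qed.
Definition base_sq : R := sval base_sq_key.
Lemma base_sq_def : base_sq = (155236%:R / 625565%:R).
Proof. exact: svalP base_sq_key. Qed.
Fact leg_base_key : {x : R | x = (- (77618%:R / 625565%:R))}.
Proof. by exists (- (77618%:R / 625565%:R)). Qed.
Definition leg_base : R := sval leg_base_key.
Lemma leg_base_def : leg_base = (- (77618%:R / 625565%:R)).
Proof. exact: svalP leg_base_key. Qed.

(** Squared norm of [x r1 + y s1 + x' r2 + y' s2], where [c], [d], [e], [f] are the
    products of [r1], [s1] with [r2], [s2]. *)
Definition comb_sq c d e f x y x' y' : R :=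
  x ^+ 2 + base_sq * y ^+ 2 + 2%:R * leg_base * x * y + x' ^+ 2 + base_sq * y' ^+ 2 + 2%:R *
    leg_base * x' * y'
  + 2%:R * (c * x * x' + d * x * y' + e * y * x' + f * y * y').

Definition comb (r1 s1 r2 s2 : R * R) x y x' y' : R * R :=
  (x * r1.1 + y * s1.1 + x' * r2.1 + y' * s2.1, x * r1.2 + y * s1.2 + x' * r2.2 + y' * s2.2).

(** [r] is a leg normal and [s] the base normal of one rotated triangle; its other leg
    has the normal [- r - s]. *)
Definition legbase (r s : R * R) := [/\ dot r r = 1, dot r s = leg_base & dot s s = base_sq].

Lemma combE r1 s1 r2 s2 x y x' y' : legbase r1 s1 -> legbase r2 s2 ->
  dot (comb r1 s1 r2 s2 x y x' y') (comb r1 s1 r2 s2 x y x' y') =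
  comb_sq (dot r1 r2) (dot r1 s2) (dot s1 r2) (dot s1 s2) x y x' y'.
Proof.
case=> h1 h2 h3 [h4 h5 h6]; rewrite /comb_sq.
have -> : x ^+ 2 + base_sq * y ^+ 2 + 2%:R * leg_base * x * y + x' ^+ 2 + base_sq * y' ^+ 2 +
  2%:R * leg_base * x' * y'
  = x ^+ 2 * dot r1 r1 + y ^+ 2 * dot s1 s1 + 2%:R * x * y * dot r1 s1
    + x' ^+ 2 * dot r2 r2 + y' ^+ 2 * dot s2 s2 + 2%:R * x' * y' * dot r2 s2.
  by rewrite h1 h2 h3 h4 h5 h6; ring.
by rewrite /dot /comb /=; ring.
Qed.

Definition switch (b : bool) x : R := if b then x else 0.

Lemma partial_sum_comb r1 s1 r2 s2 (W : seq (nat * (R * R * R * R))) k :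
  partial_sum [seq (z.1, let: (x, y, x', y') := z.2 in comb r1 s1 r2 s2 x y x' y') | z <- W] k =
  comb r1 s1 r2 s2 (\sum_(z <- W) switch (z.1 <= k)%N z.2.1.1.1) (\sum_(z <- W) switch (z.1 <=
    k)%N z.2.1.1.2)
     (\sum_(z <- W) switch (z.1 <= k)%N z.2.1.2) (\sum_(z <- W) switch (z.1 <= k)%N z.2.2).
Proof.
elim: W => [|[i [[[x y] x'] y']] W IH] /=.
  by rewrite partial_sum_nil !big_nil /comb /= !mul0r !addr0.
rewrite partial_sum_cons IH !big_cons /= /vadd /comb /=.
by case: ifP => _ /=; congr pair; ring.
Qed.

(** Coefficient of the normal of the doubly touched leg once the flagged contacts have
    been visited: its weight 1 is split into [1 - a] and [a] between the two contacts,
    and the contact with the other leg contributes -1. *)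
Definition leg_state a (sA sB sC : bool) : R := switch sA (1 - a) + switch sB (-1) + switch sC a.
Definition base_state (sB sQ : bool) : R := switch sB (-1) + switch sQ 1.

(** The sum of the width inequalities of two triangles, each of which touches two points
    with one leg; the shares given to these points are free parameters, chosen so that
    the partial sums stay small. *)
Lemma two_straddles_calibration (p : nat -> R * R) n (rho : R) r1 s1 r2 s2 a b
  (a1 b1 c1 q1 a2 b2 c2 q2 : nat) :
  legbase r1 s1 -> legbase r2 s2 ->
  all (fun i => i < n)%N [:: a1; b1; c1; q1; a2; b2; c2; q2] ->
  rho <= dot r1 (p a1) - dot r1 (p b1) - dot s1 (p b1) + dot s1 (p q1) ->
  rho <= dot r2 (p a2) - dot r2 (p b2) - dot s2 (p b2) + dot s2 (p q2) ->
  dot r1 (p a1) = dot r1 (p c1) -> dot r2 (p a2) = dot r2 (p c2) ->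
  (forall k, comb_sq (dot r1 r2) (dot r1 s2) (dot s1 r2) (dot s1 s2)
    (leg_state a (a1 <= k)%N (b1 <= k)%N (c1 <= k)%N) (base_state (b1 <= k)%N (q1 <= k)%N)
    (leg_state (1 - b) (a2 <= k)%N (b2 <= k)%N (c2 <= k)%N) (base_state (b2 <= k)%N (q2 <=
      k)%N) <= Kbound ^+ 2) ->
  2%:R * rho <= Kbound * path_length p n.
Proof.
move=> h1 h2 hn f1 f2 e1 e2 H.
pose W : seq (nat * (R * R * R * R)) :=
  [:: (a1, (1 - a, 0, 0, 0)); (b1, (-1, -1, 0, 0)); (c1, (a, 0, 0, 0));
  (q1, (0, 1, 0, 0)); (a2, (0, 0, b, 0)); (b2, (0, 0, -1, -1)); (c2, (0, 0, 1 - b, 0));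
    (q2, (0, 0, 0, 1))].
pose W' := [seq (z.1, let: (x, y, x', y') := z.2 in comb r1 s1 r2 s2 x y x' y') | z <- W].
have n0 : (0 < n)%N by case: n hn.
have hall : all (fun q => q.1 < n)%N W' by [].
have bound k : dot (partial_sum W' k) (partial_sum W' k) <= Kbound ^+ 2.
  rewrite partial_sum_comb combE //; apply: le_trans (H k).
  rewrite /W !big_cons !big_nil /= /leg_state /base_state le_eqVlt; apply/orP; left; apply/eqP.
  have i0 (s : bool) : switch s 0 = 0 by rewrite /switch; case: s.
  have -> : 1 - (1 - b) = b by ring.
  rewrite !i0; congr comb_sq; ring.
have tot : partial_sum W' n = (0, 0).
  have i1 (i : nat) x : (i < n)%N -> switch (i <= n)%N x = x by move=> /ltnW; rewrite /switch => ->.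
  move: hn; rewrite /= => /andP[g1 /andP[g2 /andP[g3 /andP[g4 /andP[g5 /andP[g6 /andP[g7 /andP[g8
    _]]]]]]]].
  rewrite partial_sum_comb /W !big_cons !big_nil /= !i1 // /comb.
  by congr pair; ring.
have := calibration p (Kbound_ge0 R) n0 hall bound tot.
apply: le_trans; rewrite /W' /W /= !big_cons big_nil /=.
have dc x y x' y' v : dot (comb r1 s1 r2 s2 x y x' y') v =
  x * dot r1 v + y * dot s1 v + x' * dot r2 v + y' * dot s2 v.
  by rewrite /dot /comb /=; ring.
rewrite !dc -e1 -e2; lra.
Qed.
End TwoStraddles.

Section EarlyLate.
Variable R : rcfType.
Implicit Types x y c d e f a b : R.
Notation base_sq := (base_sq R).
Notation leg_base := (leg_base R).
Notation Kbound := (Kbound R).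

Definition state_ok c d e f x y x' y' := comb_sq c d e f x y x' y' <= Kbound ^+ 2.

(** The states in which the leg coefficient of the first triangle vanishes but that of
    the second does not. *)
Definition side_states c d e f b := [/\ state_ok c d e f 0 0 b 0, state_ok c d e f 0 1 b 0,
  state_ok c d e f 0 0 (b - 1) 0, state_ok c d e f 0 0 (b - 1) (-1) &
  state_ok c d e f 0 1 (b - 1) 0 /\ state_ok c d e f 0 1 (b - 1) (-1)].

(** The states after [a1] and before [c2]; they do not occur for triangles that are
    separated in time. *)
Definition mid_states c d e f a b :=
  [/\ state_ok c d e f (1 - a) 0 (b - 1) 0, state_ok c d e f (1 - a) 0 (b - 1) (-1),
  state_ok c d e f (1 - a) 1 (b - 1) 0 & state_ok c d e f (1 - a) 1 (b - 1) (-1)].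

Lemma comb_sq_swap c d e f x y x' y' : comb_sq c d e f x y x' y' = comb_sq c e d f x' y' x y.
Proof. by rewrite /comb_sq; ring. Qed.
Lemma comb_sq_opp c d e f x y x' y' : comb_sq c d e f (- x) (- y) (- x') (- y') =
  comb_sq c d e f x y x' y'.
Proof. by rewrite /comb_sq; ring. Qed.

Ltac leaf h := by apply: le_trans h; rewrite le_eqVlt; apply/orP; left; apply/eqP;
  rewrite /comb_sq; ring.

Lemma base_sq_ge0 : 0 <= base_sq.
Proof. by rewrite base_sq_def; lra. Qed.
Lemma Kbound2_ge_4base_sq : 4%:R * base_sq <= Kbound ^+ 2.
Proof. by rewrite base_sq_def Kbound_def; lra. Qed.

(** A base contact is early or late according to whether it comes before or after the
    contact with the singly touched leg. Here the first is early and the second late; up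
    to exchanging the triangles and changing signs, the reachable states are those of
    [side_states] and [mid_states] and a few without leg coefficients. *)
Lemma early_late_states c d e f a b (sep : bool) : side_states c d e f b -> side_states c e d f a ->
  (~~ sep -> mid_states c d e f a b) -> f ^+ 2 <= base_sq ^+ 2 ->
  forall sA1 sB1 sC1 sQ1 sA2 sB2 sC2 sQ2 : bool,
  sB2 ==> sA2 -> sA1 ==> sB2 -> sC2 ==> sB2 -> sB1 ==> sA1 -> sB1 ==> sC2 -> sC1 ==> sB1 ->
  (sep ==> sA1 ==> sC2) -> sB1 ==> sQ1 -> sQ2 ==> sB2 ->
  state_ok c d e f (leg_state a sA1 sB1 sC1) (base_state _ sB1 sQ1) (leg_state
    (1 - b) sA2 sB2 sC2) (base_state _ sB2 sQ2).
Proof.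
move=> [h1 h2 h3 h4 [h5 h6]] [k1 k2 k3 k4 [k5 k6]] hm hf.
have [z1 z2 z3 z4] : [/\ state_ok c d e f 0 0 0 0, state_ok c d e f 0 1 0 0,
  state_ok c d e f 0 0 0 1
    & state_ok c d e f 0 1 0 (-1)].
  clear -hf; move: base_sq_ge0 Kbound2_ge_4base_sq hf; rewrite /state_ok /comb_sq;
    move: (base_sq) (leg_base) (Kbound ^+ 2) => B T K B0 BK hf.
  have ? : - B <= f by nra.
  split; lra.
clear hf.
rewrite /state_ok !(comb_sq_swap c e d f) in k1 k2 k3 k4 k5 k6.
case: sep hm => [_|/(_ isT)[m1 m2 m3 m4]]; case; case; case; case; case; case; case; case => //= *;
 rewrite /leg_state /base_state /switch /state_ok;
 first [leaf z1 | leaf z2 | leaf z3 | leaf z4 | leaf h1 | leaf h2 | leaf h3 | leaf h4 | leaf h5 |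
   leaf h6
   | leaf k1 | leaf k2 | leaf k3 | leaf k4 | leaf k5 | leaf k6 | leaf m1 | leaf m2 | leaf m3 |
     leaf m4 ].
Qed.
End EarlyLate.

Section Splits.
Variable R : rcfType.
Implicit Types x y c d e f a b : R.
Notation base_sq := (base_sq R).
Notation leg_base := (leg_base R).
Notation Kbound := (Kbound R).

(** In the application [d] and [f] are the products of a second base normal with the leg
    and base normals of a triangle, and the third hypothesis is Cauchy-Schwarz. The more
    negative [d] is, the larger the share [a] has to be; three values suffice. *)
Lemma split_parameter_exists d f : d ^+ 2 <= base_sq -> f ^+ 2 <= base_sq ^+ 2 ->
  (forall x, (x * d + f) ^+ 2 <= base_sq * (x ^+ 2 + 2%:R * x * leg_base + base_sq)) ->
  exists a, [/\ 1/5%:R <= a <= 3%:R/5%:R,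
   (1 - a) ^+ 2 + base_sq - 2%:R * (1 - a) * d <= Kbound ^+ 2 - 45%:R / 10000%:R,
   a ^+ 2 + base_sq + 2%:R * a * d <= Kbound ^+ 2 &
   a ^+ 2 + base_sq + base_sq + 2%:R * a * leg_base + 2%:R * a * d + 2%:R * f <= Kbound ^+ 2].
Proof.
move=> hd hf h.
have bE : base_sq = 155236%:R / 625565%:R := base_sq_def R.
have tE : leg_base = - (77618%:R / 625565%:R) := leg_base_def R.
have kE : 9953%:R / 10000%:R <= Kbound ^+ 2 by rewrite Kbound_def; lra.
have := h (248%:R / 1000%:R); clear h; rewrite bE tE in hd hf *.
move: (Kbound ^+ 2) kE => K kE h.
have d1 : d <= 49816%:R / 100000%:R by nra.
have d2 : - (49816%:R / 100000%:R) <= d by nra.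
have f1 : f <= 24816%:R / 100000%:R by nra.
have [h1|h1] := lerP (- (11%:R / 100%:R)) d.
  exists (248%:R / 1000%:R).
  have h2 : 248%:R / 1000%:R * d + f <= 2482%:R / 10000%:R by nra.
  split; lra.
have [h2|h2] := lerP (- (31%:R / 100%:R)) d.
  by exists (4%:R / 10%:R); split; lra.
by exists (505%:R / 1000%:R); split; lra.
Qed.

(** The shares 3/5 and 2/5 work for all relative positions of the triangles. *)
Lemma late_early_states c d e f : c ^+ 2 <= 1 ->
  forall sA1 sB1 sC1 sQ1 sA2 sB2 sC2 sQ2 : bool,
  sB2 ==> sA2 -> sA1 ==> sB2 -> sC2 ==> sB2 -> sB1 ==> sA1 -> sB1 ==> sC2 -> sC1 ==> sB1 ->
  sQ1 ==> sB1 -> sB2 ==> sQ2 ->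
  state_ok c d e f (leg_state (3%:R/5%:R) sA1 sB1 sC1) (base_state _ sB1 sQ1) (leg_state
    (2%:R/5%:R) sA2 sB2 sC2) (base_state _ sB2 sQ2).
Proof.
move=> hc; have c1 : - 1 <= c by nra.
have bE : base_sq = 155236%:R / 625565%:R := base_sq_def R.
have tE : leg_base = - (77618%:R / 625565%:R) := leg_base_def R.
have kE : 9953%:R / 10000%:R <= Kbound ^+ 2 by rewrite Kbound_def; lra.
rewrite /state_ok /comb_sq; move: bE tE kE; move: (base_sq) (leg_base)
  (Kbound ^+ 2) => B T K bE tE kE.
by case; case; case; case; case; case; case; case => //= *;
  rewrite /leg_state /base_state /switch; lra.
Qed.

(** The second triangle gives almost all its weight to its first contact, so that its leg
    coefficient nearly vanishes after [b2]; what remains is [split_parameter_exists]. *)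
Lemma late_late_states c d e f a b : b = 9976%:R / 10000%:R ->
  1/5%:R <= a <= 3%:R/5%:R -> c ^+ 2 <= 1 -> f ^+ 2 <= base_sq ^+ 2 ->
   (1 - a) ^+ 2 + base_sq - 2%:R * (1 - a) * d <= Kbound ^+ 2 - 45%:R / 10000%:R ->
   a ^+ 2 + base_sq + 2%:R * a * d <= Kbound ^+ 2 ->
   a ^+ 2 + base_sq + base_sq + 2%:R * a * leg_base + 2%:R * a * d + 2%:R * f <= Kbound ^+ 2 ->
  forall sA1 sB1 sC1 sQ1 sA2 sB2 sC2 sQ2 : bool,
  sB2 ==> sA2 -> sA1 ==> sB2 -> sC2 ==> sB2 -> sB1 ==> sA1 -> sB1 ==> sC2 -> sC1 ==> sB1 ->
  sQ1 ==> sB1 -> sQ2 ==> sB2 ->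
  state_ok c d e f (leg_state a sA1 sB1 sC1) (base_state _ sB1 sQ1) (leg_state
    (1 - b) sA2 sB2 sC2) (base_state _ sB2 sQ2).
Proof.
move=> bb /andP[a0 a1] hc hf h1 h2 h3.
have bE : base_sq = 155236%:R / 625565%:R := base_sq_def R.
have tE : leg_base = - (77618%:R / 625565%:R) := leg_base_def R.
have kE : 99532%:R / 100000%:R <= Kbound ^+ 2 by rewrite Kbound_def; lra.
rewrite /state_ok /comb_sq; move: hf h1 h2 h3 bE tE kE.
move: (base_sq) (leg_base) (Kbound ^+ 2) => B T K hf h1 h2 h3 bE tE kE.
have c1 : - 1 <= c by nra. have c2 : c <= 1 by nra.
have f1 : f <= 24816%:R / 100000%:R by rewrite bE in hf; nra.
have ac1 : 0 <= (1 - a) * (1 + c) by apply: mulr_ge0; lra.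
have ac2 : 0 <= (1 - a) * (1 - c) by apply: mulr_ge0; lra.
have aa : 0 <= (a - 1/5%:R) * (3%:R/5%:R - a) by apply: mulr_ge0; lra.
have aT : a * T = - (77618%:R / 625565%:R) * a by rewrite tE mulrC.
clear hc hf.
by case; case; case; case; case; case; case; case => //= *;
  rewrite /leg_state /base_state /switch ?bb; lra.
Qed.
End Splits.

Section RotatedSplits.
Variable R : rcfType.
Implicit Types x y c d e f a b C S : R.
Notation base_sq := (base_sq R).
Notation leg_base := (leg_base R).
Notation Kbound := (Kbound R).
Notation apex_sin := (apex_sin R).

(** The second triangle is the first one turned by an angle with cosine [C] and, up to
    sign, sine [S]. *)
Definition rot_side C S b :=
  side_states C (C * leg_base + S * apex_sin) (C * leg_base - S * apex_sin) (base_sq * C) b.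
Definition rot_mid C S a b :=
  mid_states C (C * leg_base + S * apex_sin) (C * leg_base - S * apex_sin) (base_sq * C) a b.

Lemma rot_side_mir C S b : rot_side C (- S) b -> side_states C (C * leg_base - S * apex_sin)
  (C * leg_base + S * apex_sin) (base_sq * C) b.
Proof. by rewrite /rot_side mulNr opprK. Qed.

Lemma rot_mid_mir C S a b : rot_mid C (- S) b a -> rot_mid C S a b.
Proof.
rewrite /rot_mid mulNr opprK /mid_states /state_ok => -[h1 h2 h3 h4].
split; rewrite comb_sq_swap -comb_sq_opp ?oppr0 ?opprK !opprB //.
Qed.

Ltac num := rewrite /state_ok /comb_sq ?base_sq_def ?leg_base_def ?apex_sin_def ?Kbound_def.

Lemma rot_states_wide C S : C ^+ 2 + S ^+ 2 = 1 -> - (1 / 2%:R) <= C -> 0 <= S ->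
  [/\ rot_side C S (76%:R / 100%:R), rot_side C (- S) (34%:R / 100%:R) &
    rot_mid C S (34%:R / 100%:R) (76%:R / 100%:R)].
Proof.
move=> h1 h2 h3; have h4 : C <= 1 by nra. have h5: S <= 1 by nra.
have h6 : -1 <= C by nra. have h7 : 0 <= C + S by nra.
split.
- split; last split; num; nra.
- split; last split; num; nra.
- split; num; nra.
Qed.

(** For nearly opposite triangles the best split depends on the angle; [b] is a fit that
    is affine in [C] and [S]. *)
Lemma rot_side_obtuse C S (b := 749158%:R/1000000%:R + 414%:R/1000%:R * S + - (3%:R/10%:R) *
  (1 + C) : R) : 
  C ^+ 2 + S ^+ 2 = 1 -> C <= - (1 / 5%:R) -> 
  rot_side C S b.
Proof.
rewrite /b => h1 h2.
have h3 : -1 <= C by nra. have h4 := sqr_ge0 (S).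
have h5 : 0 <= (1+C)*(-(1/5%:R) - C) by nra.
have h6 : 0 <= (1+C)*S^+2 by nra.
have h7 : 0 <= (-(1/5%:R)-C)*S^+2 by nra.
have e1 : S ^+ 2 = 1 - C ^+2 by lra.
have e2 : C * S ^+ 2 = C - C ^+3 by rewrite e1; ring.
have e3 : S ^+3 = S - S * C^+2 by rewrite exprS e1; ring.
have b1 : S <= 1 by nra.
have b2 : -1 <= S by nra.
have c1 : 0 <= (1+C)*(1-S) by nra.
have c2 : 0 <= (1+C)*(1+S) by nra.
split; last split; num; first [lra | nra].
Qed.

Lemma rot_mid_obtuse C S (m := 749158%:R/1000000%:R : R) (k := 414%:R/1000%:R : R) (h := -
  (3%:R/10%:R) : R)
 (a := m - k * S + h * (1 + C)) (b := m + k * S + h * (1 + C)) : C ^+ 2 + S ^+ 2 = 1 ->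
   C <= - (1 / 5%:R) -> 
  rot_mid C S a b.
Proof.
rewrite /a /b /m /k /h => h1 h2.
have h3 : -1 <= C by nra. have h4 := sqr_ge0 (S).
have h5 : 0 <= (1+C)*(-(1/5%:R) - C) by nra.
have h6 : 0 <= (1+C)*S^+2 by nra.
have h7 : 0 <= (-(1/5%:R)-C)*S^+2 by nra.
have e1 : S ^+ 2 = 1 - C ^+2 by lra.
have e2 : C * S ^+ 2 = C - C ^+3 by rewrite e1; ring.
have e3 : S ^+3 = S - S * C^+2 by rewrite exprS e1; ring.
have b1 : S <= 1 by nra.
have b2 : -1 <= S by nra.
have c1 : 0 <= (1+C)*(1-S) by nra.
have c2 : 0 <= (1+C)*(1+S) by nra.
split; num; first [lra | nra].
Qed.

Lemma rot_states C S : C ^+ 2 + S ^+ 2 = 1 ->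
  exists a b, [/\ rot_side C S b, rot_side C (- S) a & rot_mid C S a b].
Proof.
move=> h; have hN : C ^+ 2 + (- S) ^+ 2 = 1 by rewrite sqrrN.
have [h1|h1] := lerP C (- (1 / 5%:R)).
  do 2 eexists; split; last exact: rot_mid_obtuse.
    exact: rot_side_obtuse.
  have := rot_side_obtuse hN h1; rewrite mulrN; exact.
have h2 : - (1 / 2%:R) <= C by lra.
have [h3|h3] := lerP 0 S.
  by have [? ? ?] := rot_states_wide h h2 h3; do 2 eexists; split; eassumption.
have h4 : 0 <= - S by lra.
have [k1 k2 /rot_mid_mir k3] := rot_states_wide hN h2 h4; rewrite opprK in k2.
by do 2 eexists; split; eassumption.
Qed.
End RotatedSplits.

Section TwoStraddlesBound.
Variable R : rcfType.
Implicit Types u v r s : R * R.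
Implicit Types x y c d e f a b : R.
Notation base_sq := (base_sq R).
Notation leg_base := (leg_base R).
Notation Kbound := (Kbound R).
Notation apex_sin := (apex_sin R).

Lemma dotC u v : dot u v = dot v u.
Proof. by rewrite /dot; ring. Qed.

Lemma comb_CS r s v x : legbase r s -> dot v v = base_sq ->
  (x * dot r v + dot s v) ^+ 2 <= base_sq * (x ^+ 2 + 2%:R * x * leg_base + base_sq).
Proof.
case=> h1 h2 h3 h4.
have := dot_CS (vadd (scl x r) s) v; rewrite h4 [_ * base_sq]mulrC.
have -> : dot (vadd (scl x r) s) (vadd (scl x r) s) =
  x ^+ 2 * dot r r + 2%:R * x * dot r s + dot s s.
  by rewrite /dot /vadd /scl /=; ring.
have -> : dot (vadd (scl x r) s) v = x * dot r v + dot s v by rewrite /dot /vadd /scl /=; ring.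
by rewrite h1 h2 h3 mulr1.
Qed.

(** These are the inequalities of [split_parameter_exists] for the opposite of the base
    normal, with [b] as the complementary share. *)
Lemma side_states_separated c d e f : e ^+ 2 <= base_sq -> f ^+ 2 <= base_sq ^+ 2 ->
  (forall x, (x * e + f) ^+ 2 <= base_sq * (x ^+ 2 + 2%:R * x * leg_base + base_sq)) ->
  exists b, side_states c d e f b.
Proof.
move=> he hf h.
have he' : (- e) ^+ 2 <= base_sq by rewrite sqrrN.
have hf' : (- f) ^+ 2 <= base_sq ^+ 2 by rewrite sqrrN.
have h' x : (x * - e + - f) ^+ 2 <= base_sq * (x ^+ 2 + 2%:R * x * leg_base + base_sq).
  by rewrite mulrN -opprD sqrrN.
have [a [/andP[a0 a1] h1 h2 h3]] := split_parameter_exists he' hf' h'.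
exists (1 - a).
have bE := base_sq_def R; have tE := leg_base_def R.
have kE : 99532%:R / 100000%:R <= Kbound ^+ 2 by rewrite Kbound_def; lra.
have aT : a * leg_base = - (77618%:R / 625565%:R) * a by rewrite tE mulrC.
have aa : 0 <= (a - 1/5%:R) * (3%:R/5%:R - a) by apply: mulr_ge0; lra.
move: h1 h2 h3 aT bE tE kE; rewrite /side_states /state_ok /comb_sq.
move: (base_sq) (leg_base) (Kbound ^+ 2) => B T K h1 h2 h3 aT bE tE kE.
clear h h' he hf he' hf'; split; last split; lra.
Qed.

Lemma path_length_rev (p : nat -> R * R) n : (0 < n)%N ->
  path_length (fun k => p (n.-1 - k)%N) n = path_length p n.
Proof.
case: n => // n _; rewrite /path_length /= big_nat_rev /= add0n big_nat [RHS]big_nat.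
apply: eq_bigr => k /andP[_ hk]; rewrite dist_sym; congr dist; congr p; lia.
Qed.

Section Main.
Variables (p : nat -> R * R) (n : nat) (rho : R).

Lemma two_straddles_late r1 s1 r2 s2 (a1 b1 c1 q1 a2 b2 c2 q2 : nat) :
  legbase r1 s1 -> legbase r2 s2 ->
  all (fun i => i < n)%N [:: a1; b1; c1; q1; a2; b2; c2; q2] ->
  rho <= dot r1 (p a1) - dot r1 (p b1) - dot s1 (p b1) + dot s1 (p q1) ->
  rho <= dot r2 (p a2) - dot r2 (p b2) - dot s2 (p b2) + dot s2 (p q2) ->
  dot r1 (p a1) = dot r1 (p c1) -> dot r2 (p a2) = dot r2 (p c2) ->
  (a2 <= b2 <= a1)%N -> (a1 <= b1 <= c1)%N -> (b2 <= c2 <= b1)%N -> (b1 <= q1)%N ->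
  2%:R * rho <= Kbound * path_length p n.
Proof.
move=> l1 l2 hn f1 f2 g1 g2 /andP[tm1 tm2] /andP[tm3 tm4] /andP[tm5 tm6] oq.
have hc : dot r1 r2 ^+ 2 <= 1.
  by have := dot_CS r1 r2; case: l1 => -> _ _; case: l2 => -> _ _; rewrite mulr1.
have imp (i j k : nat) : (i <= j)%N -> (j <= k)%N ==> (i <= k)%N by move=> h; apply/implyP;
  apply: leq_trans.
have [h|h] := leqP q2 b2.
  apply: (two_straddles_calibration l1 l2 hn f1 f2 g1 g2 (a := 3%:R / 5%:R)
    (b := 3%:R / 5%:R)) => k.
  have -> : 1 - 3%:R / 5%:R = 2%:R / 5%:R :> R by field.
  by apply: late_early_states => //; apply: imp.
have [hd hf] : dot r1 s2 ^+ 2 <= base_sq /\ dot s1 s2 ^+ 2 <= base_sq ^+ 2.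
  have := dot_CS r1 s2; have := dot_CS s1 s2.
  by case: l1 => -> _ ->; case: l2 => _ _ ->; rewrite mul1r expr2.
have l2' : dot s2 s2 = base_sq by case: l2.
have [a [h1 h2 h3 h4]] := split_parameter_exists hd hf (fun x => comb_CS x l1 l2').
apply: (two_straddles_calibration l1 l2 hn f1 f2 g1 g2 (a := a) (b := 9976%:R / 10000%:R)) => k.
by apply: late_late_states => //; apply: imp => //; apply: ltnW.
Qed.

Lemma two_straddles_early_late r1 s1 r2 s2 (a1 b1 c1 q1 a2 b2 c2 q2 : nat) a b :
  legbase r1 s1 -> legbase r2 s2 ->
  all (fun i => i < n)%N [:: a1; b1; c1; q1; a2; b2; c2; q2] ->
  rho <= dot r1 (p a1) - dot r1 (p b1) - dot s1 (p b1) + dot s1 (p q1) ->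
  rho <= dot r2 (p a2) - dot r2 (p b2) - dot s2 (p b2) + dot s2 (p q2) ->
  dot r1 (p a1) = dot r1 (p c1) -> dot r2 (p a2) = dot r2 (p c2) ->
  (a2 <= b2 <= a1)%N -> (a1 <= b1 <= c1)%N -> (b2 <= c2 <= b1)%N -> (q1 <= b1)%N -> (b2 <= q2)%N ->
  side_states (dot r1 r2) (dot r1 s2) (dot s1 r2) (dot s1 s2) b ->
  side_states (dot r1 r2) (dot s1 r2) (dot r1 s2) (dot s1 s2) a ->
  (c2 <= a1)%N \/ mid_states (dot r1 r2) (dot r1 s2) (dot s1 r2) (dot s1 s2) a b ->
  2%:R * rho <= Kbound * path_length p n.
Proof.
move=> l1 l2 hn f1 f2 g1 g2 /andP[tm1 tm2] /andP[tm3 tm4] /andP[tm5 tm6] oq oq2 s1b s2a hm.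
have hf : dot s1 s2 ^+ 2 <= base_sq ^+ 2.
  by have := dot_CS s1 s2; case: l1 => _ _ ->; case: l2 => _ _ ->; rewrite expr2.
have imp (i j k : nat) : (i <= j)%N -> (j <= k)%N ==> (i <= k)%N by move=> h; apply/implyP;
  apply: leq_trans.
apply: (two_straddles_calibration l1 l2 hn f1 f2 g1 g2 (a := a) (b := b)) => k.
apply: (early_late_states (sep := (c2 <= a1)%N) s1b s2a) => //; try by apply: imp.
  by case: hm => [->|].
by apply/implyP => h; apply: imp.
Qed.

End Main.

(** All is ordered except the two base contacts, which gives four cases; reversing time
    exchanges the triangles and turns two early base contacts into two late ones. If the
    first is early and the second late, separation in time makes the middle states
    disappear; without it the triangles have to be rotations of each other, so that the
    products of their normals depend on one angle only. *)
Theorem two_straddles_bound (p : nat -> R * R) n rho r1 s1 r2 s2 (a1 b1 c1 q1 a2 b2 c2 q2 : nat) :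
  legbase r1 s1 -> legbase r2 s2 ->
  all (fun i => i < n)%N [:: a1; b1; c1; q1; a2; b2; c2; q2] ->
  rho <= dot r1 (p a1) - dot r1 (p b1) - dot s1 (p b1) + dot s1 (p q1) ->
  rho <= dot r2 (p a2) - dot r2 (p b2) - dot s2 (p b2) + dot s2 (p q2) ->
  dot r1 (p a1) = dot r1 (p c1) -> dot r2 (p a2) = dot r2 (p c2) ->
  (a2 <= b2 <= a1)%N -> (a1 <= b1 <= c1)%N -> (b2 <= c2 <= b1)%N ->
  (c2 <= a1)%N \/ (exists2 z, dot z z = 1 & r2 = cmul z r1 /\ s2 = cmul z s1 /\
    det r1 s1 ^+ 2 = apex_sin ^+ 2) ->
  2%:R * rho <= Kbound * path_length p n.
Proof.
move=> l1 l2 hn f1 f2 g1 g2 tm1 tm2 tm3 hs.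
have [h|h1] := leqP b1 q1; first exact: (two_straddles_late l1 l2 hn f1 f2 g1 g2).
have [h|h2] := leqP q2 b2.
  have n0 : (0 < n)%N by case: n hn.
  rewrite -path_length_rev //.
  have rev i : (i < n)%N -> (n.-1 - (n.-1 - i) = i)%N by lia.
  move: hn => /= hn.
  apply: (@two_straddles_late _ _ _ r2 s2 r1 s1 (n.-1 - c2) (n.-1 - b2) (n.-1 - a2) (n.-1 - q2)
    (n.-1 - c1) (n.-1 - b1) (n.-1 - a1) (n.-1 - q1)) => //=; rewrite ?rev; try lia.
  - by rewrite -g2.
  - by rewrite -g1.
  - by rewrite g2.
  - by rewrite g1.
move/ltnW: h1 => h1; move/ltnW: h2 => h2.
case: hs => [hs|[z z1 [hr [hb dt]]]].
  have [hd he hf] : [/\ dot r1 s2 ^+ 2 <= base_sq, dot s1 r2 ^+ 2 <= base_sq &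
    dot s1 s2 ^+ 2 <= base_sq ^+ 2].
    have := dot_CS r1 s2; have := dot_CS s1 s2; have := dot_CS s1 r2.
    by case: (l1) => -> _ ->; case: (l2) => -> _ ->; rewrite mul1r mulr1 expr2.
  have k1 : dot s1 s1 = base_sq by case: l1.
  have k2 : dot s2 s2 = base_sq by case: l2.
  have e' x : (x * dot s1 r2 + dot s1 s2) ^+ 2 <= base_sq *
    (x ^+ 2 + 2%:R * x * leg_base + base_sq).
    by rewrite (dotC s1 r2) (dotC s1 s2); exact: comb_CS.
  have [b sb] := side_states_separated (dot r1 r2) (dot r1 s2) he hf e'.
  have [a sa] := side_states_separated (dot r1 r2) (dot s1 r2) hd hf (fun x => comb_CS x l1 k2).
  exact: (two_straddles_early_late l1 l2 hn f1 f2 g1 g2 tm1 tm2 tm3 h1 h2 sb sa (or_introl hs)).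
have [k1 k2 k3] := l1.
have [sg [sg1 dts]] : exists sg : R, sg ^+ 2 = 1 /\ det r1 s1 = sg * apex_sin.
  have /eqP := dt; rewrite eqf_sqr => /orP[]/eqP->.
    by exists 1; rewrite mul1r expr1n.
  by exists (-1); rewrite mulN1r sqrrN expr1n.
pose C := z.1; pose S := - (sg * z.2).
have CS : C ^+ 2 + S ^+ 2 = 1.
  by rewrite /C /S sqrrN exprMn sg1 mul1r -z1 /dot -!expr2.
have cE : dot r1 r2 = C.
  by rewrite hr -[RHS]mulr1 -k1 /dot /cmul /C /=; ring.
have dE : dot r1 s2 = C * leg_base + S * apex_sin.
  by rewrite hb /C /S -k2 mulNr mulrAC -dts /dot /det /cmul /=; ring.
have eE : dot s1 r2 = C * leg_base - S * apex_sin.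
  by rewrite hr /C /S -k2 mulNr mulrAC -dts /dot /det /cmul /=; ring.
have fE : dot s1 s2 = base_sq * C.
  by rewrite hb -k3 /dot /cmul /C /=; ring.
have [a [b [sb sa md]]] := rot_states CS.
apply: (two_straddles_early_late (a := a) (b := b) l1 l2 hn f1 f2 g1 g2 tm1 tm2 tm3 h1 h2);
  last right; rewrite cE dE eE fE.
- exact: sb.
- exact: rot_side_mir.
- exact: md.
Qed.
End TwoStraddlesBound.

(** * Optimal paths through points in convex position *)

Section ConvexTours.
Variable R : rcfType.
Implicit Types x z u v o : R * R.

Definition orient x z v : R := det (vsub z x) (vsub v x).
Lemma orient_cyc x z v : orient x z v = orient z v x.
Proof. by rewrite /orient /det /vsub /=; ring. Qed.

Lemma dist_tri_strict x o v : det (vsub o x) (vsub v o) != 0 -> dist x v < dist x o + dist o v.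
Proof.
move=> h.
have d1 := dist_ge0 x o; have d2 := dist_ge0 o v; have d3 := dist_ge0 x v.
have := sqr_dist x o; have := sqr_dist o v; have := sqr_dist x v.
rewrite -ltr_sqr ?nnegrE ?addr_ge0 // => -> e2 e1.
rewrite sqrrD e1 e2.
set A := dist x o in d1 e1 *; set B := dist o v in d2 e2 *.
have lag : (A * B) ^+ 2 = dot (vsub o x) (vsub v o) ^+ 2 + det (vsub o x) (vsub v o) ^+ 2.
  by rewrite exprMn e1 e2 /dot /det /vsub /=; ring.
have pos : 0 < det (vsub o x) (vsub v o) ^+ 2 by rewrite exprn_even_gt0.
have : dot (vsub o x) (vsub v o) < A * B.
  have [hd|hd] := ltP (dot (vsub o x) (vsub v o)) 0.
    by apply: lt_le_trans hd _; apply: mulr_ge0.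
  by rewrite -ltr_sqr ?nnegrE ?mulr_ge0 // lag ltrDl.
have -> : dot (vsub x v) (vsub x v) = dot (vsub x o) (vsub x o) + dot (vsub o v) (vsub o v)
  + 2%:R * dot (vsub o x) (vsub v o) by rewrite /dot /vsub /=; ring.
by rewrite -[_ *+ 2]mulr_natl; lra.
Qed.

Lemma dist_between x z o t : 0 <= t <= 1 -> o = (x.1 + t * (z.1 - x.1), x.2 + t * (z.2 - x.2)) ->
  dist x o + dist o z = dist x z.
Proof.
move=> /andP[t0 t1] ->.
have -> : dist x z = t * dist x z + (1 - t) * dist x z by ring.
congr (_ + _); rewrite /dist /=.
  have -> : (x.1 - (x.1 + t * (z.1 - x.1))) ^+ 2 + (x.2 - (x.2 + t * (z.2 - x.2))) ^+ 2
    = t ^+ 2 * ((x.1 - z.1) ^+ 2 + (x.2 - z.2) ^+ 2) by ring.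
  by rewrite sqrtrM ?sqr_ge0 // sqrtr_sqr ger0_norm.
have -> : (x.1 + t * (z.1 - x.1) - z.1) ^+ 2 + (x.2 + t * (z.2 - x.2) - z.2) ^+ 2
    = (1 - t) ^+ 2 * ((x.1 - z.1) ^+ 2 + (x.2 - z.2) ^+ 2) by ring.
by rewrite sqrtrM ?sqr_ge0 // sqrtr_sqr ger0_norm // subr_ge0.
Qed.

Lemma ratio_between (a b : R) : a * b < 0 -> 0 < a / (a - b) < 1.
Proof.
move=> h; have [ha|ha|ha] := ltgtP a 0; last by rewrite ha mul0r ltxx in h.
  have hb : 0 < b by rewrite nmulr_rlt0 in h.
  have hab : a - b < 0 by lra.
  by rewrite ltr_ndivlMr // ltr_ndivrMr // mul0r mul1r ha /=; lra.
have hb : b < 0 by rewrite pmulr_rlt0 in h.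
have hab : 0 < a - b by lra.
by rewrite ltr_pdivlMr // ltr_pdivrMr // mul0r mul1r ha /=; lra.
Qed.

Lemma ratio_eq (N A C a b c d : R) : N != 0 -> a * N + A * (b - a) = c * N - C * (d - c) ->
  a + A / N * (b - a) = c + C / (- N) * (d - c).
Proof.
move=> hN h; have -> : a + A / N * (b - a) = (a * N + A * (b - a)) / N by field.
by rewrite h invrN; field.
Qed.

(** Strict triangle inequalities through the crossing point. *)
Lemma crossing_shortcut x z u v : orient x z u * orient x z v < 0 ->
  orient u v x * orient u v z < 0 ->
  dist x u + dist z v < dist x z + dist u v.
Proof.
move=> h1 h2.
pose t := orient u v x / (orient u v x - orient u v z).
pose s := orient x z u / (orient x z u - orient x z v).
have ht : 0 < t < 1 := ratio_between h2.
have hs : 0 < s < 1 := ratio_between h1.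
pose o := (x.1 + t * (z.1 - x.1), x.2 + t * (z.2 - x.2)).
have dn : orient u v x - orient u v z != 0.
  by apply: contraTneq h2 => /eqP; rewrite subr_eq0 => /eqP ->; rewrite -leNgt -expr2 sqr_ge0.
have dn' : orient x z u - orient x z v != 0.
  by apply: contraTneq h1 => /eqP; rewrite subr_eq0 => /eqP ->; rewrite -leNgt -expr2 sqr_ge0.
have ho : o = (u.1 + s * (v.1 - u.1), u.2 + s * (v.2 - u.2)).
  have dd : orient x z u - orient x z v = - (orient u v x - orient u v z) by rewrite /orient /det
    /vsub /=; ring.
  rewrite /o /t /s dd; congr pair; apply: ratio_eq => //; rewrite /orient /det /vsub /=; clear;
    ring.
have xo : dist x o + dist o z = dist x z.
  by apply: (@dist_between _ _ _ t) => //; case/andP: ht => /ltW-> /ltW->.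
have uo : dist u o + dist o v = dist u v.
  by apply: (@dist_between _ _ _ s) => //; case/andP: hs => /ltW-> /ltW->.
rewrite -xo -uo.
have xn : dist x u < dist x o + dist o u.
  apply: dist_tri_strict.
  have -> : det (vsub o x) (vsub u o) = t * orient x z u by rewrite /o /orient /det /vsub /=; ring.
  rewrite mulf_neq0 //; first by case/andP: ht => /lt0r_neq0.
  by apply: contraTneq h1 => ->; rewrite mul0r ltxx.
have zn : dist z v <= dist z o + dist o v.
  have hn : det (vsub o z) (vsub v o) != 0.
    have -> : det (vsub o z) (vsub v o) = - (1 - t) * orient x z v.
      by rewrite /o /orient /det /vsub /=; ring.
    rewrite mulf_neq0 //; first by rewrite oppr_eq0 subr_eq0 eq_sym; case/andP: ht => _ /lt_eqF->.
    by apply: contraTneq h1 => ->; rewrite mulr0 ltxx.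
  exact/ltW/dist_tri_strict.
rewrite [dist o u]dist_sym in xn; rewrite [dist z o]dist_sym in zn; lra.
Qed.

Section Conv.
Variables (p : nat -> R * R) (n : nat).
(* every point is a strict vertex of the hull, and exchanging two edges of the
   path does not shorten it *)
Hypothesis ext : forall i, (i < n)%N -> exists d, forall j, (j < n)%N -> j != i ->
  dot d (p j) < dot d (p i).
Hypothesis opt : forall i j, (i < j)%N -> (j.+1 < n)%N ->
  dist (p i) (p i.+1) + dist (p j) (p j.+1) <= dist (p i) (p j) + dist (p i.+1) (p j.+1).

(** The convex combination is expressed through linear functionals, the form in which
    determinant identities provide it. *)
Lemma no_comb i j k l (a b c : R) : (i < n)%N -> (j < n)%N -> (k < n)%N -> (l < n)%N ->
  j != i -> k != i -> l != i -> 0 <= a -> 0 <= b -> 0 <= c -> 0 < a + b + c ->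
  (forall d, (a + b + c) * dot d (p i) = a * dot d (p j) + b * dot d (p k) + c * dot d (p l)) ->
    False.
Proof.
move=> hi hj hk hl ij ik il a0 b0 c0 abc; have [d hd] := ext hi => /(_ d).
have := hd _ hj ij; have := hd _ hk ik; have := hd _ hl il.
move: (dot d (p j)) (dot d (p k)) (dot d (p l)) (dot d (p i)) => B C D A h1 h2 h3 h4.
have e1 : 0 <= a * (A - B) by apply: mulr_ge0 => //; lra.
have e2 : 0 <= b * (A - C) by apply: mulr_ge0 => //; lra.
have e3 : 0 <= c * (A - D) by apply: mulr_ge0 => //; lra.
have [a1|a1] := ltP 0 a.
  have : 0 < a * (A - B) by apply: mulr_gt0 => //; lra.
  lra.
have [b1|b1] := ltP 0 b.
  have : 0 < b * (A - C) by apply: mulr_gt0 => //; lra.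
  lra.
have : 0 < c * (A - D) by apply: mulr_gt0 => //; lra.
lra.
Qed.

Local Notation D3 i j k := (orient (p i) (p j) (p k)).

Lemma non_collinear i j k : (i < n)%N -> (j < n)%N -> (k < n)%N ->
  i != j -> j != k -> i != k -> D3 i j k != 0.
Proof.
move=> hi hj hk ij jk ik; apply/eqP => h0.
(* if [b] and [c] are not seen from [a] under an acute angle, then [a] lies
   between them *)
have key a b c : (a < n)%N -> (b < n)%N -> (c < n)%N -> a != b -> b != c -> a != c ->
  D3 a b c = 0 -> dot (vsub (p b) (p a)) (vsub (p c) (p a)) <= 0 -> False.
  move=> ha hb hc ab bc ac d0 hd.
  pose s := dot (vsub (p b) (p a)) (vsub (p b) (p a)).
  pose t := - dot (vsub (p b) (p a)) (vsub (p c) (p a)).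
  have t0 : 0 <= t by rewrite oppr_ge0.
  have s0 : 0 <= s by rewrite /s /dot -!expr2 addr_ge0 ?sqr_ge0.
  have s1 : 0 < s.
    rewrite lt_neqAle s0 andbT eq_sym; apply/eqP => se.
    have [d hdd] := ext ha; have := hdd _ hb; rewrite eq_sym ab => /(_ isT).
    have [/eqP e1 /eqP e2] : (p b).1 - (p a).1 == 0 /\ (p b).2 - (p a).2 == 0.
      move/eqP: se; rewrite /s /dot /vsub /= -!expr2 paddr_eq0 ?sqr_ge0 // !sqrf_eq0.
      by case/andP.
    have -> : p b = p a.
      by apply/eqP; rewrite -pair_eqE /= -subr_eq0 e1 eqxx /= -subr_eq0 e2.
    by rewrite ltxx.
  have ba : b != a by rewrite eq_sym.
  have ca : c != a by rewrite eq_sym.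
  apply: (@no_comb a b c c t s 0 ha hb hc hc) => //; first by rewrite addr0 ltr_wpDl.
  move=> d; apply/eqP; rewrite -subr_eq0; apply/eqP.
  have -> : (t + s + 0) * dot d (p a) - (t * dot d (p b) + s * dot d (p c) + 0 * dot d (p c)) =
    - D3 a b c * (d.2 * ((p b).1 - (p a).1) - d.1 * ((p b).2 - (p a).2)).
    by rewrite /t /s /orient /det /dot /vsub /=; ring.
  by rewrite d0 oppr0 mul0r.
have [h|h1] := lerP (dot (vsub (p j) (p i)) (vsub (p k) (p i))) 0; first exact: (key i j k).
have [h|h2] := lerP (dot (vsub (p k) (p j)) (vsub (p i) (p j))) 0.
  by apply: (key j k i) => //; [rewrite eq_sym|rewrite eq_sym|rewrite orient_cyc orient_cyc].
have [h|h3] := lerP (dot (vsub (p i) (p k)) (vsub (p j) (p k))) 0.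
  by apply: (key k i j) => //; [rewrite eq_sym|rewrite eq_sym|rewrite orient_cyc].
have : D3 i j k ^+ 2 = dot (vsub (p j) (p i)) (vsub (p j) (p i)) * dot (vsub (p k) (p i)) (vsub
  (p k) (p i))
   - dot (vsub (p j) (p i)) (vsub (p k) (p i)) ^+ 2.
  by rewrite /orient /det /dot /vsub /=; ring.
rewrite h0 expr0n /=.
have -> : dot (vsub (p j) (p i)) (vsub (p j) (p i)) = dot (vsub (p j) (p i)) (vsub (p k) (p i))
  + dot (vsub (p k) (p j)) (vsub (p i) (p j)) by rewrite /dot /vsub /=; ring.
have -> : dot (vsub (p k) (p i)) (vsub (p k) (p i)) = dot (vsub (p j) (p i)) (vsub (p k) (p i))
  + dot (vsub (p i) (p k)) (vsub (p j) (p k)) by rewrite /dot /vsub /=; ring.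
move: h1 h2 h3; clear; move: (dot _ _) (dot _ _) (dot _ _) => C B A; nra.
Qed.

(** Four points of the plane satisfy an affine relation whose coefficients are, up to
    sign, their four orientations. If [c] and [d] lie on different sides of [a b] but [a]
    and [b] do not lie on different sides of [c d], the signs in it make one of the points
    a convex combination of the others. *)
Lemma opposite_sides a b c d : (a < n)%N -> (b < n)%N -> (c < n)%N -> (d < n)%N ->
  uniq [:: a; b; c; d] -> D3 a b c * D3 a b d < 0 -> D3 c d a * D3 c d b < 0.
Proof.
move=> ha hb hc hd; rewrite /= !inE !negb_or => /and4P[/and3P[ab ac ad] /andP[bc bd] cd _].
rewrite -[D3 c d a]orient_cyc -[D3 c d b]orient_cyc.
have dep e : D3 b c d * dot e (p a) - D3 a c d * dot e (p b) + D3 a b d * dot e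
  (p c) - D3 a b c * dot e (p d) = 0.
  by rewrite /orient /det /dot /vsub /=; ring.
have sm : D3 b c d - D3 a c d + D3 a b d - D3 a b c = 0.
  by rewrite /orient /det /vsub /=; ring.
move: (D3 b c d) (D3 a c d) (D3 a b d) (D3 a b c) dep sm => A B C D dep sm h.
rewrite ltNge; apply/negP => hAB.
have na : [/\ b != a, c != a & d != a] by rewrite ![_ == a]eq_sym.
have nb : [/\ a != b, c != b & d != b] by rewrite ![_ == b]eq_sym [b == a]eq_sym.
case: na => na1 na2 na3; case: nb => nb1 nb2 nb3.
have [hA|hA] : (0 <= A /\ 0 <= B) \/ (A <= 0 /\ B <= 0).
  have [? | ?] := ltP 0 A; first by left; split; nra.
  have [? | ?] := ltP 0 B; first by left; split; nra.
  by right.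
  case: hA => A0 B0; have [C0|C0] := ltP 0 C.
    have D0 : D < 0 by nra.
    apply: (@no_comb b a c d A C (- D)) => //; try lra.
    by move=> e; have := dep e; rewrite (_ : A + C - D = B); lra.
  have D0 : 0 < D by nra.
  apply: (@no_comb a b c d B (- C) D) => //; try lra.
  by move=> e; have := dep e; rewrite (_ : B - C + D = A); lra.
case: hA => A0 B0; have [C0|C0] := ltP 0 C.
  have D0 : D < 0 by nra.
  apply: (@no_comb a b c d (- B) C (- D)) => //; try lra.
  by move=> e; have := dep e; rewrite (_ : - B + C - D = - A); lra.
have D0 : 0 < D by nra.
apply: (@no_comb b a c d (- A) (- C) D) => //; try lra.
by move=> e; have := dep e; rewrite (_ : - A - C + D = - B); lra.
Qed.

Lemma discrete_ivt (f : nat -> R) a b : (a < b)%N -> f a * f b < 0 ->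
  (forall i, (a <= i <= b)%N -> f i != 0) -> exists2 i, (a <= i < b)%N & f i * f i.+1 < 0.
Proof.
elim: b => // b IH; rewrite ltnS leq_eqVlt => /orP[/eqP<-|ab] h nz.
  by exists a; rewrite // leqnn leqnn.
have [h1|h1] := ltP (f a * f b) 0.
  case: (IH ab h1) => [i /andP[i1 i2]|i /andP[i1 i2] i3].
    by apply: nz; rewrite i1 ltnW.
  by exists i => //; rewrite i1 ltnW.
have b0 : f b != 0 by apply: nz; rewrite (ltnW ab) /=.
have a0 : f a != 0 by apply: nz; rewrite leqnn ltnW ?(leqW ab) ?ltnS ?(ltnW ab).
exists b; first by rewrite (ltnW ab) /=.
have {}h1 : 0 < f a * f b by rewrite lt_neqAle eq_sym mulf_neq0.
have : 0 < f a ^+ 2 by rewrite exprn_even_gt0.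
nra.
Qed.

(** Otherwise [a] and [b] also lie on different sides of the line [c d], so an edge of
    the path visited between [a] and [b] crosses this line; in the same way an edge
    visited between [c] and [d] crosses the line of the first edge. These two edges
    intersect, and exchanging them shortens the path. *)
Lemma separated_same_side a b c d : (maxn a b < minn c d)%N -> (maxn c d < n)%N -> a != b ->
  c != d ->
  0 < D3 a b c * D3 a b d.
Proof.
move=> sep hn ab cd.
have ha : (a < n)%N by lia.
have hb : (b < n)%N by lia.
have hc : (c < n)%N by lia.
have hd : (d < n)%N by lia.
have nz1 := @non_collinear a b c ha hb hc ab _ _.
rewrite lt_neqAle eq_sym mulf_neq0 ?non_collinear //=; try lia.
rewrite leNgt; apply/negP => h.
have {h} h : D3 c d a * D3 c d b < 0 by apply: opposite_sides => //=; rewrite !inE; lia.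
(* an edge of the first part of the path crosses the line through c and d *)
have [i [i1 i2 i3]] : exists i, [/\ (minn a b <= i)%N,
  (i.+1 <= maxn a b)%N & D3 c d i * D3 c d i.+1 < 0].
  have nz j : (minn a b <= j <= maxn a b)%N -> D3 c d j != 0 by move=> hj; apply: non_collinear;
    lia.
  have [lt|lt] := ltnP a b.
    have [|i ? ?] := @discrete_ivt (fun i => D3 c d i) _ _ lt h.
      by move=> j hj; apply: nz; lia.
    by exists i; split => //; lia.
  have {}lt : (b < a)%N by lia.
  rewrite mulrC in h.
  have [|i ? ?] := @discrete_ivt (fun i => D3 c d i) _ _ lt h.
    by move=> j hj; apply: nz; lia.
  by exists i; split => //; lia.
have {h} h : D3 i i.+1 c * D3 i i.+1 d < 0 by apply: opposite_sides => //=; rewrite ?inE; lia.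
(* and an edge of the second part crosses the line of that edge *)
have [j [j1 j2 j3]] : exists j, [/\ (minn c d <= j)%N,
  (j.+1 <= maxn c d)%N & D3 i i.+1 j * D3 i i.+1 j.+1 < 0].
  have nz j : (minn c d <= j <= maxn c d)%N -> D3 i i.+1 j != 0 by move=> hj;
    apply: non_collinear; lia.
  have [lt|lt] := ltnP c d.
    have [|j ? ?] := @discrete_ivt (fun j => D3 i i.+1 j) _ _ lt h.
      by move=> j hj; apply: nz; lia.
    by exists j; split => //; lia.
  have {}lt : (d < c)%N by lia.
  rewrite mulrC in h.
  have [|j ? ?] := @discrete_ivt (fun j => D3 i i.+1 j) _ _ lt h.
    by move=> j hj; apply: nz; lia.
  by exists j; split => //; lia.
have cross : D3 j j.+1 i * D3 j j.+1 i.+1 < 0 by apply: opposite_sides => //=; rewrite ?inE; lia.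
have o : (i < j)%N by lia.
have o' : (j.+1 < n)%N by lia.
by have := le_lt_trans (opt o o') (crossing_shortcut j3 cross); rewrite ltxx.
Qed.

Lemma separated_same_side_rev a b c d : (maxn c d < minn a b)%N -> (maxn a b < n)%N -> a != b ->
  c != d ->
  0 < D3 a b c * D3 a b d.
Proof.
move=> sep hn ab cd.
have ha : (a < n)%N by lia.
have hb : (b < n)%N by lia.
have hc : (c < n)%N by lia.
have hd : (d < n)%N by lia.
rewrite lt_neqAle eq_sym mulf_neq0 ?non_collinear //=; try lia.
rewrite leNgt; apply/negP => h.
have {h} : D3 c d a * D3 c d b < 0 by apply: opposite_sides => //=; rewrite !inE; lia.
by rewrite ltNge ltW // separated_same_side.
Qed.
End Conv.
End ConvexTours.

(** * Hull order against time order *)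

Section HullRank.
Variable R : rcfType.
Variables (p : nat -> R * R) (n : nat).
Hypothesis ext : forall i, (i < n)%N -> exists d, forall j, (j < n)%N -> j != i ->
  dot d (p j) < dot d (p i).
Hypothesis opt : forall i j, (i < j)%N -> (j.+1 < n)%N ->
  dist (p i) (p i.+1) + dist (p j) (p j.+1) <= dist (p i) (p j) + dist (p i.+1) (p j.+1).
Local Notation D3 i j k := (orient (p i) (p j) (p k)).

Lemma orient_xx (x z : R * R) : orient x z z = 0.
Proof. by rewrite /orient /det; ring. Qed.

Lemma turn_trans a x y z : (a < n)%N -> (x < n)%N -> (y < n)%N -> (z < n)%N ->
  x != a -> y != a -> z != a -> 0 < D3 a x y -> 0 < D3 a y z -> 0 < D3 a x z.
Proof.
move=> ha hx hy hz xa ya za h1 h2; rewrite ltNge; apply/negP => h3.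
apply: (@no_comb R p n ext a x y z (D3 a y z) (- D3 a x z) (D3 a x y)) => //; try lra.
move=> d; apply/eqP; rewrite -subr_eq0; apply/eqP.
by rewrite /orient /det /dot /vsub /=; ring.
Qed.

(** The rank counts the points to the right of the ray from [a]. As [a] is a vertex of
    the hull, all other points are seen from it within a half plane, where turning left is
    a transitive relation. *)
Lemma cyclic_rank a : (a < n)%N -> exists pos : nat -> nat, [/\ pos a = 0%N,
  (forall x y, (x < n)%N -> (y < n)%N -> pos x = pos y -> x = y) &
  (forall x y z, (x < n)%N -> (y < n)%N -> (z < n)%N -> (pos x < pos y)%N -> (pos y < pos z)%N ->
    0 < D3 x y z)].
Proof.
move=> ha.
pose pos x := if x == a then 0%N else #|[set y : 'I_n | (nat_of_ord y != a) && (0 < D3 a y x)]|.+1.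
have mono x y : (x < n)%N -> (y < n)%N -> x != a -> y != a -> 0 < D3 a x y -> (pos x < pos y)%N.
  move=> hx hy xa ya hxy; rewrite /pos (negPf xa) (negPf ya) ltnS.
  apply/proper_card/fintype.properP; split.
    apply/fintype.subsetP => z; rewrite !inE => /andP[za hzx]; rewrite za /=.
    exact: (turn_trans ha (ltn_ord z) hx hy za xa ya).
  by exists (Ordinal hx); rewrite !inE /= ?orient_xx ?ltxx ?andbF // xa.
have sgn x y : (x < n)%N -> (y < n)%N -> x != a -> y != a -> x != y ->
  (0 < D3 a x y) = (pos x < pos y)%N.
  move=> hx hy xa ya xy; have [h|h] := ltP 0 (D3 a x y); first by rewrite mono.
  have h' : 0 < D3 a y x.
    have -> : D3 a y x = - D3 a x y by rewrite /orient /det /vsub /=; ring.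
    by rewrite oppr_gt0 lt_neqAle h andbT (non_collinear ext) // eq_sym.
  by rewrite ltnNge ltnW ?mono.
have pa : pos a = 0%N by rewrite /pos eqxx.
have pos0 x : (pos x == 0%N) = (x == a) by rewrite /pos; case: ifP.
exists pos; split => // [x y hx hy e|x y z hx hy hz hxy hyz].
  have [xa|xa] := eqVneq x a.
    by move/eqP: e; rewrite xa pa eq_sym pos0 => /eqP.
  have ya : y != a by rewrite -pos0 -e pos0.
  apply/eqP; apply: contraT => xy.
  have := sgn _ _ hx hy xa ya xy; rewrite e ltnn => h1.
  have := sgn _ _ hy hx ya xa; rewrite eq_sym xy e ltnn => /(_ isT) h2.
  have : D3 a x y != 0 by rewrite (non_collinear ext) // eq_sym.
  have e' : D3 a y x = - D3 a x y by rewrite /orient /det /vsub /=; ring.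
  by move: h1 h2; rewrite e' oppr_gt0; case: ltgtP.
have ya : y != a by rewrite -pos0 -lt0n; apply: leq_ltn_trans hxy.
have za : z != a by rewrite -pos0 -lt0n; apply: leq_ltn_trans hyz.
have yz : y != z by apply: contraTneq hyz => ->; rewrite ltnn.
have xy : x != y by apply: contraTneq hxy => ->; rewrite ltnn.
have xz : x != z by apply: contraTneq (ltn_trans hxy hyz) => ->; rewrite ltnn.
have h2 : 0 < D3 a y z by rewrite sgn.
have [xa|xa] := eqVneq x a; first by rewrite xa.
have h1 : 0 < D3 a x y by rewrite sgn.
rewrite lt_neqAle eq_sym (non_collinear ext) //= leNgt; apply/negP => h3.
apply: (@no_comb R p n ext y a x z (- D3 x y z) (D3 a y z) (D3 a x y));
  rewrite ?[_ == y]eq_sym //; [by rewrite eq_sym|lra|exact: ltW|exact: ltW|lra|].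
move=> d; apply/eqP; rewrite -subr_eq0; apply/eqP.
by rewrite /orient /det /dot /vsub /=; ring.
Qed.

Lemma rank_of_turn pos x y z : (forall x y z, (x < n)%N -> (y < n)%N -> (z < n)%N ->
  (pos x < pos y)%N -> (pos y < pos z)%N -> 0 < D3 x y z) ->
  (x < n)%N -> (y < n)%N -> (z < n)%N ->
  (forall x y, (x < n)%N -> (y < n)%N -> pos x = pos y -> x = y) -> 0 < D3 x y z ->
  [|| (pos x < pos y < pos z)%N, (pos y < pos z < pos x)%N | (pos z < pos x < pos y)%N].
Proof.
move=> H hx hy hz inj h.
have ne u v : (u < n)%N -> (v < n)%N -> u != v -> pos u <> pos v.
  by move=> hu hv /eqP uv e; apply: uv; apply: inj.
have nz : D3 x y z != 0 by rewrite gt_eqF.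
have xy : x != y by apply: contraNneq nz => ->; rewrite /orient /det /vsub subrr; apply/eqP;
  rewrite /=; ring.
have yz : y != z by apply: contraNneq nz => ->; rewrite orient_xx.
have xz : x != z by apply: contraNneq nz => ->; rewrite /orient /det /vsub; apply/eqP;
  rewrite /=; ring.
have := ne _ _ hx hy xy; have := ne _ _ hy hz yz; have := ne _ _ hx hz xz.
have o1 := H y x z hy hx hz; have o2 := H x z y hx hz hy; have o3 := H z y x hz hy hx.
have e1 : D3 y x z = - D3 x y z by rewrite /orient /det /vsub /=; ring.
have e2 : D3 x z y = - D3 x y z by rewrite /orient /det /vsub /=; ring.
have e3 : D3 z y x = - D3 x y z by rewrite /orient /det /vsub /=; ring.
move: o1 o2 o3; rewrite e1 e2 e3 oppr_gt0 ltNge (ltW h) /=; lia.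
Qed.

(** For four points in hull order, [w y] and [x z] are the two diagonals. *)
Definition unlinked pos (w x y z : nat) := (pos w < pos x -> pos x < pos y -> pos y < pos z ->
  ~ (maxn w y < minn x z) /\ ~ (maxn x z < minn w y))%N.

(** Each diagonal separates the end points of the other one. *)
Lemma rank_unlinked (pos : nat -> nat) w x y z : (forall x y z, (x < n)%N -> (y < n)%N ->
  (z < n)%N -> (pos x < pos y)%N -> (pos y < pos z)%N -> 0 < D3 x y z) ->
  (w < n)%N -> (x < n)%N -> (y < n)%N -> (z < n)%N -> unlinked pos w x y z.
Proof.
move=> H hw hx hy hz wx xy yz.
have o1 := H _ _ _ hw hx hy wx xy. have o2 := H _ _ _ hw hy hz (ltn_trans wx xy) yz.
have o3 := H _ _ _ hx hy hz xy yz. have o4 := H _ _ _ hw hx hz wx (ltn_trans xy yz).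
have ne u v : (pos u < pos v)%N -> u != v by apply: contraTneq => ->; rewrite ltnn.
split=> h.
  have := @separated_same_side _ _ _ ext opt w y x z h _ (ne _ _ (ltn_trans wx xy)) (ne _ _
    (ltn_trans xy yz)).
  have -> : D3 w y x = - D3 w x y by rewrite /orient /det /vsub /=; ring.
  have : (maxn x z < n)%N by lia.
  by move=> hn /(_ hn); rewrite mulNr oppr_gt0 ltNge mulr_ge0 // ltW.
have := @separated_same_side _ _ _ ext opt x z w y h _ (ne _ _ (ltn_trans xy yz)) (ne _ _
  (ltn_trans wx xy)).
have -> : D3 x z w = D3 w x z by rewrite /orient /det /vsub /=; ring.
have -> : D3 x z y = - D3 x y z by rewrite /orient /det /vsub /=; ring.
have : (maxn w y < n)%N by lia.
by move=> hn /(_ hn); rewrite mulrN oppr_gt0 ltNge mulr_ge0 // ltW.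
Qed.

(** The two hull edges are traversed in opposite directions in time. The position of [b1]
    relative to the second edge decides which alternative holds, and every inequality in
    it is obtained by exhibiting two diagonals, one of which would be visited before the
    other. *)
Theorem opposite_edges_order a1 b1 c1 a2 b2 c2 : (c1 < n)%N -> (c2 < n)%N ->
  (a1 < b1 < c1)%N -> (a2 < b2 < c2)%N ->
  (forall x, (x < n)%N -> x != a1 -> x != c1 -> 0 < D3 a1 c1 x) ->
  (forall x, (x < n)%N -> x != a2 -> x != c2 -> 0 < D3 c2 a2 x) ->
  (((b2 <= a1) && (c2 <= b1)) || ((b1 <= a2) && (c1 <= b2)))%N.
Proof.
move=> hc1 hc2 /andP[t1 t2] /andP[t3 t4] E1 E2.
have ha1 : (a1 < n)%N by lia. have hb1 : (b1 < n)%N by lia.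
have ha2 : (a2 < n)%N by lia. have hb2 : (b2 < n)%N by lia.
have [pos [p0 inj H]] := cyclic_rank ha1.
have first x : (x < n)%N -> (x = a1 /\ pos x = 0%N) \/ (x = c1 /\
  pos x = pos c1) \/ (0 < pos c1 < pos x)%N.
  move=> hx; have [->|xa] := eqVneq x a1; first by left.
  have [->|xc] := eqVneq x c1; first by right; left.
  have := rank_of_turn H ha1 hc1 hx inj (E1 x hx xa xc); rewrite p0; lia.
have gap x : (x < n)%N -> (x = a2 /\ pos x = pos a2) \/ (x = c2 /\ pos x = pos c2) \/
   [|| (pos c2 < pos a2 < pos x)%N, (pos a2 < pos x < pos c2)%N | (pos x < pos c2 < pos a2)%N].
  move=> hx; have [->|xa] := eqVneq x a2; first by left.
  have [->|xc] := eqVneq x c2; first by right; left.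
  by right; right; exact: rank_of_turn H hc2 ha2 hx inj (E2 x hx xa xc).
have U w x y z : (w < n)%N -> (x < n)%N -> (y < n)%N -> (z < n)%N -> unlinked pos w x y z.
  exact: rank_unlinked.
have fb1 := first _ hb1; have fa2 := first _ ha2; have fc2 := first _ hc2; have fb2 := first _ hb2.
have ga1 := gap _ ha1; rewrite p0 in ga1; have gb1 :=
  gap _ hb1; have gc1 := gap _ hc1; have gb2 := gap _ hb2.
clear first gap E1 E2 H ext opt.
have kb1 : (0 < pos c1 < pos b1)%N by move: fb1 t1 t2; clear; lia.
have ib1 x : (x < n)%N -> pos x = pos b1 -> x = b1 by move=> hx e; exact: inj.
(* the second edge either precedes b1 on the hull, or follows it *)
have [X|Y] := boolP ((pos c2 < pos a2) && (pos a2 <= pos b1))%N.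
  have kc : (pos c1 <= pos c2)%N by move: fc2 gc1 fa2 X kb1 t1 t2 t3 t4; clear; lia.
  have q1 := U _ _ _ _ ha1 hc2 ha2 hb1; rewrite /unlinked p0 in q1.
  have {q1} [h|h] : (b1 <= a2 \/ c2 <= a1)%N.
    have := ib1 _ ha2; move: q1 kc X kb1 t1 t2 t3 t4; clear; lia.
  - have q2 := U _ _ _ _ hc1 ha2 hb2 hb1; rewrite /unlinked in q2.
    have q3 := U _ _ _ _ ha1 hc1 hb1 hb2; rewrite /unlinked p0 in q3.
    have q4 := U _ _ _ _ hc1 hb2 hc2 ha2; rewrite /unlinked in q4.
    have [h1|h1] := leqP (pos b2) (pos c2).
      move: q4 fb2 gb2 h h1 kc X kb1 t1 t2 t3 t4; clear; lia.
    have := ib1 _ hb2.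
    have [h2|h2] := leqP (pos b2) (pos b1).
      move: q2 gb2 h h1 h2 kc X kb1 t1 t2 t3 t4; clear; lia.
    move: q3 h h1 h2 kc X kb1 t1 t2 t3 t4; clear; lia.
  - move: h t1 t2 t3 t4; clear; lia.
have kY : (pos b1 <= pos c2)%N by move: gb1 ga1 fa2 Y kb1 t1 t2 t3 t4; clear; lia.
have kY2 : (pos c2 < pos a2)%N \/ (a2 = a1 /\ pos a2 = 0%N) by move: ga1 Y kY kb1; clear; lia.
have h : (c2 <= b1)%N.
  have q1 := U _ _ _ _ ha1 hc1 hb1 hc2; rewrite /unlinked p0 in q1.
  have := ib1 _ hc2; move: q1 kY kY2 kb1 t1 t2 t3 t4; clear; lia.
have [//|h'] := leqP b2 a1; first by rewrite h.
have q2 := U _ _ _ _ ha1 hc1 hb2 hb1; rewrite /unlinked p0 in q2.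
have q3 := U _ _ _ _ ha1 hb1 hb2 hc2; rewrite /unlinked p0 in q3.
have q4 := U _ _ _ _ ha1 hc2 ha2 hb2; rewrite /unlinked p0 in q4.
exfalso; have [h1|h1] := leqP (pos b2) (pos b1).
  have := ib1 _ hb2; move: q2 fb2 h h1 h' kb1 t1 t2 t3 t4; clear; lia.
have [h2|h2] := leqP (pos b2) (pos c2).
  have := inj _ _ hb2 hc2; have := ib1 _ hc2; move: q3 h h1 h2 h' kY kb1 t1 t2 t3 t4; clear; lia.
move: q4 gb2 fb2 h h1 h2 h' kY kY2 kb1 t1 t2 t3 t4; clear; lia.
Qed.
End HullRank.

(** * Rotations and contact points *)

Section Contacts.
Variable R : rcfType.
Implicit Types u v e z : R * R.
Notation uR := (uR R). Notation uL := (uL R). Notation uB := (uB R).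
Notation Kbound := (Kbound R).
Notation apex_sin := (apex_sin R).
Notation apex_cos := (apex_cos R).
Notation frame_A := (frame_A R).
Notation frame_B := (frame_B R).

Definition cconj e : R * R := (e.1, - e.2).
Definition contact (p : nat -> R * R) n v i :=
  (i < n)%N /\ forall j, (j < n)%N -> dot v (p j) <= dot v (p i).

Lemma contact_exists p n v : (0 < n)%N -> exists i, contact p n v i.
Proof.
case: n => // n _; have [i _ hi] := @arg_maxP _ R 'I_n.+1 ord0 predT (fun i => dot v (p i)) isT.
by exists i; split => [|j hj]; [exact: ltn_ord | exact: (hi (Ordinal hj))].
Qed.

Lemma cmulA e z v : cmul e (cmul z v) = cmul (cmul e z) v.
Proof. by rewrite /cmul /=; congr pair; ring. Qed.
Lemma cmulC e v : cmul e v = cmul v e.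
Proof. by rewrite /cmul; congr pair; ring. Qed.
Lemma dot_cmul e v x : dot (cmul e v) x = dot v (cmul (cconj e) x).
Proof. by rewrite /dot /cmul /cconj /=; ring. Qed.
Lemma cmul1v v : cmul (1, 0) v = v.
Proof. by case: v => x y; rewrite /cmul /=; congr pair; ring. Qed.
Lemma cmul_cconj e : dot e e = 1 -> cmul e (cconj e) = (1, 0).
Proof. by move=> h; rewrite /cmul /cconj /=; congr pair; last ring; rewrite -h /dot; ring. Qed.
Lemma cmulKc e v : dot e e = 1 -> cmul (cconj e) (cmul e v) = v.
Proof. by move=> h; rewrite cmulA [cmul (cconj e) e]cmulC cmul_cconj // cmul1v. Qed.
Lemma dot_cconj e : dot (cconj e) (cconj e) = dot e e.
Proof. by rewrite /dot /cconj /=; ring. Qed.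
Lemma dot_cmul2 e u v : dot (cmul e u) (cmul e v) = dot e e * dot u v.
Proof. by rewrite /dot /cmul /=; ring. Qed.
Lemma det_cmul2 e u v : det (cmul e u) (cmul e v) = dot e e * det u v.
Proof. by rewrite /dot /det /cmul /=; ring. Qed.
Lemma vsub_cmul e u v : vsub (cmul e u) (cmul e v) = cmul e (vsub u v).
Proof. by rewrite /vsub /cmul /=; congr pair; ring. Qed.
Lemma mir_cmul e v : mir (cmul e v) = cmul (cconj e) (mir v).
Proof. by rewrite /mir /cmul /cconj /=; congr pair; ring. Qed.

Lemma dist_cmul e u v : dot e e = 1 -> dist (cmul e u) (cmul e v) = dist u v.
Proof.
move=> h; have e1 := sqr_dist (cmul e u) (cmul e v);
  rewrite vsub_cmul dot_cmul2 h mul1r -sqr_dist in e1.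
by apply/eqP; rewrite -(@eqrXn2 _ 2) ?dist_ge0 // e1.
Qed.
Lemma path_length_cmul e p n : dot e e = 1 -> path_length (fun i => cmul e (p i)) n =
  path_length p n.
Proof. by move=> h; apply: eq_bigr => i _; rewrite dist_cmul. Qed.
Lemma orient_cmul e x y z : dot e e = 1 -> orient (cmul e x) (cmul e y) (cmul e z) = orient x y z.
Proof. by move=> h; rewrite /orient !vsub_cmul det_cmul2 h mul1r. Qed.

Lemma apex_sin2cos2 : apex_sin ^+ 2 + apex_cos ^+ 2 = 1.
Proof. by rewrite apex_sin_def apex_cos_def; field. Qed.
Lemma apex_sin_gt0 : 0 < apex_sin.
Proof. by rewrite apex_sin_def; lra. Qed.
Lemma apex_cos_gt0 : 0 < apex_cos.
Proof. by rewrite apex_cos_def; lra. Qed.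

(** The triangle is isosceles, so its mirror image is a rotated copy, with the legs
    exchanged. *)
Definition swap_frame : R * R := (- apex_cos, - apex_sin).
Lemma swap_frameE : [/\ dot swap_frame swap_frame = 1, cmul swap_frame uL = uR,
  cmul swap_frame uR = mir uL & cmul swap_frame uB = mir uB].
Proof.
have h := apex_sin2cos2; have h2 : apex_sin ^+ 2 = 1 - apex_cos ^+ 2 by rewrite -h addrK.
rewrite /dot /cmul /swap_frame /uL /uR /uB /mir /=; split; try (congr pair); ring: h2.
Qed.

(** The determinants say that [v] is a positive combination of [u] and [U]. In the
    application [a] and [b] are the displacements to a contact of [v] from contacts of [u]
    and [U], and the conclusion tells on which side of the line through the latter two
    contacts the first one lies. *)
Lemma cone_contact (u U v a b : R * R) : 0 < det u U * det u v -> 0 < det u U * det v U ->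
  dot u a <= 0 -> dot U b <= 0 -> 0 <= dot v a -> 0 <= dot v b -> det u U * det a b <= 0.
Proof.
move=> h1 h2 h3 h4 h5 h6.
have -> : det u U * det a b = dot u a * dot U b - dot u b * dot U a.
  by rewrite /det /dot; ring.
have e1 : det u U * dot v a = det v U * dot u a + det u v * dot U a by rewrite /det /dot; ring.
have e2 : det u U * dot v b = det v U * dot u b + det u v * dot U b by rewrite /det /dot; ring.
move: (dot u a) (dot U b) (dot u b) (dot U a) (dot v a) (dot v b) (det u U) (det u v)
  (det v U) h1 h2 h3 h4 h5 h6 e1 e2.
clear => x Y y X s t D bt al h1 h2 h3 h4 h5 h6 e1 e2.
have k1 : 0 <= (D * al) * x + (D * bt) * X.
  have -> : (D * al) * x + (D * bt) * X = D * (D * s) by rewrite e1; ring.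
  by rewrite mulrA -expr2 mulr_ge0 ?sqr_ge0.
have k2 : 0 <= (D * al) * y + (D * bt) * Y.
  have -> : (D * al) * y + (D * bt) * Y = D * (D * t) by rewrite e2; ring.
  by rewrite mulrA -expr2 mulr_ge0 ?sqr_ge0.
move: (D * al) (D * bt) h1 h2 k1 k2 => A B B0 A0 k1 k2.
have hp : 0 <= (A * y + B * Y) * (B * X) + (- B * Y) * (A * x + B * X).
  have Ax : A * x <= 0 by nra.
  have BX : 0 <= B * X by lra.
  have BY : 0 <= - B * Y by nra.
  by rewrite addr_ge0 // mulr_ge0.
have e : (A * y + B * Y) * (B * X) + (- B * Y) * (A * x + B * X) =
  (A * B) * (y * X - x * Y) by ring.
rewrite e in hp; rewrite pmulr_rge0 ?mulr_gt0 // in hp; lra.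
Qed.

Lemma unit_normal_unique u v x y z : dot u u = 1 -> dot v v = 1 ->
  dot u x = dot u y -> dot v x = dot v y -> dot u z <= dot u x -> dot v z <= dot v x ->
  orient x y z != 0 -> u = v.
Proof.
move=> uu vv h1 h2 h3 h4 nz.
pose d := vsub y x; pose m := vsub z x.
have ud : dot u d = 0 by move/eqP: h1; rewrite -subr_eq0 => /eqP; rewrite /d /dot /vsub /=; lra.
have vd : dot v d = 0 by move/eqP: h2; rewrite -subr_eq0 => /eqP; rewrite /d /dot /vsub /=; lra.
have um : dot u m <= 0 by move: h3; rewrite /m /dot /vsub /=; lra.
have vm : dot v m <= 0 by move: h4; rewrite /m /dot /vsub /=; lra.
have dm : det d m != 0 by [].
have uv0 : det u v = 0.
  apply/eqP; rewrite -(mulIr_eq0 _ (mulIf dm)).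
  have -> : det u v * det d m = dot u d * dot v m - dot u m * dot v d by rewrite /det /dot; ring.
  by rewrite ud vd mul0r mulr0 subrr.
have um0 : dot u m != 0.
  apply: contraNneq dm => h; rewrite -[det d m]mul1r -uu.
  have -> : dot u u * det d m = dot u d * det u m - dot u m * det u d by rewrite /det /dot; ring.
  by rewrite h ud !mul0r subrr.
have v_u : v = scl (dot u v) u.
  have e1 : dot u u * v.1 = dot u v * u.1 - u.2 * det u v by rewrite /dot /det; ring.
  have e2 : dot u u * v.2 = dot u v * u.2 + u.1 * det u v by rewrite /dot /det; ring.
  move: e1 e2; rewrite uv0 uu !mul1r !mulr0 subr0 addr0 /scl => <- <-.
  exact: surjective_pairing.
have : dot u v ^+ 2 == 1.
  have : dot u v ^+ 2 + det u v ^+ 2 = dot u u * dot v v by rewrite /dot /det; ring.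
  by rewrite uv0 expr0n addr0 uu vv mulr1 => /eqP.
rewrite sqrf_eq1 => /orP[]/eqP e; rewrite e in v_u.
  by rewrite v_u /scl !mul1r; case: (u).
move: vm; rewrite v_u dot_scl => vm; have um1 : dot u m = 0 by lra.
by rewrite um1 eqxx in um0.
Qed.

(** [uL] is not a positive combination of [uR] and [mir uL], so [cone_contact] does not
    apply. *)
Lemma upper_contacts (A B C : R * R) :
  dot uR B <= dot uR A -> dot uR C <= dot uR A ->
  dot uL A <= dot uL B -> dot uL C <= dot uL B ->
  dot (mir uL) A <= dot (mir uL) C -> dot (mir uL) B <= dot (mir uL) C ->
  0 <= orient A B C.
Proof.
have w0 := apex_sin_gt0; have c0 := apex_cos_gt0.
rewrite /orient /det /vsub /dot /mir /uR /uL /=; move: (apex_sin) (apex_cos) w0 c0 => w c w0 c0.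
case: A B C => [ax ay] [bx by_] [cx cy] /= h1 h2 h3 h4 h5 h6.
pose X := cx - ax; pose Y := cy - ay; pose P := bx - cx; pose Q := by_ - cy.
have -> : (bx - ax) * (cy - ay) - (by_ - ay) * (cx - ax) = P * Y - Q * X by rewrite /X /Y /P /Q;
  ring.
have g1 : 0 <= Y + Q by rewrite /Y /Q; lra.
have g2 : 0 <= Y by rewrite /Y; lra.
have g3 : 0 <= w * (X + P) + c * (Y + Q) by rewrite /X /Y /P /Q; lra.
have g4 : 0 <= w * P + c * Q by rewrite /P /Q; lra.
have g5 : 0 <= - w * X + c * Y by rewrite /X /Y; lra.
have g6 : 0 <= w * P - c * Q by rewrite /P /Q; lra.
move: X Y P Q g1 g2 g3 g4 g5 g6; clear -w0 c0 => X Y P Q g1 g2 g3 g4 g5 g6.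
rewrite -(pmulr_rge0 _ w0).
have [hq|hq] := lerP 0 Q.
  have : 0 <= Q * (- w * X + c * Y) by exact: mulr_ge0.
  have : 0 <= Y * (w * P - c * Q) by exact: mulr_ge0.
  lra.
have : 0 <= - Q * (w * (X + P) + c * (Y + Q)) by apply: mulr_ge0 => //; lra.
have : 0 <= (Y + Q) * (w * P + c * Q) by exact: mulr_ge0.
lra.
Qed.
End Contacts.

(** * Two triangles on a common hull edge *)

Section CommonEdge.
Variable R : rcfType.
Implicit Types u v e z : R * R.
Notation uR := (uR R). Notation uL := (uL R). Notation uB := (uB R).
Notation Kbound := (Kbound R).
Notation apex_sin := (apex_sin R).
Notation apex_cos := (apex_cos R).
Notation frame_A := (frame_A R).
Notation frame_B := (frame_B R).

Definition exposed (p : nat -> R * R) n := forall i, (i < n)%N ->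
  exists d, forall j, (j < n)%N -> j != i -> dot d (p j) < dot d (p i).

(** Reversing the part of the path from [i + 1] to [j] does not shorten it. *)
Definition two_opt (p : nat -> R * R) n := forall i j, (i < j)%N -> (j.+1 < n)%N ->
  dist (p i) (p i.+1) + dist (p j) (p j.+1) <= dist (p i) (p j) + dist (p i.+1) (p j.+1).

(** The support values are taken at contact points, the form in which they enter the
    calibrations. *)
Definition wide (p : nat -> R * R) n rho := forall e i j k, dot e e = 1 ->
  contact p n (cmul e uR) i -> contact p n (cmul e uL) j -> contact p n (cmul e uB) k ->
  rho <= dot (cmul e uR) (p i) + dot (cmul e uL) (p j) + dot (cmul e uB) (p k).
Definition ccw_edge (p : nat -> R * R) n a c := forall x, (x < n)%N -> x != a -> x != c ->
  0 < orient (p a) (p c) (p x).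

(** [v] lies in the open cone between the normals [uR] and [mir uL]. *)
Definition in_left v := (det uR v < 0) && (det v (mir uL) < 0).

Lemma left_normals : [/\ in_left uB, in_left (cmul frame_A uB), in_left (cmul frame_A uR),
  in_left (mir (cmul frame_A uL))
  & [/\ in_left (cmul frame_B uB), in_left (cmul frame_B uR) & in_left (mir (cmul frame_B uL))]].
Proof.
rewrite /in_left /uB /uR /uL /mir /cmul /det /= apex_sin_def apex_cos_def frame_A_def frame_B_def.
rewrite ![(_, _).1]/= ![(_, _).2]/=.
split; last split; apply/andP; split; lra.
Qed.

Lemma det_mir u v : det (mir u) (mir v) = - det u v.
Proof. by rewrite /det /mir /=; ring. Qed.
Lemma frame_A_unit : dot frame_A frame_A = 1.
Proof. by rewrite frame_A_def /dot ![(_, _).1]/= ![(_, _).2]/=; field. Qed.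
Lemma frame_B_unit : dot frame_B frame_B = 1.
Proof. by rewrite frame_B_def /dot ![(_, _).1]/= ![(_, _).2]/=; field. Qed.
Lemma mir_uR : mir uR = uR.
Proof. by rewrite /mir /uR /= oppr0. Qed.

Section Common.
Variables (p : nat -> R * R) (n : nat) (rho : R) (e : R * R).
Hypotheses (ext : exposed p n) (opt : two_opt p n) (wd : wide p n rho) (e1 : dot e e = 1).
Variables (a c b1 b2 : nat).
Hypotheses (ab1 : (a < b1)%N) (b1c : (b1 < c)%N) (ab2 : (a < b2)%N) (b2c : (b2 < c)%N).
Let q i := cmul (cconj e) (p i).
Hypotheses (ta : contact q n uR a) (tc : contact q n uR c) (tb1 : contact q n uL b1)
  (tb2 : contact q n (mir uL) b2).
Hypothesis ed : ccw_edge p n a c.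

Lemma same_side i j k l : (maxn i j < minn k l)%N -> (maxn k l < n)%N -> i != j -> k != l ->
  0 < orient (q i) (q j) (q k) * orient (q i) (q j) (q l).
Proof.
move=> h hn ij kl; rewrite /q !orient_cmul ?dot_cconj //.
exact: (separated_same_side ext opt).
Qed.

Lemma same_side_rev i j k l : (maxn k l < minn i j)%N -> (maxn i j < n)%N -> i != j -> k != l ->
  0 < orient (q i) (q j) (q k) * orient (q i) (q j) (q l).
Proof.
move=> h hn ij kl; rewrite /q !orient_cmul ?dot_cconj //.
exact: (separated_same_side_rev ext opt).
Qed.

Lemma edge_q x : (x < n)%N -> x != a -> x != c -> 0 < orient (q a) (q c) (q x).
Proof. by move=> hx xa xc; rewrite /q orient_cmul ?dot_cconj //; exact: ed. Qed.

Lemma contact_wide z : dot z z = 1 -> forall i j k, contact q n (cmul z uR) i ->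
  contact q n (cmul z uL) j ->
  contact q n (cmul z uB) k ->
  rho <= dot (cmul z uR) (q i) + dot (cmul z uL) (q j) + dot (cmul z uB) (q k).
Proof.
have dE v i : dot v (q i) = dot (cmul e v) (p i) by rewrite /q dot_cmul.
have tE v i : contact q n v i -> contact p n (cmul e v) i.
  by move=> [hi h]; split=> // j hj; rewrite -!dE; exact: h.
move=> z1 i j k /tE hi /tE hj /tE hk; rewrite !dE.
have := @wd (cmul e z); rewrite -!cmulA; apply=> //.
by rewrite dot_cmul2 e1 z1 mulr1.
Qed.

(** A contact on the left is not on the side of [c] of the line from [a] to [b2]. If it
    were visited after [b2], then [a] and [b2] would precede [c] and [x] and separate
    them. *)
Lemma left_before v x : in_left v -> contact q n v x -> (x <= b2)%N.
Proof.
move=> /andP[v1 v2] [hx tx]; rewrite leqNgt; apply/negP => b2x.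
have [hc _] := tc; have [ha tta] := ta; have [hb ttb] := tb2.
have lt : 0 <= orient (q a) (q b2) (q x).
  have D0 : det uR (mir uL) < 0.
    by rewrite /det /uR /uL /= mul0r mulN1r opprK add0r oppr_lt0 apex_sin_gt0.
  rewrite -(nmulr_rle0 _ D0).
  have -> : orient (q a) (q b2) (q x) = det (vsub (q x) (q a)) (vsub (q x) (q b2)).
    by rewrite /orient /det /vsub /=; ring.
  apply: (@cone_contact _ _ _ v); rewrite ?nmulr_rgt0 //.
  - by have := tta _ hx; rewrite /dot /vsub /=; lra.
  - by have := ttb _ hx; rewrite /dot /vsub /=; lra.
  - by have := tx _ ha; rewrite /dot /vsub /=; lra.
  - by have := tx _ hb; rewrite /dot /vsub /=; lra.
have ed2 : 0 < orient (q a) (q c) (q b2) by apply: edge_q; lia.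
have e2 : orient (q a) (q b2) (q c) = - orient (q a) (q c) (q b2).
  by rewrite /orient /det /vsub /=; ring.
have [xc|xc] := eqVneq x c; first by move: lt; rewrite xc e2; lra.
have : 0 < orient (q a) (q b2) (q c) * orient (q a) (q b2) (q x) by apply: same_side; lia.
rewrite e2; nra.
Qed.

Lemma right_after v x : in_left v -> contact q n (mir v) x -> (b1 <= x)%N.
Proof.
move=> /andP[v1 v2] [hx tx]; rewrite leqNgt; apply/negP => xb1.
have [hc ttc] := tc; have [ha _] := ta; have [hb ttb] := tb1.
have lt : orient (q c) (q b1) (q x) <= 0.
  have D0 : 0 < det uR uL.
    by rewrite /det /uR /uL /= mul0r mulN1r opprK add0r apex_sin_gt0.
  rewrite -(pmulr_rle0 _ D0).
  have -> : orient (q c) (q b1) (q x) = det (vsub (q x) (q c)) (vsub (q x) (q b1)).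
    by rewrite /orient /det /vsub /=; ring.
  apply: (@cone_contact _ _ _ (mir v)).
  - by rewrite pmulr_rgt0 // -mir_uR det_mir oppr_gt0.
  - by rewrite pmulr_rgt0 // -[uL]mirK det_mir oppr_gt0.
  - by have := ttc _ hx; rewrite /dot /vsub /=; lra.
  - by have := ttb _ hx; rewrite /dot /vsub /=; lra.
  - by have := tx _ hc; rewrite /dot /vsub /=; lra.
  - by have := tx _ hb; rewrite /dot /vsub /=; lra.
have ed2 : 0 < orient (q a) (q c) (q b1) by apply: edge_q; lia.
have e2 : orient (q c) (q b1) (q a) = orient (q a) (q c) (q b1).
  by rewrite /orient /det /vsub /=; ring.
have [xa|xa] := eqVneq x a; first by move: lt; rewrite xa e2; lra.
have : 0 < orient (q c) (q b1) (q a) * orient (q c) (q b1) (q x) by apply: same_side_rev; lia.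
rewrite e2; nra.
Qed.

(** Otherwise [a] and [b1] precede [c] and [b2] and separate them. *)
Lemma b2_le_b1 : (b2 <= b1)%N.
Proof.
rewrite leqNgt; apply/negP => lt.
have [hc ttc] := tc; have [ha tta] := ta; have [hb1 ttb1] := tb1; have [hb2 ttb2] := tb2.
have h1 : 0 <= orient (q a) (q b1) (q b2) by apply: upper_contacts; auto.
have : 0 < orient (q a) (q b1) (q c) * orient (q a) (q b1) (q b2) by apply: same_side; lia.
have h2 : 0 < orient (q a) (q c) (q b1) by apply: edge_q; lia.
have -> : orient (q a) (q b1) (q c) = - orient (q a) (q c)
  (q b1) by rewrite /orient /det /vsub /=; ring.
nra.
Qed.

(** Two triangles stand on the edge from [a] to [c]; contacts of the four auxiliary
    triangles lie far enough on one side to be ordered relative to [b2] and [b1]. *)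
Theorem common_edge_bound : 2%:R * rho <= Kbound * path_length p n.
Proof.
have n0 : (0 < n)%N by case: tc => /(leq_ltn_trans (leq0n _)).
have contactx v := contact_exists q v n0.
have [swp1 sL sR sB] := swap_frameE R.
have [lB lAB lAR lAL [lBB lBR lBL]] := left_normals.
have [q1 tq1] := contactx uB; have [q2 tq2] := contactx (mir uB).
have [ma tma] := contactx (cmul frame_A uB); have [ra tra] :=
  contactx (cmul frame_A uR); have [la tla] := contactx (cmul frame_A uL).
have [na tna] := contactx (mir (cmul frame_A uB)); have [sa tsa] :=
  contactx (mir (cmul frame_A uR)); have [ka tka] := contactx (mir (cmul frame_A uL)).
have [mb tmb] := contactx (cmul frame_B uB); have [rb trb] :=
  contactx (cmul frame_B uR); have [lb tlb] := contactx (cmul frame_B uL).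
have [nb tnb] := contactx (mir (cmul frame_B uB)); have [sb tsb] :=
  contactx (mir (cmul frame_B uR)); have [kb tkb] := contactx (mir (cmul frame_B uL)).
have mirfr z : [/\ cmul (cmul (cconj z) (swap_frame R)) uL = mir (cmul z uR),
   cmul (cmul (cconj z) (swap_frame R)) uR = mir (cmul z uL) &
     cmul (cmul (cconj z) (swap_frame R)) uB = mir (cmul z uB)].
  by rewrite -!cmulA sL sR sB !mir_cmul mir_uR.
have mirunit z : dot z z = 1 -> dot (cmul (cconj z) (swap_frame R)) (cmul (cconj z)
  (swap_frame R)) = 1.
  by move=> h; rewrite dot_cmul2 dot_cconj h swp1 mulr1.
have wm z i j k : dot z z = 1 -> contact q n (mir (cmul z uL)) i ->
  contact q n (mir (cmul z uR)) j ->
    contact q n (mir (cmul z uB)) k -> rho <= dot (mir (cmul z uR)) (q j) + dot (mir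
      (cmul z uL)) (q i) + dot (mir (cmul z uB)) (q k).
  move=> z1 hi hj hk; have [m1 m2 m3] := mirfr z.
  have := @contact_wide _ (mirunit z z1) i j k; rewrite m1 m2 m3 => /(_ hi hj hk); lra.
have one1 : dot (1, 0) ((1, 0) : R * R) = 1 by rewrite /dot /= mulr1 mulr0 addr0.
rewrite -(path_length_cmul p n (_ : dot (cconj e) (cconj e) = 1)); last by rewrite dot_cconj.
apply: (@common_edge_certificate _ q n rho q1 a ma ra ka mb rb kb b2 b1 q2 c na sa la nb sb lb).
- have lt v i : contact q n v i -> (i < n)%N by case.
  rewrite /= (lt _ _ tq1) (lt _ _ tq2) (lt _ _ ta) (lt _ _ tc) (lt _ _ tb1) (lt _ _ tb2).
  rewrite (lt _ _ tma) (lt _ _ tra) (lt _ _ tla) (lt _ _ tna) (lt _ _ tsa) (lt _ _ tka).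
  by rewrite (lt _ _ tmb) (lt _ _ trb) (lt _ _ tlb) (lt _ _ tnb) (lt _ _ tsb) (lt _ _ tkb).
- rewrite /= (left_before lB tq1) (ltnW ab2) (left_before lAB tma) (left_before lAR tra)
  (left_before lAL tka).
  by rewrite (left_before lBB tmb) (left_before lBR trb) (left_before lBL tkb).
- exact: b2_le_b1.
- rewrite /= (right_after lB tq2) (ltnW b1c) (right_after lAB tna) (right_after lAR tsa).
  rewrite (right_after lBB tnb) (right_after lBR tsb).
  by rewrite (right_after lAL) ?mirK // (right_after lBL) ?mirK.
- have := contact_wide one1; rewrite !cmul1v; exact.
- have := @wm (1, 0) b2 c q2 one1; rewrite !cmul1v mir_uR; exact.
- exact: (contact_wide frame_A_unit).
- exact: (wm _ _ _ _ frame_A_unit).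
- exact: (contact_wide frame_B_unit).
- exact: (wm _ _ _ _ frame_B_unit).
Qed.
End Common.
End CommonEdge.

(** * Length bound from two flips *)

Section FlipsBound.
Variable R : rcfType.
Implicit Types u v e z : R * R.
Implicit Types p : nat -> R * R.
Notation uR := (uR R). Notation uL := (uL R). Notation uB := (uB R).
Notation Kbound := (Kbound R).
Notation apex_sin := (apex_sin R).
Notation apex_cos := (apex_cos R).

Definition straddle p n (e V W : R * R) a b c :=
  [/\ (a < b < c)%N, contact p n (cmul e V) a, contact p n (cmul e V) c & contact p n (cmul e W) b].

Definition leg_pair (V W : R * R) := (V, W) = (uR, uL) \/ (V, W) = (uL, uR).

Lemma leg_pair_sum V W : leg_pair V W -> W = (- V.1 - uB.1, - V.2 - uB.2).
Proof. by case=> -[-> ->]; rewrite /uR /uL /uB /=; congr pair; ring. Qed.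

Lemma leg_pair_legbase V W : leg_pair V W -> legbase V uB.
Proof.
case=> -[-> _]; rewrite /legbase /dot /uR /uL /uB /= base_sq_def leg_base_def apex_sin_def
  apex_cos_def; split; lra.
Qed.

Lemma leg_pair_det V W : leg_pair V W -> det V uB ^+ 2 = apex_sin ^+ 2.
Proof. by case=> -[-> _]; rewrite /det /uR /uL /uB /=; ring. Qed.

Lemma legbase_cmul e u v : dot e e = 1 -> legbase u v -> legbase (cmul e u) (cmul e v).
Proof. by move=> e1 [h1 h2 h3]; rewrite /legbase !dot_cmul2 e1 !mul1r. Qed.

Section Main.
Variables (n : nat) (rho : R).

Lemma wide_legs p V W e i j k : wide p n rho -> leg_pair V W -> dot e e = 1 ->
  contact p n (cmul e V) i -> contact p n (cmul e W) j -> contact p n (cmul e uB) k ->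
  rho <= dot (cmul e V) (p i) - dot (cmul e V) (p j) - dot (cmul e uB) (p j) + dot (cmul e uB)
    (p k).
Proof.
move=> wd lp e1 ti tj tk.
have -> : dot (cmul e V) (p i) - dot (cmul e V) (p j) - dot (cmul e uB) (p j) + dot (cmul e uB)
  (p k) =
  dot (cmul e V) (p i) + dot (cmul e W) (p j) + dot (cmul e uB) (p k).
  by rewrite (leg_pair_sum lp) /dot /cmul /=; ring.
case: lp ti tj => -[-> ->] ti tj; first exact: wd.
by rewrite [X in _ <= X + _]addrC; apply: wd.
Qed.

Lemma contact_eq p v i j : contact p n v i -> contact p n v j -> dot v (p i) = dot v (p j).
Proof. by move=> [hi Hi] [hj Hj]; apply/eqP; rewrite eq_le Hi // Hj. Qed.

Section Fixed.
Variable p : nat -> R * R.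
Hypotheses (ext : exposed p n) (opt : two_opt p n) (wd : wide p n rho).

Lemma straddle_pair V W V' W' e e' a1 b1 c1 a2 b2 c2 : leg_pair V W -> leg_pair V' W' ->
  dot e e = 1 -> dot e' e' = 1 ->
  straddle p n e V W a1 b1 c1 -> straddle p n e' V' W' a2 b2 c2 ->
  (b2 <= a1)%N -> (c2 <= b1)%N -> V = V' \/ (c2 <= a1)%N -> 2%:R * rho <= Kbound * path_length p n.
Proof.
move=> lp lp' e1 e1' [/andP[tm1 tm2] ta tc tb] [/andP[tm1' tm2'] ta' tc' tb'] h1 h2 h3.
have n0 : (0 < n)%N by case: tc => /(leq_ltn_trans (leq0n _)).
have [q tq] := contact_exists p (cmul e uB) n0.
have [q' tq'] := contact_exists p (cmul e' uB) n0.
have lt v i : contact p n v i -> (i < n)%N by case.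
apply: (@two_straddles_bound _ p n rho (cmul e V) (cmul e uB) (cmul e' V')
  (cmul e' uB) a1 b1 c1 q a2 b2 c2 q').
- exact: legbase_cmul (leg_pair_legbase lp).
- exact: legbase_cmul (leg_pair_legbase lp').
- rewrite /= (lt _ _ ta) (lt _ _ tb) (lt _ _ tc) (lt _ _ tq).
  by rewrite (lt _ _ ta') (lt _ _ tb') (lt _ _ tc') (lt _ _ tq').
- exact: (wide_legs wd lp).
- exact: (wide_legs wd lp').
- exact: contact_eq.
- exact: contact_eq.
- by rewrite (ltnW tm1').
- by rewrite (ltnW tm1) (ltnW tm2).
- by rewrite (ltnW tm2').
- case: h3 => [eV|]; [right|by left].
  exists (cmul e' (cconj e)); first by rewrite dot_cmul2 dot_cconj e1 e1' mulr1.
  by rewrite -!cmulA !cmulKc // det_cmul2 e1 mul1r eV (leg_pair_det lp').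
Qed.

Lemma opposite_edges_bound V W e e' a1 b1 c1 a2 b2 c2 : leg_pair V W ->
  dot e e = 1 -> dot e' e' = 1 ->
  straddle p n e V W a1 b1 c1 -> straddle p n e' V W a2 b2 c2 ->
  ccw_edge p n a1 c1 -> ccw_edge p n c2 a2 -> 2%:R * rho <= Kbound * path_length p n.
Proof.
move=> lp e1 e1' s1 s2 E1 E2.
have [/andP[tm1 tm2] _ [hc _] _] := s1; have [/andP[tm1' tm2'] _ [hc' _] _] := s2.
have E2' x : (x < n)%N -> x != a2 -> x != c2 -> 0 < orient (p c2) (p a2) (p x).
  by move=> h ha hb; exact: E2.
have := @opposite_edges_order _ p n ext opt a1 b1 c1 a2 b2 c2 hc hc'.
rewrite tm1 tm2 tm1' tm2' => /(_ isT isT E1 E2') /orP[]/andP[h1 h2].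
  exact: (straddle_pair lp lp e1 e1' s1 s2 h1 h2 (or_introl erefl)).
exact: (straddle_pair lp lp e1' e1 s2 s1 h1 h2 (or_introl erefl)).
Qed.

(** Both hull edges are traversed counterclockwise in time. If the triangles overlap in
    time and the edges start at different points, then these starting points precede the
    two end points and separate them. If they start at the same point, the edges coincide,
    and so do their normals, which makes the second triangle the mirror image of the
    first. *)
Lemma parallel_edges_bound e e' a1 b1 c1 a2 b2 c2 :
  dot e e = 1 -> dot e' e' = 1 ->
  straddle p n e uR uL a1 b1 c1 -> straddle p n e' uL uR a2 b2 c2 ->
  ccw_edge p n a1 c1 -> ccw_edge p n a2 c2 -> 2%:R * rho <= Kbound * path_length p n.
Proof.
move=> e1 e1' s1 s2 E1 E2.
have [/andP[tm1 tm2] ta tc tb] := s1; have [/andP[tm1' tm2'] ta' tc' tb'] := s2.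
have [ha tta] := ta; have [hc ttc] := tc; have [hb _] := tb.
have [ha' tta'] := ta'; have [hc' ttc'] := tc'; have [hb' _] := tb'.
have lRL : leg_pair uR uL by left.
have lLR : leg_pair uL uR by right.
have [h|h] := leqP c2 a1.
  by apply: (straddle_pair lRL lLR e1 e1' s1 s2); [lia|lia|right].
have [h'|h'] := leqP c1 a2.
  by apply: (straddle_pair lLR lRL e1' e1 s2 s1); [lia|lia|right].
have [ea|na] := eqVneq a1 a2; last first.
  have k1 : 0 < orient (p a1) (p c1) (p a2) by apply: E1; lia.
  have k2 : 0 < orient (p a2) (p c2) (p a1) by apply: E2; lia.
  have [ec|nc] := eqVneq c1 c2.
    move: k1 k2; rewrite ec.
    have -> : orient (p a2) (p c2) (p a1) = - orient (p a1) (p c2)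
      (p a2) by rewrite /orient /det /vsub /=; ring.
    lra.
  have : 0 < orient (p a1) (p a2) (p c1) * orient (p a1) (p a2) (p c2).
    by apply: (separated_same_side ext opt); lia.
  have -> : orient (p a1) (p a2) (p c1) = - orient (p a1) (p c1)
    (p a2) by rewrite /orient /det /vsub /=; ring.
  have -> : orient (p a1) (p a2) (p c2) = orient (p a2) (p c2)
    (p a1) by rewrite /orient /det /vsub /=; ring.
  nra.
subst a2.
have [ec|nc] := eqVneq c1 c2; last first.
  have k1 : 0 < orient (p a1) (p c1) (p c2) by apply: E1; lia.
  have k2 : 0 < orient (p a1) (p c2) (p c1) by apply: E2; lia.
  move: k1; have -> : orient (p a1) (p c1) (p c2) = - orient (p a1) (p c2)
    (p c1) by rewrite /orient /det /vsub /=; ring.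
  lra.
subst c2.
have un : cmul e uR = cmul e' uL.
  have kb : 0 < orient (p a1) (p c1) (p b1) by apply: E1; lia.
  apply: (@unit_normal_unique _ _ _ (p a1) (p c1) (p b1)).
  - by have [->] := legbase_cmul e1 (leg_pair_legbase lRL).
  - by have [->] := legbase_cmul e1' (leg_pair_legbase lLR).
  - exact: contact_eq ta tc.
  - exact: contact_eq ta' tc'.
  - exact: tta.
  - exact: tta'.
  - by rewrite gt_eqF.
(* the second frame is the mirror image of the first *)
have fr : cmul e' uR = cmul e (mir uL).
  have [s11 sL sR _] := swap_frameE R.
  rewrite -sR cmulA; congr cmul.
  have uL1 : dot uL uL = 1 by case: (leg_pair_legbase lLR).
  have : cmul (cmul e (swap_frame R)) uL = cmul e' uL by rewrite -cmulA sL.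
  move/(congr1 (fun z : R * R => cmul z (cconj uL))).
  by rewrite /= -!cmulA cmul_cconj // ![cmul _ (1, 0)]cmulC !cmul1v.
have tq v i : contact p n (cmul e v) i -> contact (fun k => cmul (cconj e) (p k)) n v i.
  by move=> [hi H]; split=> // j hj; rewrite -!dot_cmul; exact: H.
apply: (common_edge_bound ext opt wd e1 tm1 tm2 tm1' tm2').
- exact: tq.
- exact: tq.
- exact: tq.
- by apply: tq; rewrite -fr.
- exact: E1.
Qed.
End Fixed.

(** Turning counterclockwise through this position, the contact with the right leg
    changes from being visited earlier than the contact with the left leg to being visited
    later. *)
Definition forward_flip p := exists e a b c, dot e e = 1 /\
  ((straddle p n e uR uL a b c /\ ccw_edge p n a c) \/ (straddle p n e uL uR a b c /\
    ccw_edge p n c a)).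
Definition backward_flip p := exists e a b c, dot e e = 1 /\
  ((straddle p n e uR uL a b c /\ ccw_edge p n c a) \/ (straddle p n e uL uR a b c /\
    ccw_edge p n a c)).

Definition backward p k := p (n.-1 - k)%N.
Lemma exposed_rev p : exposed p n -> exposed (backward p) n.
Proof.
move=> h i hi; have [|d hd] := h (n.-1 - i)%N; first by lia.
by exists d => j hj ij; apply: hd; lia.
Qed.
Lemma two_opt_rev p : two_opt p n -> two_opt (backward p) n.
Proof.
move=> h i j ij jn.
have hi : (n.-1 - j.+1 < n.-1 - i.+1)%N by lia.
have hj : ((n.-1 - i.+1).+1 < n)%N by lia.
have := h _ _ hi hj; rewrite /backward.
have -> : (n.-1 - j.+1).+1 = (n.-1 - j)%N by lia.
have -> : (n.-1 - i.+1).+1 = (n.-1 - i)%N by lia.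
rewrite [dist (p (n.-1 - i)%N) (p (n.-1 - i.+1)%N)]dist_sym [dist (p (n.-1 - j)%N) (p
  (n.-1 - j.+1)%N)]dist_sym.
rewrite [dist (p (n.-1 - i)%N) (p (n.-1 - j)%N)]dist_sym [dist (p (n.-1 - i.+1)%N) (p
  (n.-1 - j.+1)%N)]dist_sym.
lra.
Qed.
Lemma contact_rev p v i : (i < n)%N -> contact p n v (n.-1 - i)%N <-> contact (backward p) n v i.
Proof.
move=> hi; split=> -[h H]; split=> //; try lia.
  by move=> j hj; apply: H; lia.
move=> j hj; have := H (n.-1 - j)%N; rewrite /backward.
have -> : (n.-1 - (n.-1 - j) = j)%N by lia.
by apply; lia.
Qed.
Lemma wide_rev p : wide p n rho -> wide (backward p) n rho.
Proof.
move=> h e i j k e1 ti tj tk; apply: h => //.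
- by apply/contact_rev; case: (ti).
- by apply/contact_rev; case: (tj).
- by apply/contact_rev; case: (tk).
Qed.
Lemma straddle_rev p e V W a b c : straddle p n e V W a b c ->
  straddle (backward p) n e V W (n.-1 - c)%N (n.-1 - b)%N (n.-1 - a)%N.
Proof.
have back v i : contact p n v i -> contact (backward p) n v (n.-1 - i)%N.
  move=> t; have hi : (i < n)%N by case: t.
  have hr : (n.-1 - i < n)%N by lia.
  apply: (proj1 (contact_rev p v hr)).
  by have -> : (n.-1 - (n.-1 - i) = i)%N by lia.
move=> [tm ta tc tb]; split; try exact: back.
by case: tc; lia.
Qed.
Lemma ccw_edge_rev p a c : (a < n)%N -> (c < n)%N -> ccw_edge p n a c ->
  ccw_edge (backward p) n (n.-1 - a)%N (n.-1 - c)%N.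
Proof.
move=> ha hc h x hx xa xc; rewrite /backward.
have -> : (n.-1 - (n.-1 - a) = a)%N by lia.
have -> : (n.-1 - (n.-1 - c) = c)%N by lia.
by apply: h; lia.
Qed.

Lemma backward_flip_of_reversed p : forward_flip (backward p) -> backward_flip p.
Proof.
have revK : backward (backward p) =1 (fun k => p (n.-1 - (n.-1 - k))%N) by [].
have contactK v i : contact (backward (backward p)) n v i -> contact p n v i.
  move=> [h H]; split=> // j hj; have := H j hj; rewrite /backward.
  by rewrite !subKn //; lia.
have strK e V W a b c : straddle (backward (backward p)) n e V W a b c -> straddle p n e V W a b c.
  by case=> tm ta tb tc; split=> //; exact: contactK.
have edK a c : (a < n)%N -> (c < n)%N -> ccw_edge (backward (backward p)) n a c -> ccw_edge p n a c.
  by move=> ha hc H x hx xa xc; have := H x hx xa xc; rewrite /backward !subKn //; lia.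
move=> [e [a [b [c [e1 H]]]]]; exists e, (n.-1 - c)%N, (n.-1 - b)%N, (n.-1 - a)%N; split=> //.
case: H => -[s E]; [left|right]; (split; first by apply: strK; exact: straddle_rev).
  by case: (s) => tm [ha _] [hc _] _; apply: edK; [lia|lia|exact: ccw_edge_rev].
by case: (s) => tm [ha _] [hc _] _; apply: edK; [lia|lia|exact: ccw_edge_rev].
Qed.

Theorem flips_bound p : exposed p n -> two_opt p n -> wide p n rho -> forward_flip p ->
  backward_flip p ->
  2%:R * rho <= Kbound * path_length p n.
Proof.
move=> ext opt wd [e [a [b [c [e1 H]]]]] [e' [a' [b' [c' [e1' H']]]]].
have lRL : leg_pair uR uL by left.
have lLR : leg_pair uL uR by right.
case: H => -[s E]; case: H' => -[s' E'].
- exact: (opposite_edges_bound ext opt wd lRL e1 e1' s s').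
- exact: (parallel_edges_bound ext opt wd e1 e1' s s').
- have n0 : (0 < n)%N by case: s => _ [/(leq_ltn_trans (leq0n _))].
  rewrite -path_length_rev //.
  have [tm [ha _] [hc _] _] := s; have [tm' [ha' _] [hc' _] _] := s'.
  apply: (parallel_edges_bound (exposed_rev ext) (two_opt_rev opt) (wide_rev wd) e1' e1
    (straddle_rev s') (straddle_rev s)).
    exact: ccw_edge_rev.
  exact: ccw_edge_rev.
- exact: (opposite_edges_bound ext opt wd lLR e1' e1 s' s).
Qed.
End Main.
End FlipsBound.

(** * Existence of flips *)

Local Open Scope classical_set_scope.
Local Open Scope ring_scope.

Section Flips.
Variable R : realType.
Implicit Types u v e z : R * R.
Notation uR := (uR R). Notation uL := (uL R). Notation uB := (uB R).
Notation Kbound := (Kbound R).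
Notation apex_sin := (apex_sin R).
Notation apex_cos := (apex_cos R).
Variables (p : nat -> R * R) (n : nat).

Lemma contact_scl k v i : 0 < k -> contact p n (scl k v) i <-> contact p n v i.
Proof.
move=> k0; split=> -[hi H]; split=> // j hj; have := H j hj; rewrite !dot_scl ?ler_pM2l //.
Qed.

(** Contacts do not depend on the length of a normal, so frames need not be unit vectors
    and linear interpolation can replace rotation. *)
Definition interp e0 e1 (t : R) : R * R := vadd (scl (1 - t) e0) (scl t e1).

Lemma dot_interp e0 e1 t V x : dot (cmul (interp e0 e1 t) V) x =
  dot (cmul e0 V) x + t * (dot (cmul e1 V) x - dot (cmul e0 V) x).
Proof. by rewrite /interp /dot /cmul /vadd /scl /=; ring. Qed.

(** A point that is not a contact at [t0] is exceeded there by another point, and also at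
    nearby parameters. *)
Lemma contacts_near e0 e1 V t0 : exists2 d, 0 < d & forall t i, `|t - t0| < d ->
  contact p n (cmul (interp e0 e1 t) V) i -> contact p n (cmul (interp e0 e1 t0) V) i.
Proof.
have one i : exists2 d, 0 < d & forall t, `|t - t0| < d ->
  contact p n (cmul (interp e0 e1 t) V) i -> contact p n (cmul (interp e0 e1 t0) V) i.
  have [h|h] := pselect (contact p n (cmul (interp e0 e1 t0) V) i); first by exists 1.
  have [hi|hi] := boolP (i < n)%N; last by exists 1 => // t _ [hi']; rewrite hi' in hi.
  have [j hj lt] : exists2 j, (j < n)%N & dot (cmul (interp e0 e1 t0) V) (p i) < dot (cmul
    (interp e0 e1 t0) V) (p j).
    apply: contrapT => nex; apply: h; split=> // j hj; rewrite leNgt; apply/negP => lt.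
    by apply: nex; exists j.
  pose s := (dot (cmul e1 V) (p j) - dot (cmul e0 V) (p j)) - (dot (cmul e1 V) (p i) - dot
    (cmul e0 V) (p i)).
  pose g := dot (cmul (interp e0 e1 t0) V) (p j) - dot (cmul (interp e0 e1 t0) V) (p i).
  have g0 : 0 < g by rewrite subr_gt0.
  have s0 : 0 < `|s| + 1 by rewrite ltr_wpDl.
  exists (g / (`|s| + 1)); first by rewrite divr_gt0.
  move=> t ht [_ /(_ j hj)]; rewrite leNgt => /negP; case.
  have e : dot (cmul (interp e0 e1 t) V) (p j) - dot (cmul (interp e0 e1 t) V) (p i) =
    g + (t - t0) * s.
    by rewrite /g /s !dot_interp; ring.
  rewrite -subr_gt0 e; rewrite ltr_pdivlMr // in ht.
  have : `|(t - t0) * s| <= `|t - t0| * (`|s| + 1).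
    by rewrite normrM ler_wpM2l // lerDl.
  have := ler_norm (- ((t - t0) * s)); rewrite normrN; lra.
have all m : exists2 d, 0 < d & forall t i, (i < m)%N -> `|t - t0| < d ->
  contact p n (cmul (interp e0 e1 t) V) i -> contact p n (cmul (interp e0 e1 t0) V) i.
  elim: m => [|m [d d0 H]]; first by exists 1.
  have [d' d'0 H'] := one m.
  exists (Num.min d d'); first by rewrite lt_min d0.
  move=> t i; rewrite ltnS leq_eqVlt lt_min => /orP[/eqP->|hi] /andP[h1 h2]; first exact: H'.
  exact: H.
have [d d0 H] := all n.
by exists d => // t i ht hi; apply: H ht (hi) => //; case: hi.
Qed.

Definition early v :=
  exists i j, [/\ contact p n (cmul v uR) i, contact p n (cmul v uL) j & (i <= j)%N].
Definition no_common :=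
  forall v i, v != (0, 0) -> contact p n (cmul v uR) i -> ~ contact p n (cmul v uL) i.

Hypotheses (ext : exposed p n) (n0 : (0 < n)%N).

Lemma ccw_edge_of_contacts v v' a y : 0 < det v v' -> a != y -> contact p n v a ->
  contact p n v y ->
  dot v' (p a) <= dot v' (p y) -> ccw_edge p n a y.
Proof.
move=> dv ay [ha Ha] [hy Hy] h x hx xa xy.
rewrite lt_neqAle eq_sym (non_collinear ext) //=; try by rewrite 1?eq_sym.
have e : dot v (p a) = dot v (p y) by apply/eqP; rewrite eq_le Ha // Hy.
have hvx := Ha _ hx.
rewrite -(pmulr_rge0 _ dv).
have -> : det v v' * orient (p a) (p y) (p x) = (dot v (p a) - dot v (p x)) * (dot v'
  (p y) - dot v' (p a))
   + (dot v (p y) - dot v (p a)) * (dot v' (p x) - dot v' (p a)).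
  by rewrite /orient /det /dot /vsub /=; ring.
rewrite -e subrr mul0r addr0; apply: mulr_ge0; lra.
Qed.

Lemma unit_frame v : v != (0, 0) -> exists e, dot e e = 1 /\ forall V i,
  contact p n (cmul v V) i -> contact p n (cmul e V) i.
Proof.
move=> v0; have d0 : 0 < dot v v.
  rewrite lt_neqAle /dot -!expr2 addr_ge0 ?sqr_ge0 // andbT eq_sym paddr_eq0 ?sqr_ge0 // !sqrf_eq0.
  by apply: contra v0; case: (v) => x y /= /andP[/eqP-> /eqP->].
pose k := (Num.sqrt (dot v v))^-1.
have k0 : 0 < k by rewrite invr_gt0 sqrtr_gt0.
exists (scl k v); split.
  have -> : dot (scl k v) (scl k v) = k ^+ 2 * dot v v by rewrite /dot /scl /=; ring.
  by rewrite /k exprVn sqr_sqrtr ?ltW // mulVf // gt_eqF.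
move=> V i; have -> : cmul (scl k v) V = scl k (cmul v V) by rewrite /cmul /scl /=; congr pair;
  ring.
by move/(contact_scl _ _ k0).
Qed.

Lemma det_nz e0 e1 v : det e0 v != 0 \/ det v e1 != 0 -> v != (0, 0).
Proof.
by move=> h; apply/eqP => v0; case: h => /eqP; apply; rewrite v0 /det /=; ring.
Qed.

(** Let [s] be the supremum of the parameters with an early pair of contacts. Contacts at
    nearby parameters are contacts at [s], so at [s] there are contacts [a], [b] with the
    right and left legs such that [a < b], and also contacts [y], [z] with [z < y]; hence
    one of the legs is touched twice. *)
Lemma flip_between e0 e1 : no_common -> 0 < det e0 e1 -> early e0 -> ~ early e1 -> forward_flip n p.
Proof.
move=> nc d01 P0 P1.
pose D := interp e0 e1.
pose A : set R := [set t | 0 <= t <= 1 /\ early (D t)].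
have D0 : D 0 = e0 by rewrite /D /interp /vadd /scl; case: (e0) => x y /=; congr pair; ring.
have D1 : D 1 = e1 by rewrite /D /interp /vadd /scl; case: (e1) => x y /=; congr pair; ring.
have A0 : A 0 by split; rewrite ?lexx ?ler01 ?D0.
have supA : has_sup A by split; [exists 0 | exists 1 => t [/andP[]]].
pose s := sup A.
have s0 : 0 <= s by apply: ub_le_sup => //; case: supA.
have s1 : s <= 1 by apply: ge_sup; [exists 0 | move=> t [/andP[]]].
have [dR dR0 HR] := contacts_near e0 e1 uR s.
have [dL dL0 HL] := contacts_near e0 e1 uL s.
pose d := Num.min dR dL.
have d0 : 0 < d by rewrite lt_min dR0.
have near t V i : (V = uR \/ V = uL) -> `|t - s| < d -> contact p n (cmul (D t) V) i ->
  contact p n (cmul (D s) V) i.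
  by rewrite lt_min => -[->|->] /andP[h1 h2]; [exact: HR | exact: HL].
have dD t t' : det (D t) (D t') = (t' - t) * det e0 e1.
  by rewrite /D /interp /det /vadd /scl /=; ring.
have Dnz t : D t != (0, 0).
  have [h|h] := eqVneq t 1.
    apply: (@det_nz e0 e1); left.
    by have := dD 0 t; rewrite D0 h subr0 mul1r => ->; rewrite gt_eqF.
  apply: (@det_nz e0 e1); right.
  have := dD t 1; rewrite D1 => ->; apply: mulf_neq0; last by rewrite gt_eqF.
  by rewrite subr_eq0 eq_sym.
have [t [At st]] : exists t, A t /\ s - d < t.
  by have [t' At lt] := sup_adherent d0 supA; exists t'.
have ts : t <= s by apply: ub_le_sup; [case: supA | exact: At].
have [a [b [ta tb ab]]] : early (D t) by case: At.
have tns : `|t - s| < d by rewrite ler0_norm; lra.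
(* contacts just before s stay contacts at s *)
have {}ta := near _ _ _ (or_introl erefl) tns ta.
have {}tb := near _ _ _ (or_intror erefl) tns tb.
have ab' : (a < b)%N.
  rewrite ltn_neqAle ab andbT; apply/eqP => e; subst b.
  exact: (nc _ _ (Dnz s) ta tb).
have s1' : s < 1.
  rewrite lt_neqAle s1 andbT; apply/eqP => e; apply: P1.
  by rewrite -D1 -e; exists a, b.
(* a frame just after s, whose contacts are also contacts at s *)
pose u := s + Num.min (d / 2%:R) (1 - s).
have m0 : 0 < Num.min (d / 2%:R) (1 - s) by rewrite lt_min divr_gt0 ?ltr0n // subr_gt0.
have su : s < u by rewrite ltrDl.
have u1 : u <= 1.
  have : Num.min (d / 2%:R) (1 - s) <= 1 - s by rewrite ge_min lexx orbT.
  rewrite /u; lra.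
have uns : `|u - s| < d.
  rewrite gtr0_norm; last by rewrite subr_gt0.
  have : Num.min (d / 2%:R) (1 - s) <= d / 2%:R by rewrite ge_min lexx.
  rewrite /u; lra.
have nPu : ~ early (D u).
  move=> P; have : u <= s by apply: ub_le_sup; [case: supA | split => //; rewrite u1 andbT; lra].
  by rewrite leNgt su.
have [y ty] := contact_exists p (cmul (D u) uR) n0.
have [z tz] := contact_exists p (cmul (D u) uL) n0.
have zy : (z < y)%N.
  by rewrite ltnNge; apply/negP => h; apply: nPu; exists y, z.
have ty' := near _ _ _ (or_introl erefl) uns ty.
have tz' := near _ _ _ (or_intror erefl) uns tz.
have dsu : 0 < det (D s) (D u) by rewrite dD mulr_gt0 // subr_gt0.
have dV V : dot V V = 1 -> 0 < det (cmul (D s) V) (cmul (D u) V).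
  by move=> V1; rewrite cmulC [cmul (D u) V]cmulC det_cmul2 V1 mul1r.
have uR1 : dot uR uR = 1 by rewrite /dot /uR /=; ring.
have uL1 : dot uL uL = 1 by have [] := leg_pair_legbase (or_intror erefl : leg_pair uL uR).
have eR : a != y -> ccw_edge p n a y.
  move=> ay; apply: (ccw_edge_of_contacts (dV _ uR1) ay ta ty').
  by case: ty => _; apply; case: ta.
have eL : b != z -> ccw_edge p n b z.
  move=> bz; apply: (ccw_edge_of_contacts (dV _ uL1) bz tb tz').
  by case: tz => _; apply; case: tb.
have dis i j : contact p n (cmul (D s) uR) i -> contact p n (cmul (D s) uL) j -> i != j.
  by move=> hi hj; apply/eqP => e; subst j; exact: (nc _ _ (Dnz s) hi hj).
have n1 := dis _ _ ta tz'; have n2 := dis _ _ ty' tb; have n3 := dis _ _ ty' tz'.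
have [e [e1' He]] := unit_frame (Dnz s).
have fR : (a < b < y)%N -> forward_flip n p.
  move=> tm; exists e, a, b, y; split; first exact: e1'; left; split; last by apply: eR;
    move: tm; clear; lia.
  by split; [exact: tm | exact: He ta | exact: He ty' | exact: He tb].
have fL x : contact p n (cmul (D s) uR) x -> (z < x < b)%N -> forward_flip n p.
  move=> tx tm; exists e, z, x, b; split; first exact: e1'; right; split; last by apply: eL;
    move: tm; clear; lia.
  by split; [exact: tm | exact: He tz' | exact: He tb | exact: He tx].
have [by'|by'] := ltnP b y; first by apply: fR; rewrite ab'.
by apply: (fL y ty'); rewrite zy ltn_neqAle by' n2.
Qed.

(** Interpolation covers less than a half turn; [y] is reached from [x] through quarter
    turns. *)
Lemma ccw_chain (P : R * R -> Prop) x y : x != (0, 0) ->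
  (forall k v, 0 < k -> P (scl k v) -> P v) -> P x -> ~ P y -> y != (0, 0) ->
  exists e0 e1, [/\ 0 < det e0 e1, P e0 & ~ P e1].
Proof.
move=> x0 Pscl Px Py y0.
have pos v : v != (0, 0) -> 0 < dot v v.
  move=> v0; rewrite lt_neqAle /dot -!expr2 addr_ge0 ?sqr_ge0 // andbT eq_sym paddr_eq0 ?sqr_ge0
    // !sqrf_eq0.
  by apply: contra v0; case: (v) => a b /= /andP[/eqP-> /eqP->].
have xx := pos _ x0; have yy := pos _ y0.
pose ix : R * R := (- x.2, x.1); pose nx : R * R := (- x.1, - x.2).
have [h1|h1] := ltP 0 (det x y); first by exists x, y.
have d1 : 0 < det x ix by rewrite (_ : det x ix = dot x x) // /det /dot /ix /=; ring.
have [Pi|nPi] := pselect (P ix); last by exists x, ix.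
have [h2|h2] := ltP 0 (det ix y); first by exists ix, y.
have d2 : 0 < det ix nx by rewrite (_ : det ix nx = dot x x) // /det /dot /ix /nx /=; ring.
have [Pn|nPn] := pselect (P nx); last by exists ix, nx.
have [h3|h3] := ltP 0 (det nx y); first by exists nx, y.
exfalso; apply: Py.
have e : det nx y = - det x y by rewrite /det /nx /=; ring.
have dt0 : det x y = 0 by lra.
have e' : det ix y = - dot x y by rewrite /det /dot /ix /=; ring.
have l : dot x y ^+ 2 + det x y ^+ 2 = dot x x * dot y y by rewrite /dot /det /=; ring.
have dp : 0 < dot x y.
  rewrite lt_neqAle; apply/andP; split; last by lra.
  apply/eqP => h; move: l; rewrite dt0 -h expr0n addr0 => /esym/eqP.
  by rewrite mulf_eq0 !gt_eqF.
apply: (Pscl (dot x x / dot x y)); first by rewrite divr_gt0.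
suff -> : scl (dot x x / dot x y) y = x by [].
have dn : dot x y != 0 by rewrite gt_eqF.
have k1 : dot x x * y.1 = dot x y * x.1 - x.2 * det x y by rewrite /dot /det /=; ring.
have k2 : dot x x * y.2 = dot x y * x.2 + x.1 * det x y by rewrite /dot /det /=; ring.
rewrite dt0 mulr0 subr0 in k1; rewrite dt0 mulr0 addr0 in k2.
by rewrite /scl ![_ / _ * _]mulrAC k1 k2 ![dot x y * _]mulrC !mulfK //; case: (x).
Qed.

(** Start where the first point touches the right leg, so that its contact is early, and
    turn to where the last point is the only one that does. *)
Lemma forward_flip_exists : (1 < n)%N -> no_common -> forward_flip n p.
Proof.
move=> n1 nc.
have fr d : cmul (cmul d (cconj uR)) uR = d.
  by case: d => x y; rewrite /cmul /cconj /uR /=; congr pair; ring.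
have strict i : (i < n)%N -> exists d, d != (0, 0) /\ contact p n (cmul d uR) i /\ forall j,
  contact p n (cmul d uR) j -> j = i.
  move=> hi; have [d hd] := ext hi.
  exists (cmul d (cconj uR)); rewrite fr; split; last split.
  - have [j hj ji] : exists2 j, (j < n)%N & j != i.
      by case: (eqVneq i 0%N) => [->|i0]; [exists 1%N | exists 0%N; rewrite 1?eq_sym].
    apply/eqP => h; have := hd j hj ji; rewrite -[d]fr h /dot /cmul /= !mul0r subr0 addr0 !mul0r
      addr0 ltxx //.
  - by split=> // j hj; case: (eqVneq j i) => [->//|ji]; apply/ltW/hd.
  - move=> j [hj H]; apply/eqP; apply: contraT => ji.
    by have := hd j hj ji; rewrite ltNge H.
have hS : (0 < n)%N by [].
have hE : (n.-1 < n)%N by lia.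
have [x [x0 [tx _]]] := strict _ hS; have [y [y0 [ty uy]]] := strict _ hE.
have Px : early x.
  by have [j tj] := contact_exists p (cmul x uL) n0; exists 0%N, j.
have Py : ~ early y.
  move=> [i [j [ti tj ij]]]; have ei := uy _ ti.
  have ej : j = n.-1 by case: (tj) => hj _; move: ij; rewrite ei; lia.
  by apply: (nc y n.-1 y0 ty); rewrite -ej.
have sc k v : 0 < k -> early (scl k v) -> early v.
  have cs V : cmul (scl k v) V = scl k (cmul v V) by rewrite /cmul /scl /=; congr pair; ring.
  move=> k0 [i [j []]]; rewrite !cs => /(contact_scl _ _ k0) ti /(contact_scl _ _ k0) tj ij.
  by exists i, j.
have [e0 [e1 [d01 P0 P1]]] := ccw_chain x0 sc Px Py y0.
exact: (flip_between nc d01 P0 P1).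
Qed.
End Flips.

Section Finite.
Variable R : realType.
Notation uR := (uR R). Notation uL := (uL R). Notation uB := (uB R).
Notation Kbound := (Kbound R).
Variables (n : nat) (rho : R).

Lemma no_common_rev (p : nat -> R * R) : no_common p n -> no_common (backward n p) n.
Proof.
move=> nc v i v0 ti tj; have hi : (i < n)%N by case: ti.
by apply: (nc v (n.-1 - i)%N v0); apply/(contact_rev p _ hi).
Qed.

(** If one point touches both legs, the three terms of the width inequality collapse to
    the base normal applied to one displacement, and twice the base normal still has norm
    at most [Kbound]. *)
Lemma common_contact_bound (p : nat -> R * R) : (0 < n)%N -> wide p n rho -> ~ no_common p n ->
  2%:R * rho <= Kbound * path_length p n.
Proof.
move=> n0 wd nnc.
have [v [i [v0 [ti tj]]]] : exists v i, v != (0, 0) /\ contact p n (cmul v uR) i /\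
  contact p n (cmul v uL) i.
  apply: contrapT => h; apply: nnc => v i v0 ti tj; apply: h.
  by exists v, i.
have [e [e1 He]] := unit_frame p n v0.
have [k tk] := contact_exists p (cmul e uB) n0.
have := wd e i i k e1 (He _ _ ti) (He _ _ tj) tk.
pose W : seq (nat * (R * R)) := [:: (i, scl (-2) (cmul e uB)); (k, scl 2 (cmul e uB))].
have hW : all (fun x => x.1 < n)%N W.
  by rewrite /W /= andbT; apply/andP; split; [case: ti | case: tk].
have BB : dot (cmul e uB) (cmul e uB) = base_sq R.
  by have [_ _] := legbase_cmul e1 (leg_pair_legbase (or_introl erefl : leg_pair uR uL)).
have hb k' : dot (partial_sum W k') (partial_sum W k') <= Kbound ^+ 2.
  rewrite /W !partial_sum_cons partial_sum_nil /vadd.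
  have K4 := Kbound2_ge_4base_sq R; have b0 := base_sq_ge0 R.
  have d4 : dot (scl 2 (cmul e uB)) (scl 2 (cmul e uB)) =
    4%:R * base_sq R by rewrite -BB /dot /scl /=; ring.
  have d4' : dot (scl (-2) (cmul e uB)) (scl (-2) (cmul e uB)) =
    4%:R * base_sq R by rewrite -BB /dot /scl /=; ring.
  have K0 : 0 <= Kbound ^+ 2 by lra.
  case: ifP => _; case: ifP => _; rewrite ?[(0, 0).1]/= ?[(0, 0).2]/= ?addr0 ?add0r.
  - by rewrite /dot /scl /= !mulNr !addNr !mul0r addr0.
  - by rewrite -[(_, _)]/(scl (-2) (cmul e uB)) d4'.
  - by rewrite -[(_, _)]/(scl 2 (cmul e uB)) d4.
  - by rewrite /dot /= !mul0r addr0.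
have tot : partial_sum W n = (0, 0).
  rewrite /W !partial_sum_cons partial_sum_nil /vadd /=; case: (ti) => /ltnW -> _;
    case: (tk) => /ltnW -> _.
  by rewrite /= !addr0 !mulNr !addNr.
have := calibration p (Kbound_ge0 R) n0 hW hb tot.
rewrite /W !big_cons big_nil /= addr0 => h1 h2.
apply: le_trans h1; move: h2.
rewrite !dot_scl.
have -> : dot (cmul e uR) (p i) = - dot (cmul e uL) (p i) - dot (cmul e uB) (p i).
  by rewrite /dot /cmul /uR /uL /uB /=; ring.
lra.
Qed.

Theorem finite_bound (p : nat -> R * R) : (0 < n)%N -> exposed p n -> two_opt p n -> wide p n rho ->
  2%:R * rho <= Kbound * path_length p n.
Proof.
move=> n0 ext opt wd.
have [nc|nnc] := pselect (no_common p n); last exact: common_contact_bound.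
have [n1|n1] := ltnP 1 n.
  apply: (flips_bound ext opt wd); first exact: forward_flip_exists.
  apply: backward_flip_of_reversed; apply: forward_flip_exists => //; first exact: exposed_rev.
  exact: no_common_rev.
apply: common_contact_bound => // nc'.
have t0 V : contact p n V 0%N.
  by split=> // j hj; have -> : j = 0%N by lia.
apply: (nc' (1, 0) 0%N) => //.
by rewrite -pair_eqE /= oner_eq0.
Qed.
End Finite.

(** * Reduction of polygons to minimal ones *)

Section Polygons.
Variable R : realType.
Implicit Types (u v e x y : R * R) (q s t : seq (R * R)).
Notation uR := (uR R). Notation uL := (uL R). Notation uB := (uB R).
Notation Kbound := (Kbound R).

Fixpoint polyline_from x s : R := if s is y :: s' then dist y x + polyline_from y s' else 0.
Definition polyline_length s : R := if s is x :: s' then polyline_from x s' else 0.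

Lemma polyline_from_cat x s t : polyline_from x (s ++ t) =
  polyline_from x s + polyline_from (last x s) t.
Proof. by elim: s x => [|y s IH] x /=; rewrite ?add0r // IH addrA. Qed.

Lemma polyline_from_ge0 x s : 0 <= polyline_from x s.
Proof. by elim: s x => [|y s IH] x //=; rewrite addr_ge0 ?dist_ge0. Qed.

Lemma dist_tri x y z : dist x z <= dist x y + dist y z.
Proof.
have d1 := dist_ge0 x y; have d2 := dist_ge0 y z; have d3 := dist_ge0 x z.
have [->//|z1] := eqVneq (dist x z) 0; first by rewrite addr_ge0.
have z0 : 0 < dist x z by rewrite lt_neqAle eq_sym z1.
rewrite -(ler_pM2l z0) mulrDr -[X in X <= _]expr2 sqr_dist.
have h : dot (vsub x z) (vsub x z) <= dist x z ^+ 2 by rewrite sqr_dist.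
have e : dot (vsub x z) (vsub x z) = dot (vsub x z) (vsub x y) + dot (vsub x z) (vsub y z).
  by rewrite /dot /vsub /=; ring.
rewrite e; apply: lerD; exact: dot_le_dist.
Qed.

Lemma polyline_from_head x y s : polyline_from x s <= dist y x + polyline_from y s.
Proof.
case: s => [|z s] /=; first by rewrite addr0 dist_ge0.
by rewrite addrA lerD2r addrC dist_tri.
Qed.

Lemma polyline_from_subseq x s t : subseq s t -> polyline_from x s <= polyline_from x t.
Proof.
elim: t x s => [|y t IH] x [|z s] //= h; first by rewrite addr_ge0 ?dist_ge0 ?polyline_from_ge0.
move: h; case: eqP => [<-|_] h; first by rewrite lerD2l IH.
by apply: (le_trans (polyline_from_head x y (z :: s))); rewrite lerD2l; exact: IH y _ h.
Qed.

Lemma polyline_length_subseq s t : subseq s t -> polyline_length s <= polyline_length t.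
Proof.
elim: t s => [|y t IH] [|z s] //= h; first exact: polyline_from_ge0.
move: h; case: eqP => [<-|_] h; first exact: polyline_from_subseq.
apply: le_trans (IH _ h) _; case: t {h IH} => //= a t; by rewrite lerDr dist_ge0.
Qed.

Lemma path_length_polyline d s : path_length (nth d s) (size s) = polyline_length s.
Proof.
rewrite /path_length; case: s => [|x s] /=; first by rewrite big_geq.
elim: s x => [|y s IH] x; first by rewrite /= big_geq.
by rewrite big_nat_recl //= -IH.
Qed.

Lemma polyline_length_cat x s y t : polyline_length (x :: s ++ y :: t) =
  polyline_length (x :: s) + dist y (last x s) + polyline_length (y :: t).
Proof. by rewrite /= polyline_from_cat /= addrA. Qed.

Lemma eq_path_length (p p' : nat -> R * R) n : (forall k, (k < n)%N -> p k = p' k) ->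
  path_length p n = path_length p' n.
Proof.
move=> h; rewrite /path_length big_nat [RHS]big_nat; apply: eq_bigr => k hk.
by rewrite !h //; lia.
Qed.

Lemma polyline_length_rev s : polyline_length (rev s) = polyline_length s.
Proof.
have [/size0nil->//|s0] := eqVneq (size s) 0%N.
rewrite -!(path_length_polyline (0, 0)) size_rev -[RHS](path_length_rev _ (n := size s)) ?lt0n //.
by apply: eq_path_length => k hk; rewrite nth_rev //; congr nth; lia.
Qed.

Definition wide_set (rho : R) q :=
  forall e, dot e e = 1 -> exists a b c, [/\ a \in q, b \in q & c \in q] /\
  rho <= dot (cmul e uR) a + dot (cmul e uL) b + dot (cmul e uB) c.

Lemma wide_set_sub (rho : R) q q' : {subset q <= q'} -> wide_set rho q -> wide_set rho q'.
Proof.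
move=> h H e e1; have [a [b [c [[ha hb hc] l]]]] := H e e1.
by exists a, b, c; split=> //; split; apply: h.
Qed.

Lemma wide_of_wide_set (rho : R) q d : wide_set rho q -> wide (nth d q) (size q) rho.
Proof.
move=> H e i j k e1 [_ hi] [_ hj] [_ hk].
have [a [b [c [[ha hb hc] l]]]] := H e e1.
have le V x m : x \in q -> (forall j, (j < size q)%N ->
  dot V (nth d q j) <= dot V (nth d q m)) -> dot V x <= dot V (nth d q m).
  by move=> /(nthP d)[t ht <-]; apply.
by apply: (le_trans l); apply: lerD; [apply: lerD|]; apply: le.
Qed.

(** Dropping a point loses width in some position of the triangle, and there it is the
    only contact with one of the sides. *)
Lemma exposed_of_minimal (rho : R) q d : wide_set rho q ->
  (forall i, (i < size q)%N -> ~ wide_set rho (take i q ++ drop i.+1 q)) ->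
    exposed (nth d q) (size q).
Proof.
move=> H mn i hi; apply: contrapT => nex; apply: (mn i hi) => e e1.
have [a [b [c [[ha hb hc] l]]]] := H e e1.
have sub V x : x \in q -> exists2 y, y \in take i q ++ drop i.+1 q &
  dot (cmul e V) x <= dot (cmul e V) y.
  move=> /(nthP d)[t ht <-].
  have mem j : (j < size q)%N -> j != i -> nth d q j \in take i q ++ drop i.+1 q.
    move=> hj ji; rewrite mem_cat; have [lt|ge] := ltnP j i.
      by rewrite -(nth_take d lt) mem_nth // size_take hi.
    have -> : nth d q j = nth d (drop i.+1 q) (j - i.+1) by rewrite nth_drop; congr nth; lia.
    have lt : (i < j)%N by rewrite ltn_neqAle eq_sym ji.
    by rewrite mem_nth ?orbT // size_drop; apply: ltn_sub2r (leq_ltn_trans lt hj) hj.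
  have [ti|ti] := eqVneq t i; last by exists (nth d q t); rewrite ?mem.
  rewrite ti; apply: contrapT => nex2; apply: nex; exists (cmul e V) => j hj ji.
  rewrite ltNge; apply/negP => le; apply: nex2; exists (nth d q j) => //; exact: mem.
have [a' ha' la] := sub uR _ ha; have [b' hb' lb] := sub uL _ hb; have [c' hc' lc] := sub uB _ hc.
by exists a', b', c'; split=> //; apply: (le_trans l); apply: lerD => //; apply: lerD.
Qed.

(** Reversing a block of the sequence rearranges it. *)
Lemma two_opt_of_minimal q d : (forall q', perm_eq q q' ->
  polyline_length q <= polyline_length q') -> two_opt (nth d q) (size q).
Proof.
move=> mn i j ij jn.
pose a := take i.+1 q; pose b := take (j - i) (drop i.+1 q); pose c := drop j.+1 q.
have qE : q = a ++ b ++ c.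
  rewrite -[LHS](cat_take_drop i.+1); congr (_ ++ _).
  rewrite -[LHS](cat_take_drop (j - i)); congr (_ ++ _).
  by rewrite drop_drop; congr drop; lia.
have sa : size a = i.+1 by rewrite size_take; case: ltnP; lia.
have sb : size b = (j - i)%N by rewrite size_take size_drop; case: ltnP; lia.
have key (u v w : seq (R * R)) : u != [::] -> v != [::] -> w != [::] ->
  polyline_length (u ++ v ++ w) =
   polyline_length u + dist (head d v) (last d u) + polyline_length v + dist (head d w)
     (last d v) + polyline_length w.
  case: u => [|x u] //; case: v => [|y v] //; case: w => [|z w] // _ _ _.
  by rewrite !cat_cons !polyline_length_cat /= !addrA.
have perm : perm_eq q (a ++ rev b ++ c).
  by rewrite {1}qE perm_cat2l perm_cat2r perm_sym perm_rev.
have := mn _ perm; rewrite {1}qE.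
have a0 : a != [::] by rewrite -size_eq0 sa.
have b0 : b != [::] by rewrite -size_eq0 sb -lt0n subn_gt0.
have c0 : c != [::] by rewrite -size_eq0 size_drop -lt0n subn_gt0.
have rb0 : rev b != [::] by rewrite -size_eq0 size_rev size_eq0.
rewrite !key // polyline_length_rev.
have la : last d a = nth d q i by rewrite -nth_last sa nth_take.
have hb : head d b = nth d q i.+1 by rewrite -nth0 nth_take ?subn_gt0 // nth_drop addn0.
have lb : last d b = nth d q j by rewrite -nth_last sb nth_take ?nth_drop; try (congr nth); lia.
have hc : head d c = nth d q j.+1 by rewrite -nth0 nth_drop addn0.
have hrb : head d (rev b) = last d b by rewrite -nth0 nth_rev ?sb ?subn_gt0 // -nth_last sb subn1.
have lrb : last d (rev b) = head d b by rewrite -{2}[b]revK -!nth0 nth_rev ?size_rev ?sb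
  ?subn_gt0 // -nth_last size_rev sb subn1.
rewrite hrb lrb la hb lb hc.
rewrite [dist (nth d q i) _]dist_sym [dist (nth d q j) (nth d q j.+1)]dist_sym.
rewrite [dist (nth d q i) _]dist_sym [dist (nth d q i.+1) (nth d q j.+1)]dist_sym; lra.
Qed.

Lemma tuple_of_subset q s k : {subset s <= q} -> size s = k ->
  exists t : k.-tuple (seq_sub q), map (@ssval _ q) t = s.
Proof.
elim: s k => [|x s IH] k hs; first by move=> <-; exists [tuple].
case: k => // k [sz]; have [|t ht] := IH k _ sz.
  by move=> y hy; apply: hs; rewrite inE hy orbT.
have hx : x \in q by apply: hs; rewrite inE eqxx.
by exists [tuple of SeqSub hx :: t]; rewrite /= ht.
Qed.

(** Among the wide sets of points of [q] with a path no longer than that of [q], take one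
    with the fewest points, and then the shortest path through that many points: the first
    choice makes the points exposed, the second makes the path 2-optimal. *)
Theorem polygon_bound (rho : R) q : wide_set rho q -> 2%:R * rho <= Kbound * polyline_length q.
Proof.
move=> Gq; pose L0 := polyline_length q; pose d : R * R := (0, 0).
pose ok s := [/\ {subset s <= q}, wide_set rho s & polyline_length s <= L0].
have exk : exists k, `[< exists s, ok s /\ size s = k >].
  by exists (size q); apply/asboolP; exists q; split=> //; split=> //; exact: lexx.
have [k /asboolP[s0 [isok0 sz0]] mk] := ex_minnP exk.
pose v (t : k.-tuple (seq_sub q)) := map (@ssval _ q) t.
have back s : {subset s <= q} -> size s = k -> exists t : k.-tuple (seq_sub q), v t = s.
  by move=> hs sz; apply: tuple_of_subset.
have [t0 vt0] := back s0 (let: And3 h _ _ := isok0 in h) sz0.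
have Pt0 : `[< ok (v t0) >] by apply/asboolP; rewrite vt0.
have [t /asboolP okt mint] := @arg_minP _ R _ t0 (fun t : k.-tuple (seq_sub q) => `[< ok
  (v t) >]) (fun t : k.-tuple (seq_sub q) => polyline_length (v t)) Pt0.
have szt : size (v t) = k by rewrite size_map size_tuple.
have [sub Gt lt] := okt.
have ext : exposed (nth d (v t)) (size (v t)).
  apply: exposed_of_minimal Gt _ => i hi Gi.
  have sb : subseq (take i (v t) ++ drop i.+1 (v t)) (v t).
    rewrite -[X in subseq _ X](cat_take_drop i); apply: cat_subseq => //.
    by rewrite -[i.+1]add1n -drop_drop; apply: drop_subseq.
  have : (k <= size (take i (v t) ++ drop i.+1 (v t)))%N.
    apply: mk; apply/asboolP; exists (take i (v t) ++ drop i.+1 (v t)); split=> //; split=> //.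
      by move=> x /(mem_subseq sb) /sub.
    exact: le_trans (polyline_length_subseq sb) lt.
  by rewrite size_cat size_take size_drop hi szt; move: hi; rewrite szt; lia.
have opt : two_opt (nth d (v t)) (size (v t)).
  apply: two_opt_of_minimal => s' pm; rewrite leNgt; apply/negP => lt'.
  have sub' : {subset s' <= q} by move=> x; rewrite -(perm_mem pm); exact: sub.
  have [t' vt'] := back s' sub' (etrans (esym (perm_size pm)) szt).
  have : `[< ok (v t') >].
    apply/asboolP; rewrite vt'; split=> //; last exact: ltW (lt_le_trans lt' lt).
    by apply: wide_set_sub Gt => x; rewrite (perm_mem pm).
  by move/mint; rewrite vt' leNgt lt'.
have n0 : (0 < size (v t))%N.
  have one1 : dot (1, 0) ((1, 0) : R * R) = 1 by rewrite /dot /= mulr1 mulr0 addr0.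
  by have [a [b [c [[ha _ _] _]]]] := Gt _ one1; case: (v t) ha.
have := finite_bound n0 ext opt (@wide_of_wide_set _ _ d Gt).
rewrite path_length_polyline => h; apply: le_trans h _; rewrite ler_wpM2l ?Kbound_ge0 //.
Qed.
End Polygons.

(** * Interior of the triangle *)

Section Hull.
Variable R : realType.

Lemma convex_comb (A : set (plane R)) (a b : plane R) (t : R) : @convex_set R (plane R) A ->
  A a -> A b -> 0 <= t <= 1 -> A (t * a.1 + (1 - t) * b.1, t * a.2 + (1 - t) * b.2).
Proof.
move=> cA Aa Ab /andP[t0 t1].
by have := cA a b (Itv01 t0 t1); rewrite !inE => /(_ Aa Ab).
Qed.

Lemma open_triangle_interior (s c : R) (x : plane R) : 0 < s -> 0 < c ->
  s * x.1 + c * x.2 < s * c -> - s * x.1 + c * x.2 < s * c -> 0 < x.2 ->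
  interior (convex_hull [set (- c, 0); (c, 0); (0, s)]) x.
Proof.
move=> s0 c0 h1 h2 h3.
have inhull (y : plane R) : s * y.1 + c * y.2 < s * c -> - s * y.1 + c * y.2 < s * c -> 0 < y.2 ->
    convex_hull [set (- c, 0); (c, 0); (0, s)] y.
  move=> g1 g2 g3 A [cA sA].
  have A1 : A (- c, 0) by apply: sA; left; left.
  have A2 : A (c, 0) by apply: sA; left; right.
  have A3 : A (0, s) by apply: sA; right.
  have lt : y.2 < s by rewrite -(ltr_pM2l c0) [c * s]mulrC; lra.
  have nz : s - y.2 != 0 by rewrite subr_eq0 gt_eqF.
  have d0 : 0 < s - y.2 by rewrite subr_gt0.
  pose m := s * y.1 / (s - y.2).
  have mE : m * (s - y.2) = s * y.1 by rewrite /m divfK.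
  have mc : m < c by rewrite /m ltr_pdivrMr //; lra.
  have mc' : - c < m by rewrite /m ltr_pdivlMr //; lra.
  have sn : s != 0 by rewrite gt_eqF.
  have cn : c != 0 by rewrite gt_eqF.
  have Am : A (m, 0).
    have := @convex_comb A (c, 0) (- c, 0) ((m + c) / (2%:R * c)) cA A2 A1.
    rewrite /= !mulr0 addr0.
    have -> : (m + c) / (2%:R * c) * c + (1 - (m + c) / (2%:R * c)) * - c = m by field.
    apply; rewrite divr_ge0 ?mulr_ge0 //=; try lra.
    by rewrite ler_pdivrMr ?mulr_gt0 //; lra.
  have := @convex_comb A (0, s) (m, 0) (y.2 / s) cA A3 Am.
  have -> : y.2 / s * (0, s).1 + (1 - y.2 / s) * (m, (0:R)).1 = y.1.
    rewrite /= mulr0 add0r; apply: (mulfI sn); rewrite -mE; field => //.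
  have -> : y.2 / s * ((0:R), s).2 + (1 - y.2 / s) * (m, (0:R)).2 = y.2.
    by rewrite /= mulr0 addr0 divfK.
  rewrite -surjective_pairing; apply.
  by rewrite divr_ge0 ?(ltW g3) ?(ltW s0) //= ler_pdivrMr // mul1r ltW.
pose d1 := s * c - (s * x.1 + c * x.2); pose d2 := s * c - (- s * x.1 + c * x.2).
have d10 : 0 < d1 by rewrite subr_gt0.
have d20 : 0 < d2 by rewrite subr_gt0.
pose r := Num.min x.2 (Num.min (d1 / (s + c)) (d2 / (s + c))).
have sc : 0 < s + c by rewrite addr_gt0.
have r0 : 0 < r by rewrite !lt_min h3 !divr_gt0.
apply/nbhs_ballP; exists r => //= y [].
rewrite -!ball_normE /= => b1 b2.
have [r1 r2] : r * (s + c) <= d1 /\ r * (s + c) <= d2.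
  by split; rewrite -ler_pdivlMr // !ge_min lexx ?orbT.
have r3 : r <= x.2 by rewrite !ge_min lexx.
have {b1}[b1 b1'] : x.1 - y.1 < r /\ - r < x.1 - y.1 by move: b1; rewrite ltr_norml => /andP[].
have {b2}[b2 b2'] : x.2 - y.2 < r /\ - r < x.2 - y.2 by move: b2; rewrite ltr_norml => /andP[].
have p1 := mulr_gt0 s0 (_ : 0 < r - (x.1 - y.1)).
have p2 := mulr_gt0 s0 (_ : 0 < r + (x.1 - y.1)).
have p4 := mulr_gt0 c0 (_ : 0 < r + (x.2 - y.2)).
have {}p1 := p1 ltac:(lra). have {}p2 := p2 ltac:(lra). have {}p4 := p4 ltac:(lra).
apply: inhull; move: r1 r2; rewrite /d1 /d2; lra.
Qed.

Lemma angle_exists (u : R * R) : dot u u = 1 -> exists theta : R,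
  cos theta = u.1 /\ sin theta = u.2.
Proof.
rewrite /dot -!expr2 => h.
have h1 : -1 <= u.1 <= 1 by apply/andP; split; have := sqr_ge0 u.2; nra.
have := sin_acos h1; rewrite (_ : 1 - u.1 ^+ 2 = u.2 ^+ 2); last by rewrite -h; ring.
rewrite sqrtr_sqr => sE.
have cE : cos (acos u.1) = u.1 by apply: acosK; rewrite in_itv.
have [g|g] := lerP 0 u.2.
  by exists (acos u.1); rewrite cE sE ger0_norm.
by exists (- acos u.1); rewrite cosN sinN cE sE ltr0_norm // opprK.
Qed.
End Hull.

(** * Curves that do not fit *)

Section Arc.
Variable R : realType.
Notation uR := (uR R). Notation uL := (uL R). Notation uB := (uB R).
Notation Kbound := (Kbound R).
Notation apex_sin := (apex_sin R).
Notation apex_cos := (apex_cos R).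
Variable gamma : R -> plane R.

Section Length.
Variable L : R.
Hypothesis hL : (len gamma <= L%:E)%E.

Lemma polygonal_lengthE t : polygonal_length 0 1 gamma t = polyline_length (map gamma (0 :: t)).
Proof.
rewrite -(path_length_polyline (0, 0)) size_map.
rewrite (@eq_path_length _ _ (fun k => gamma (nth 1 (0 :: t) k))); first by [].
by move=> k hk; rewrite (nth_map 1).
Qed.

Lemma inscribed_polyline_le s : sorted <%R s -> all (fun x => 0 <= x <= 1) s ->
  polyline_length (map gamma s) <= L.
Proof.
move=> ss /allP hs.
pose t := rcons [seq x <- s | 0 < x < 1] 1.
have st : sorted <%R (0 :: t).
  rewrite lt_sorted_pairwise /= pairwise_rcons all_rcons ltr01 /=.
  have sf : pairwise <%R [seq x <- s | 0 < x < 1] by rewrite -lt_sorted_pairwise lt_sorted_filter.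
  rewrite sf andbT; apply/andP; split.
    by apply/allP => x; rewrite mem_filter => /andP[/andP[]].
  by apply/allP => x; rewrite mem_filter => /andP[/andP[]].
have sub : subseq s (0 :: t).
  have -> : s = [seq x <- 0 :: t | x \in s].
    apply: lt_sorted_eq => //; first exact: lt_sorted_filter.
    move=> x; rewrite mem_filter inE mem_rcons inE mem_filter.
    have [xs /=|//] := boolP (x \in s); apply/esym.
    have /andP[] :=
      hs x xs; rewrite !le_eqVlt eq_sym => /orP[->//|->] /orP[->|->]; rewrite ?orbT //.
  exact: filter_subseq.
apply: le_trans (polyline_length_subseq (map_subseq gamma sub)) _.
rewrite -polygonal_lengthE -lee_fin; apply: le_trans hL.
apply: ereal_sup_ubound; exists t => //; split; last by rewrite last_rcons.
by move: st.
Qed.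

Definition separated eps s := [/\ uniq s, all (fun x : R => 0 <= x <= 1) s &
  forall x y, x \in s -> y \in s -> x != y -> eps <= dist (gamma x) (gamma y)].

Lemma separated_polyline_ge eps s : separated eps s ->
  (size s).-1%:R * eps <= polyline_length (map gamma s).
Proof.
case: s => [|x s] [us _ hs]; first by rewrite mul0r.
elim: s x us hs => [|y s IH] x us hs; first by rewrite mul0r.
have -> : (size (x :: y :: s)).-1%:R * eps = eps + (size (y :: s)).-1%:R * eps.
  by rewrite /= -natr1 mulrDl mul1r addrC.
case/andP: us => xn us; apply: lerD.
  rewrite dist_sym; apply: hs; rewrite ?inE ?eqxx ?orbT //.
  by move: xn; rewrite inE negb_or => /andP[].
by apply: IH => // u v hu hv; apply: hs; rewrite inE ?hu ?hv orbT.
Qed.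

Lemma separated_size eps s : 0 < eps -> separated eps s -> (size s).-1%:R * eps <= L.
Proof.
move=> e0 [us hs sep]; pose s' := sort <=%R s.
have ss' : separated eps s'.
  split; first by rewrite sort_uniq.
    by rewrite all_sort.
  by move=> x y; rewrite !mem_sort; exact: sep.
have := separated_polyline_ge ss'; rewrite size_sort => h; apply: le_trans h _.
apply: inscribed_polyline_le; last by rewrite all_sort.
by rewrite sort_lt_sorted.
Qed.

(** A separated set of times with the most elements; visited in order, its points span a
    polyline with steps of length at least [eps], which bounds their number. *)
Lemma eps_net eps : 0 < eps -> exists s, [/\ sorted <%R s, all (fun x => 0 <= x <= 1) s &
  forall t, 0 <= t <= 1 -> exists2 x, x \in s & dist (gamma t) (gamma x) < eps].
Proof.
move=> e0.
have ex0 : exists k, `[< exists s, separated eps s /\ size s = k >].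
  by exists 0%N; apply/asboolP; exists [::].
have L0 : 0 <= L by have := @inscribed_polyline_le [::] isT isT.
have bd k : `[< exists s, separated eps s /\ size s = k >] -> (k <= (Num.bound (L / eps)).+1)%N.
  move=> /asboolP[s [sp sz]]; have := separated_size e0 sp.
  rewrite -ler_pdivlMr // sz => h.
  have := le_lt_trans h (archi_boundP (divr_ge0 L0 (ltW e0))).
  by rewrite ltr_nat; case: k {h sz} => //= k; rewrite ltnS => /ltnW.
have [k /asboolP[s [[us hs sep] sz]] mk] := ex_maxnP ex0 bd.
exists (sort <=%R s); split; rewrite ?sort_lt_sorted ?all_sort //.
move=> t ht; apply: contrapT => nex.
have far x : x \in s -> eps <= dist (gamma t) (gamma x).
  by move=> xs; rewrite leNgt; apply/negP => lt; apply: nex; exists x; rewrite ?mem_sort.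
have : (k.+1 <= k)%N; last by rewrite ltnn.
apply: mk; apply/asboolP; exists (t :: s); split; last by rewrite /= sz.
have tn : t \notin s.
  apply/negP => ts; have := far t ts.
  by rewrite leNgt /dist !subrr expr0n /= addr0 sqrtr0 e0.
split; rewrite /= ?tn ?ht //.
move=> x y; rewrite !inE => /orP[/eqP->|xs] /orP[/eqP->|ys] xy; first by rewrite eqxx in xy.
- exact: far.
- by rewrite dist_sym; exact: far.
- exact: sep.
Qed.
End Length.

(** Translate the rotated curve so that its support lines parallel to the legs lie just
    inside the legs of the triangle; the hypothesis says that the base is then out of
    reach. *)
Lemma fits_inside (s c : R) (e : R * R) (delta : R) : 0 < s -> 0 < c -> s ^+ 2 + c ^+ 2 = 1 ->
  apex_sin = 2%:R * s * c -> apex_cos = s ^+ 2 - c ^+ 2 -> dot e e = 1 -> 0 < delta ->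
  (forall a b d, 0 <= a <= 1 -> 0 <= b <= 1 -> 0 <= d <= 1 ->
    dot (cmul e uR) (gamma a) + dot (cmul e uL) (gamma b) + dot (cmul e uB)
      (gamma d) < apex_sin - delta) ->
  exists (z : plane R) (theta : R), forall t, 0 <= t <= 1 ->
    interior (convex_hull [set (- c, 0); (c, 0); (0, s)]) (z + rotation theta (gamma t)).
Proof.
move=> s0 c0 sc1 wE cE e1 d0 H.
pose f V t := dot (cmul e V) (gamma t).
have I0 : 0 <= (0 : R) <= 1 by rewrite lexx ler01.
pose S V : set R := [set f V t | t in [set t | 0 <= t <= 1]].
have ne V : S V !=set0 by exists (f V 0), 0.
pose h V := sup (S V).
have HRLB : h uR + h uL + h uB <= apex_sin - delta.
  have k1 b d : 0 <= b <= 1 -> 0 <= d <= 1 -> h uR <= apex_sin - delta - f uL b - f uB d.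
    by move=> hb hd; apply: ge_sup => // _ [a ha <-]; have := H a b d ha hb hd; rewrite /f; lra.
  have k2 d : 0 <= d <= 1 -> h uL <= apex_sin - delta - h uR - f uB d.
    by move=> hd; apply: ge_sup => // _ [b hb <-]; have := k1 b d hb hd; lra.
  suff : h uB <= apex_sin - delta - h uR - h uL by lra.
  by apply: ge_sup => // _ [d hd <-]; have := k2 d hd; lra.
have ub V t : V = uR \/ V = uL \/ V = uB -> 0 <= t <= 1 -> f V t <= h V.
  move=> hV ht; apply: ub_le_sup; last by exists t.
  exists (apex_sin - delta - (f uR 0 + f uL 0 + f uB 0) + f V 0) => _ [a ha <-].
  by case: hV => [->|[->|->]]; [have := H a 0 0 ha I0 I0|have := H 0 a 0 I0 ha I0|have := H 0 0 a
    I0 I0 ha]; rewrite /f; lra.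
pose r := cmul (- c, s) (cconj e).
have rho1 : dot (- c, s) (- c, s) = 1 by rewrite -sc1 /dot /=; ring.
have r1 : dot r r = 1 by rewrite /r dot_cmul2 rho1 dot_cconj e1 mulr1.
have [theta [ct st]] := angle_exists r1.
(* half of the spare width delta is left at the base, and a quarter at each leg *)
pose z : plane R :=
  ((h uL - h uR) / (2%:R * s), (2%:R * s * c - h uR - h uL - delta / 2%:R) / (2%:R * c)).
exists z, theta => t ht.
have rot : rotation theta (gamma t) = cmul r (gamma t) by rewrite /rotation ct st.
have val V : dot (cmul (- c, s) V) (cmul r (gamma t)) = f V t.
  by rewrite /r -cmulA dot_cmul2 rho1 mul1r /f dot_cmul.
have vR := val uR; have vL := val uL; have vB := val uB.
have uRE : cmul (- c, s) uR = (s, c) by rewrite /cmul /uR /=; congr pair; ring.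
have uLE : cmul (- c, s) uL = (- s, c).
  rewrite /cmul /uL /= wE cE; congr pair.
    by transitivity (- s * (s ^+ 2 + c ^+ 2)); [ring | rewrite sc1 mulr1].
  by transitivity (c * (s ^+ 2 + c ^+ 2)); [ring | rewrite sc1 mulr1].
have uBE : cmul (- c, s) uB = (0, - 2%:R * c).
  have -> : uB = (- uR.1 - uL.1, - uR.2 - uL.2) by rewrite /uR /uL /uB /=; congr pair; ring.
  have -> : cmul (- c, s) (- uR.1 - uL.1, - uR.2 - uL.2) =
    (- (cmul (- c, s) uR).1 - (cmul (- c, s) uL).1, - (cmul (- c, s) uR).2 - (cmul (- c, s) uL).2).
    by rewrite /cmul /=; congr pair; ring.
  by rewrite uRE uLE /=; congr pair; ring.
rewrite uRE in vR; rewrite uLE in vL; rewrite uBE in vB.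
have bR := ub uR t (or_introl erefl) ht.
have bL := ub uL t (or_intror (or_introl erefl)) ht.
have bB := ub uB t (or_intror (or_intror erefl)) ht.
rewrite rot; move: (cmul r (gamma t)) vR vL vB => x; rewrite /dot /= => vR vL vB.
have sn : s != 0 by rewrite gt_eqF.
have cn : c != 0 by rewrite gt_eqF.
have z1 : s * z.1 = (h uL - h uR) / 2%:R by rewrite /z /=; field.
have z2 : c * z.2 = (2%:R * s * c - h uR - h uL - delta / 2%:R) / 2%:R by rewrite /z /=; field.
apply: open_triangle_interior => //; rewrite -?[(z + x).1]/(z.1 + x.1) -?[(z + x).2]/(z.2 + x.2)
  ?mulrDr ?mulNr.
- lra.
- lra.
- by rewrite -(pmulr_rgt0 _ c0) mulrDr z2; move: HRLB; rewrite wE; lra.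
Qed.
End Arc.

(** * The escape length *)

(** The curve is at least [apex_sin] wide in every position of the triangle, since it
    would fit inside otherwise; the points of a fine net are almost as wide. *)
Lemma escape_length_bound (R : realType) (s c : R) (gamma : R -> plane R) (L : R) :
  0 < s -> 0 < c -> s ^+ 2 + c ^+ 2 = 1 -> apex_sin R = 2%:R * s * c ->
    apex_cos R = s ^+ 2 - c ^+ 2 ->
  (len gamma <= L%:E)%E -> escape_path (convex_hull [set (- c, 0); (c, 0); (0, s)]) gamma ->
  2%:R * apex_sin R <= Kbound R * L.
Proof.
move=> s0 c0 sc1 wE cE hL [_ esc].
have bound eta : 0 < eta -> 2%:R * (apex_sin R - eta) <= Kbound R * L.
  move=> eta0; have eps0 : 0 < eta / 6%:R by rewrite divr_gt0 ?ltr0n.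
  have [t [st ht net]] := eps_net hL eps0.
  apply: le_trans (ler_wpM2l (Kbound_ge0 R) (inscribed_polyline_le hL st ht)).
  apply: polygon_bound => e e1.
  have near V a : dot V V <= 1 -> 0 <= a <= 1 -> exists2 x, x \in map gamma t &
      dot (cmul e V) (gamma a) <= dot (cmul e V) x + eta / 6%:R.
    move=> V1 /net[x xt lt]; exists (gamma x); first exact: map_f.
    have VV : dot (cmul e V) (cmul e V) <= 1 ^+ 2 by rewrite dot_cmul2 e1 mul1r expr1n.
    have := dot_le_dist (gamma a) (gamma x) ler01 VV; rewrite mul1r.
    have -> : dot (cmul e V) (vsub (gamma a) (gamma x)) =
      dot (cmul e V) (gamma a) - dot (cmul e V) (gamma x).
      by rewrite /dot /vsub /=; ring.
    lra.
  apply: contrapT => nG.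
  have dl : 0 < eta / 2%:R by rewrite divr_gt0 ?ltr0n.
  have [RL1 _ BB1] := leg_pair_legbase (or_introl erefl : leg_pair (uR R) (uL R)).
  have [LL1 _ _] := leg_pair_legbase (or_intror erefl : leg_pair (uL R) (uR R)).
  have BB : dot (uB R) (uB R) <= 1 by rewrite BB1 base_sq_def; lra.
  have RR : dot (uR R) (uR R) <= 1 by rewrite RL1.
  have LL : dot (uL R) (uL R) <= 1 by rewrite LL1.
  have small a b d : 0 <= a <= 1 -> 0 <= b <= 1 -> 0 <= d <= 1 ->
    dot (cmul e (uR R)) (gamma a) + dot (cmul e (uL R)) (gamma b) + dot (cmul e (uB R))
      (gamma d) < apex_sin R - eta / 2%:R.
    move=> ha hb hd; rewrite ltNge; apply/negP => h; apply: nG.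
    have [x hx lx] := near _ a RR ha.
    have [y hy ly] := near _ b LL hb.
    have [w hw lw] := near _ d BB hd.
    by exists x, y, w; split; [split | move: h lx ly lw; lra].
  have [z [theta zin]] := fits_inside s0 c0 sc1 wE cE e1 dl small.
  apply: (esc z theta) => _ [_ [a ha <-] <-]; apply: zin.
  by move: ha; rewrite /= in_itv.
rewrite leNgt; apply/negP => lt.
have := bound ((2%:R * apex_sin R - Kbound R * L) / 4%:R) _;
  rewrite divr_gt0 ?ltr0n ?subr_gt0 // => /(_ isT).
lra.
Qed.

Lemma escape_length_ge (R : realType) (s c : R) : s = 766%:R / Num.sqrt 625565%:R ->
  c = 197%:R / Num.sqrt 625565%:R ->
  let T : set (plane R) := convex_hull [set (- c, 0); (c, 0); (0, s)] in
  let D : R := 82074390584%:R / 84861020075%:R in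
  (D%:E <= escape_length T)%E.
Proof.
move=> sE cE; cbv zeta.
have N0 : 0 < Num.sqrt (625565%:R : R) by rewrite sqrtr_gt0 ltr0n.
have N2 : Num.sqrt (625565%:R : R) ^+ 2 = 625565%:R by rewrite sqr_sqrtr ?ler0n.
have s0 : 0 < s by rewrite sE divr_gt0 ?ltr0n.
have c0 : 0 < c by rewrite cE divr_gt0 ?ltr0n.
have s2 : s ^+ 2 = 766%:R ^+ 2 / 625565%:R by rewrite sE expr_div_n N2.
have c2 : c ^+ 2 = 197%:R ^+ 2 / 625565%:R by rewrite cE expr_div_n N2.
have scE : s * c = 766%:R * 197%:R / 625565%:R by rewrite sE cE mulf_div -expr2 N2.
clear sE cE N0 N2.
have sc1 : s ^+ 2 + c ^+ 2 = 1 by rewrite s2 c2; lra.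
have wE : apex_sin R = 2%:R * s * c by rewrite -mulrA scE apex_sin_def; lra.
have cbE : apex_cos R = s ^+ 2 - c ^+ 2 by rewrite s2 c2 apex_cos_def; lra.
apply: le_ereal_inf_tmp => _ [gamma esc <-].
have [lt|//] := ltP (len gamma) ((82074390584%:R / 84861020075%:R : R)%:E).
have low : ((polygonal_length 0 1 gamma [:: 1])%:E <= len gamma)%E.
  by apply: ereal_sup_ubound; exists [:: 1] => //; apply: itv_partition1.
move: lt low; case E : (len gamma) => [L| |] //.
have hL : (len gamma <= L%:E)%E by rewrite E lexx.
have := escape_length_bound s0 c0 sc1 wE cbE hL esc.
rewrite lte_fin apex_sin_def Kbound_def => h lt _.
exfalso; move: h lt; clear; lra.
Qed.

Theorem theorem7p1 (R : realType) :
  let s : R := 766%:R / Num.sqrt 625565%:R in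
  let c : R := 197%:R / Num.sqrt 625565%:R in
  let T : set (plane R) := convex_hull [set (- c, 0); (c, 0); (0, s)] in
  let D : R := 82074390584%:R / 84861020075%:R in
  (D%:E <= escape_length T)%E.
Proof. by cbv zeta; exact: escape_length_ge. Qed.
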